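(* Let $\Omega=\mathbb{C}\setminus\overline{G}$, where $G$ is a convex domain in $\mathbb{C}$, and let $f$ be a holomorphic function in $\Omega$ with bounded real part. Then for any point $z\in\Omega$ the inequality $$|f^{(s)}(z)|\le\frac{K_s}{d_z^{\,s}}\,\sup_\Omega|\Re f|,\qquad s=1,2,\dots,$$ holds with $d_z=\mathrm{dist}(z,\partial\Omega)$, where $$K_s=\frac{s!}{\pi}\max_{\alpha}\int_{-\pi/2}^{\pi/2}\bigl|\cos\bigl(\alpha+(s+1)\varphi\bigr)\bigr|\cos^{s-1}\varphi\,d\varphi$$ (the maximum being over real $\alpha$) is the best constant in the inequality $$|f^{(s)}(z)|\le\frac{K_s}{(\Im z)^s}\,\|\Re f\|_{L^\infty(\partial\mathbb{C}_+)}$$ for holomorphic functions $f$ in the half-plane $\mathbb{C}_+=\{z\in\mathbb{C}:\Im z>0\}$ with bounded real part (and all $z\in\mathbb{C}_+$). In particular, $$K_{2l+1}=\frac{2[(2l+1)!!]^2}{\pi(2l+1)}\quad(l=0,1,2,\dots),\qquad K_2=\frac{3\sqrt3}{2\pi},\qquad K_4=\frac{3(16+5\sqrt5)}{4\pi}.$$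
   Context: $\Re f$ and $\Im z$ denote real and imaginary parts. $\|\Re f\|_{L^\infty(\partial\mathbb{C}_+)}$ is the essential supremum over the real line $\partial\mathbb{C}_+$ of the modulus of the boundary values of the bounded harmonic function $\Re f$. $(2l+1)!!=1\cdot3\cdots(2l+1)$. *)

(* Defs.v *)
From HB Require Import structures.
From mathcomp Require Import all_boot all_order all_algebra.
From mathcomp Require Import all_classical all_reals all_analysis.
From mathcomp Require Import complex.

Set Implicit Arguments.
Unset Strict Implicit.
Unset Printing Implicit Defensive.

Import Order.TTheory GRing.Theory Num.Theory.
Import numFieldNormedType.Exports.

Local Open Scope classical_set_scope.
Local Open Scope complex_scope.
Local Open Scope ring_scope.

(* The topology and the norm over itself of the field [R[i]]. *)
HB.instance Definition _ (R : realType) := NormedModule.copy R[i] R[i]^o.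

(* The norm of [R[i]] takes its values in [R[i]]; [cmod] is the same modulus as
   an element of [R]. *)
Definition cmod (R : realType) (z : R[i]) : R := complex.Re `|z|.

Definition holomorphic_on (R : realType) (D : set R[i]) (f : R[i] -> R[i]) :
    Prop :=
  open D /\ forall z, D z -> derivable f z 1.

(* Complex derivative of order [s]. *)
Definition cderiv (R : realType) (s : nat) (f : R[i] -> R[i]) : R[i] -> R[i] :=
  derive1n s f.

Definition bounded_Re (R : realType) (D : set R[i]) (f : R[i] -> R[i]) : Prop :=
  exists M : R, forall z, D z -> `|complex.Re (f z)| <= M.

Definition sup_Re (R : realType) (D : set R[i]) (f : R[i] -> R[i]) : R :=
  sup [set `|complex.Re (f z)| | z in D].

Definition boundary (R : realType) (A : set R[i]) : set R[i] :=
  closure A `\` interior A.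

Definition dist (R : realType) (z : R[i]) (A : set R[i]) : R :=
  inf [set cmod (z - w) | w in A].

(* [Rcomplex R] is [R[i]] as a vector space over [R]; connectedness of [G]
   follows from convexity. *)
Definition convex_domain (R : realType) (G : set R[i]) : Prop :=
  [/\ open G, G !=set0 & @convex_set R (Rcomplex R) G].

Definition half_plane (R : realType) : set R[i] := [set z | 0 < complex.Im z].

(* Boundary values at [x + i0] of [Re f], as limits along the normal; for a
   bounded harmonic function they exist for almost every [x] (Fatou), so the
   default value of [lim] matters only on a null set. *)
Definition Re_bdry (R : realType) (f : R[i] -> R[i]) (x : R) : R :=
  lim (complex.Re (f (x +i* y)) @[y --> (0 : R)^'+]).

Definition Re_bdry_norm (R : realType) (f : R[i] -> R[i]) : \bar R :=
  Lnorm (@lebesgue_measure R) +oo%E (EFin \o Re_bdry f).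

Definition K_integral (R : realType) (s : nat) (a : R) : R :=
  \int[@lebesgue_measure R]_(x in `[- (pi / 2), pi / 2])
    (`|cos (a + s.+1%:R * x)| * cos x ^+ s.-1).

Definition K (R : realType) (s : nat) : R :=
  s`!%:R / pi * sup (range (@K_integral R s)).

Definition half_plane_estimate (R : realType) (s : nat) (C : R) : Prop :=
  forall f : R[i] -> R[i],
    holomorphic_on (@half_plane R) f -> bounded_Re (@half_plane R) f ->
    forall z : R[i], half_plane z ->
      ((cmod (cderiv s f z))%:E
         <= (C / complex.Im z ^+ s)%:E * Re_bdry_norm f)%E.

(* [(2 l + 1)!! = 1 * 3 * ... * (2 l + 1)]. *)
Definition odd_dfact (l : nat) : nat := (\prod_(i < l.+1) i.*2.+1)%N.

(* Main.v *)
From HB Require Import structures.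
Require Import Defs.
From mathcomp Require Import all_boot all_order all_algebra.
From mathcomp Require Import all_classical all_reals all_analysis.
From mathcomp Require Import complex ring lra zify measurable_realfun ess_sup_inf.

Set Implicit Arguments.
Unset Strict Implicit.
Unset Printing Implicit Defensive.

Import Order.TTheory GRing.Theory Num.Theory.
Import numFieldNormedType.Exports.

Local Open Scope classical_set_scope.
Local Open Scope complex_scope.
Local Open Scope ring_scope.

Local Notation mu := (@lebesgue_measure _).

(** A function [f] holomorphic in the upper half-plane with bounded real part is
    determined, up to an imaginary constant, by the values [u] of its real part on
    any horizontal line.  Cauchy's theorem on rectangles, applied to [f] composed
    with an exponential and a Cayley transform, gives Poisson's formula
    ([Poisson_angle]); hence [f] and the Cauchy integral of [u], divided by
    [pi i], have the same real part and so the same derivatives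
    ([cderiv_cauchy]): on the real line,
      [f^(s) (z) = s! / (pi i) * int u (t) / (t - z)^(s+1) dt].
    After a rotation that makes this value real, its best bound in terms of
    [sup |u|] is the norm in [L1] of the real part of the rotated kernel, which
    the substitution [t = Re z + Im z * tan phi] turns into
    [K_integral s a / (Im z)^s] ([kernel_integral]).  The sign of the rotated
    kernel is an admissible [u], so that no smaller constant will do
    ([half_plane_estimate_sharp]).

    For the exterior of a convex set, let [w] be the point of the closed set
    nearest to [z].  The half-plane beyond the supporting line at [w] lies in the
    exterior and contains [z] at the distance [d_z] from its edge, so that the
    estimate in the half-plane applies ([convex_exterior_estimate]).

    To bound by the essential supremum of the boundary values, one needs Fatou's
    theorem.  The primitives of the real part along horizontal lines converge to
    a Lipschitz function as the line is lowered ([cvg_prim_line]).  Integration by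
    parts writes Poisson's formula with difference quotients of that function
    ([Re_slope]), so that the real part has a limit along the normal at each
    point where the function is differentiable, that is almost everywhere
    ([lip_ae_derivable], [Re_bdry_cvg_ae]).  Poisson's formula then bounds the real
    part by the norm of its boundary values ([Re_le_bdry_norm]).

    Let [n = s + 1].  Then [cos (a + n x) * cos^(n-2) x] has the primitive
    [sin (a + (n-1) x) * cos^(n-1) x / (n-1)], which at a zero of the first factor
    equals [cos^n x / (n-1)] up to sign.  So [K_integral s a] is [2 / s] times the
    sum of [cos^n] over the [n] zeros in the interval, which are [pi / n] apart
    ([K_integral_zeros]).  Continuity in the first zero yields the maximum; for
    even [n] the sum is constant, by orthogonality of the roots of unity, and for
    [n = 3] and [n = 5] it is an odd polynomial in the cosine of the middle
    zero. *)

Local Notation Re := complex.Re.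
Local Notation Im := complex.Im.

(** * Real and imaginary parts, modulus *)

Section Modulus.
Variable R : realType.
Implicit Types (z w : R[i]) (x y : R).

Lemma complex_eqP z w : Re z = Re w -> Im z = Im w -> z = w.
Proof. by case: z => a b; case: w => c d /= -> ->. Qed.

Lemma ReD z w : Re (z + w) = Re z + Re w.
Proof. by case: z; case: w. Qed.
Lemma ImD z w : Im (z + w) = Im z + Im w.
Proof. by case: z; case: w. Qed.
Lemma ReN z : Re (- z) = - Re z.
Proof. by case: z. Qed.
Lemma ImN z : Im (- z) = - Im z.
Proof. by case: z. Qed.
Lemma ReM z w : Re (z * w) = Re z * Re w - Im z * Im w.
Proof. by case: z; case: w. Qed.
Lemma ImM z w : Im (z * w) = Re z * Im w + Im z * Re w.
Proof. by case: z; case: w. Qed.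

Lemma normc_cmod z : `|z| = (cmod z)%:C.
Proof. by rewrite /cmod normc_def. Qed.

Lemma cmodE z : cmod z = Num.sqrt (Re z ^+ 2 + Im z ^+ 2).
Proof. by rewrite /cmod normc_def. Qed.

Lemma cmod_ge0 z : 0 <= cmod z.
Proof. by rewrite cmodE sqrtr_ge0. Qed.

Lemma sqr_cmod z : cmod z ^+ 2 = Re z ^+ 2 + Im z ^+ 2.
Proof. by rewrite cmodE sqr_sqrtr// addr_ge0// sqr_ge0. Qed.

Lemma cmodM z w : cmod (z * w) = cmod z * cmod w.
Proof. by rewrite /cmod normrM !normc_cmod ReM /= mulr0 subr0. Qed.

Lemma cmodX z n : cmod (z ^+ n) = cmod z ^+ n.
Proof.
elim: n => [|n IH]; last by rewrite !exprS cmodM IH.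
by rewrite !expr0 /cmod normr1.
Qed.

Lemma cmodV z : cmod z^-1 = (cmod z)^-1.
Proof.
have [->|z0] := eqVneq z 0; first by rewrite invr0 /cmod normr0 /= invr0.
apply: (mulfI (x := cmod z)).
  by apply: contraNneq z0 => z0; rewrite -normr_eq0 normc_cmod z0.
rewrite -cmodM mulfV// divff; first by rewrite /cmod normr1.
by apply: contraNneq z0 => z0; rewrite -normr_eq0 normc_cmod z0.
Qed.

Lemma cmodN z : cmod (- z) = cmod z.
Proof. by rewrite /cmod normrN. Qed.

Lemma cmodB z w : cmod (z - w) = cmod (w - z).
Proof. by rewrite /cmod distrC. Qed.

Lemma cmod0 : cmod (0 : R[i]) = 0.
Proof. by rewrite /cmod normr0. Qed.

Lemma cmod1 : cmod (1 : R[i]) = 1.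
Proof. by rewrite /cmod normr1. Qed.

Lemma cmod_eq0 z : (cmod z == 0) = (z == 0).
Proof.
apply/eqP/eqP => [z0|->]; last exact: cmod0.
by apply/eqP; rewrite -normr_eq0 normc_cmod z0.
Qed.

Lemma cmod_gt0 z : (0 < cmod z) = (z != 0).
Proof. by rewrite lt_def cmod_ge0 andbT cmod_eq0. Qed.

Lemma cmodD z w : cmod (z + w) <= cmod z + cmod w.
Proof. by have := ler_normD z w; rewrite !normc_cmod lecE /= => /andP[_]. Qed.

Lemma cmod_real x : cmod x%:C = `|x|.
Proof. by rewrite cmodE /= expr0n addr0 sqrtr_sqr. Qed.

Lemma cmod_i : cmod ('i : R[i]) = 1.
Proof. by rewrite cmodE /= expr0n add0r expr1n sqrtr1. Qed.

Lemma Re_le_cmod z : `|Re z| <= cmod z.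
Proof.
rewrite -(@ler_pXn2r _ 2) ?nnegrE ?cmod_ge0//.
by rewrite sqr_cmod real_normK ?num_real// lerDl sqr_ge0.
Qed.

Lemma Im_le_cmod z : `|Im z| <= cmod z.
Proof.
rewrite -(@ler_pXn2r _ 2) ?nnegrE ?cmod_ge0//.
by rewrite sqr_cmod real_normK ?num_real// lerDr sqr_ge0.
Qed.

Lemma cmod_le z : cmod z <= `|Re z| + `|Im z|.
Proof.
rewrite -(@ler_pXn2r _ 2) ?nnegrE ?cmod_ge0 ?addr_ge0//.
rewrite sqr_cmod sqrrD !real_normK ?num_real// addrAC lerDl.
by rewrite mulrn_wge0// mulr_ge0.
Qed.

Lemma nbhs_cmodP z (A : set R[i]) :
  nbhs z A <-> exists2 d : R, 0 < d & forall w, cmod (w - z) < d -> A w.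
Proof.
split=> [/nbhs_normP[e /= e0 eA]|[d d0 dA]].
- exists (Re e); first by move: e0; rewrite ltcE => /andP[].
  move=> w wz; apply: eA => /=; rewrite -normrN opprB normc_cmod ltcE /= wz andbT.
  by move: e0; rewrite ltcE => /andP[].
- apply/nbhs_normP; exists d%:C; first by rewrite /= ltcE /= eqxx.
  move=> w /=; rewrite -normrN opprB normc_cmod ltcE /= eqxx => /dA.
  exact.
Qed.

Lemma open_cmodP (A : set R[i]) :
  open A <-> forall z, A z ->
    exists2 d : R, 0 < d & forall w, cmod (w - z) < d -> A w.
Proof.
rewrite openE; split=> h z Az; first by have /nbhs_cmodP := h z Az.
by apply/nbhs_cmodP; exact: h.
Qed.

End Modulus.

(** * Complex derivatives by remainder estimates *)

Section Derivative.
Variable R : realType.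
Implicit Types (z w h l : R[i]) (f g : R[i] -> R[i]) (e d : R).

(** The difference quotient multiplied out: in this form the increment may
    vanish and no division occurs, which suits remainder estimates. *)
Definition cdiff f z l := forall e, 0 < e -> exists2 d, 0 < d &
  forall h, cmod h < d -> cmod (f (z + h) - f z - l * h) <= e * cmod h.

Lemma derivable_cdiff f z : derivable f z 1 -> cdiff f z (derive1 f z).
Proof.
move=> fz e e0; have : h^-1 *: (f (h + z) - f z) @[h --> 0^'] --> derive1 f z.
  move/cvg_ex : fz => [l fl].
  have fl' : h^-1 *: (f (h + z) - f z) @[h --> 0^'] --> l.
    move: fl; rewrite [X in X @ _](_ : _ = (fun h => h^-1 *: (f (h + z) - f z)))//.
    by apply/funext => h /=; congr (_ *: (f (_ + _) - _)); exact: mulr1.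
  exact: (cvgP _ fl').
move/cvgrPdist_le => /(_ e%:C); rewrite ltcE /= eqxx e0 => /(_ isT).
rewrite /dnbhs /= /within /= => /nbhs_cmodP[d d0 dP]; exists d => // h hd.
have [->|h0] := eqVneq h 0.
  by rewrite addr0 subrr mulr0 subrr cmod0 mulr0.
have := dP h; rewrite subr0 => /(_ hd h0).
rewrite normc_cmod lecE /= eqxx /= => le.
rewrite (_ : f _ - _ - _ = - ((derive1 f z - h^-1 *: (f (h + z) - f z)) * h)).
  by rewrite cmodN cmodM ler_wpM2r ?cmod_ge0.
rewrite /GRing.scale /= [z + h]addrC mulrBl [h^-1 * _]mulrC.
by rewrite -[X in _ = - (_ - X)]mulrA mulVf// mulr1 opprB.
Qed.

Lemma cdiff_is_derive f z l : cdiff f z l ->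
  derivable f z 1 /\ derive1 f z = l.
Proof.
move=> fl.
have fl' : h^-1 *: (f (h + z) - f z) @[h --> 0^'] --> l.
  apply/cvgrPdist_le => e; rewrite ltcE => /= /andP[/eqP ie re].
  have [d d0 dP] := fl _ re.
  rewrite /dnbhs /= /within /=; apply/nbhs_cmodP; exists d => // h.
  rewrite subr0 => /dP hd h0; rewrite normc_cmod lecE /= ie eqxx /=.
  rewrite -(@ler_pM2r _ (cmod h)) ?cmod_gt0// -cmodM -cmodN.
  rewrite (_ : - _ = f (z + h) - f z - l * h)//.
  rewrite /GRing.scale /= [z + h]addrC mulrBl [h^-1 * _]mulrC.
  by rewrite -[X in - (_ - X)]mulrA mulVf// mulr1 opprB.
split; last first.
  by rewrite /derive1; apply/cvg_lim.
rewrite /derivable; apply/cvg_ex; exists l.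
rewrite [X in X @ _](_ : _ = (fun h => h^-1 *: (f (h + z) - f z)))//.
by apply/funext => h /=; congr (_ *: (f (_ + _) - _)); exact: mulr1.
Qed.

Lemma cdiff_derive1 f z l : cdiff f z l -> derive1 f z = l.
Proof. by move=> /cdiff_is_derive[]. Qed.

Lemma cdiff_near f g z l e : 0 < e ->
  (forall w, cmod (w - z) < e -> f w = g w) -> cdiff f z l -> cdiff g z l.
Proof.
move=> e0 fg fl a a0; have [d d0 dP] := fl a a0.
exists (Num.min d e); first by rewrite lt_min d0.
move=> h; rewrite lt_min => /andP[hd he].
by rewrite -!fg ?subrr ?cmod0//; [exact: dP|rewrite addrAC subrr add0r].
Qed.

Lemma cdiff_cst (c : R[i]) z : cdiff (fun=> c) z 0.
Proof.
move=> e e0; exists 1 => // h _.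
by rewrite subrr mul0r subrr cmod0 mulr_ge0 ?cmod_ge0 ?ltW.
Qed.

Lemma cdiff_affine (a b : R[i]) z : cdiff (fun z => a * z + b) z a.
Proof.
move=> e e0; exists 1 => // h _.
rewrite (_ : _ - _ - _ = 0); last by ring.
by rewrite cmod0 mulr_ge0 ?cmod_ge0 ?ltW.
Qed.

Lemma cdiffD f g z l k : cdiff f z l -> cdiff g z k ->
  cdiff (fun z => f z + g z) z (l + k).
Proof.
move=> fl gk e e0.
have e20 : 0 < e / 2 by rewrite divr_gt0.
have [d d0 dP] := fl _ e20; have [d' d'0 dP'] := gk _ e20.
exists (Num.min d d'); first by rewrite lt_min d0.
move=> h; rewrite lt_min => /andP[hd hd'].
rewrite (_ : _ - _ - _ = (f (z + h) - f z - l * h) + (g (z + h) - g z - k * h)).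
  rewrite (le_trans (cmodD _ _))// [X in _ <= X * _]splitr mulrDl.
  by rewrite lerD ?dP ?dP'.
by ring.
Qed.

(** The form in which differentiability enters continuity and the chain rule. *)
Lemma cdiff_lip f z l : cdiff f z l -> exists2 d, 0 < d &
  forall h, cmod h < d -> cmod (f (z + h) - f z) <= (cmod l + 1) * cmod h.
Proof.
move=> /(_ 1 ltr01)[d d0 dP]; exists d => // h /dP hd.
rewrite (_ : f _ - _ = (f (z + h) - f z - l * h) + l * h); last by ring.
by rewrite (le_trans (cmodD _ _))// cmodM mulrDl addrC lerD.
Qed.

Lemma cdiff_comp f g z l k : cdiff g z k -> cdiff f (g z) l ->
  cdiff (fun z => f (g z)) z (l * k).
Proof.
move=> gk fl e e0.
have [d d0 dP] := cdiff_lip gk.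
pose C := cmod k + 1.
have C0 : 0 < C by rewrite ltr_wpDl// cmod_ge0.
have L0 : 0 < cmod l + 1 by rewrite ltr_wpDl// cmod_ge0.
have [d1 d10 dP1] := fl (e / 2 / C) ltac:(by rewrite !divr_gt0).
have [d2 d20 dP2] := gk (e / 2 / (cmod l + 1)) ltac:(by rewrite !divr_gt0).
exists (Num.min d (Num.min (d1 / C) d2)).
  by rewrite !lt_min d0 d20 divr_gt0.
move=> h; rewrite !lt_min => /and3P[hd hd1 hd2].
have h1 := dP _ hd.
set u := g (z + h) - g z in h1 *.
have u1 : cmod u < d1.
  by rewrite (le_lt_trans h1)// mulrC -ltr_pdivlMr.
have := dP1 _ u1; rewrite (_ : g z + u = g (z + h)); last by rewrite /u; ring.
move=> h2; have h3 := dP2 _ hd2.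
rewrite (_ : _ - _ - _ = (f (g (z + h)) - f (g z) - l * u) + l * (u - k * h)).
  rewrite (le_trans (cmodD _ _))// cmodM [X in _ <= X * _]splitr mulrDl lerD//.
    have eC : 0 <= e / 2 / C by rewrite ltW// !divr_gt0.
    apply: (le_trans h2); apply: (le_trans (ler_wpM2l eC h1)).
    by rewrite mulrA divfK// gt_eqF.
  apply: (le_trans (ler_wpM2l (cmod_ge0 _) h3)).
  rewrite mulrA ler_wpM2r ?cmod_ge0// mulrCA ler_piMr ?ltW ?divr_gt0//.
  by rewrite ltr_pdivrMr// mul1r ltrDl.
by rewrite /u; ring.
Qed.

Lemma cdiffMl f (c : R[i]) z l : cdiff f z l ->
  cdiff (fun z => c * f z) z (c * l).
Proof.
move=> fl.
have := cdiff_comp fl (@cdiff_affine c 0 (f z)).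
by under eq_fun do rewrite addr0.
Qed.

Lemma cdiff_inv z : z != 0 -> cdiff (fun z => z^-1) z (- (z ^+ 2)^-1).
Proof.
move=> z0 e e0; have zp : 0 < cmod z by rewrite cmod_gt0.
exists (Num.min (cmod z / 2) (e * cmod z ^+ 3 / 2)).
  by rewrite lt_min !divr_gt0// mulr_gt0// exprn_gt0.
move=> h; rewrite lt_min => /andP[h1 h2].
have zh : cmod z / 2 <= cmod (z + h).
  have := cmodD (z + h) (- h); rewrite addrK cmodN => zzh.
  by rewrite -(lerD2r (cmod h)) (le_trans _ zzh)// [X in _ <= X]splitr lerD2l ltW.
have zhp : 0 < cmod (z + h) by rewrite (lt_le_trans _ zh)// divr_gt0.
have zh0 : z + h != 0 by rewrite -cmod_gt0.
rewrite (_ : _ - _ - _ = h * h * (z + h)^-1 * z ^- 2); last first.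
  by field; rewrite z0 zh0.
rewrite !cmodM !cmodV cmodX -!mulrA mulrC ler_wpM2r ?cmod_ge0//.
have zz : (cmod (z + h))^-1 <= (cmod z / 2)^-1 by rewrite lef_pV2 // posrE ?divr_gt0.
have k0 : 0 <= (cmod z / 2)^-1 / cmod z ^+ 2.
  by rewrite ltW// divr_gt0 ?invr_gt0 ?divr_gt0 ?exprn_gt0.
apply: (le_trans (y := cmod h * ((cmod z / 2)^-1 / cmod z ^+ 2))).
  by rewrite ler_wpM2l ?cmod_ge0// ler_wpM2r ?invr_ge0 ?exprn_ge0 ?cmod_ge0.
apply: (le_trans (ler_wpM2r k0 (ltW h2))).
by rewrite le_eqVlt; apply/orP; left; apply/eqP; field; rewrite gt_eqF.
Qed.

(** Iterated derivatives are always found by exhibiting all of them at once: each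
    only has to be recognized as the first derivative of its predecessor. *)
Lemma cderiv_chain (U : set R[i]) (g : nat -> R[i] -> R[i]) :
  (forall z, U z -> exists2 d, 0 < d & forall w, cmod (w - z) < d -> U w) ->
  (forall n z, U z -> cdiff (g n) z (g n.+1 z)) ->
  forall n z, U z -> cderiv n (g 0%N) z = g n z.
Proof.
move=> oU dg; elim=> [//|n IH] z Uz.
rewrite /cderiv derive1nS; apply: cdiff_derive1.
have [d d0 dU] := oU z Uz; apply: cdiff_near d0 _ (dg n z Uz) => w /dU Uw.
by rewrite -IH.
Qed.

End Derivative.

(** * Integrals over segments *)

Section SegmentIntegrals.
Variable R : realType.
Implicit Types (f g : R -> R) (a b c : R).

Lemma segment_integrable f a b : {in `[a, b], continuous f} ->
  mu.-integrable `[a, b] (EFin \o f).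
Proof.
move=> cf; apply: continuous_compact_integrable; first exact: segment_compact.
apply: continuous_in_subspaceT => x; rewrite inE => /= xab; exact: cf.
Qed.

Lemma Rintegral_segment_split f a c b : a <= c -> c <= b ->
  {in `[a, b], continuous f} ->
  \int[mu]_(t in `[a, b]) f t =
  \int[mu]_(t in `[a, c]) f t + \int[mu]_(t in `[c, b]) f t.
Proof.
move=> ac cb cf.
have := @Rintegral_itvB R f (BLeft a) (BRight b) c (segment_integrable cf).
rewrite !bnd_simp => /(_ ac cb) h.
rewrite -[X in _ = _ + X]Rintegral_itv_obnd_cbnd -?h; first by ring.
apply: integrableS (segment_integrable cf) => //.
by apply: subset_itvr; rewrite bnd_simp.
Qed.

Lemma Rintegral_segment_dev f a b c (m : R) : a <= b ->
  {in `[a, b], continuous f} ->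
  (forall t, a <= t <= b -> `|f t - c| <= m) ->
  `|\int[mu]_(t in `[a, b]) f t - c * (b - a)| <= m * (b - a).
Proof.
move=> ab cf fm.
have ic k : mu.-integrable `[a, b] (EFin \o cst k) by
  apply: segment_integrable => x _; exact: cvg_cst.
have E k : \int[mu]_(t in `[a, b]) (cst k t) = k * (b - a).
  rewrite Rintegral_cst//= lebesgue_measure_itv/= lte_fin.
  by case: ltgtP ab => //= -> _; rewrite subrr mulr0.
have If := segment_integrable cf.
have If1 : mu.-integrable `[a, b] (EFin \o (fun t => f t - c)).
  by apply: segment_integrable => x xab; apply: cvgB; [exact: cf|exact: cvg_cst].
rewrite -(E c) -RintegralB// -(E m).
apply: le_trans (le_normr_Rintegral _ If1) _ => //.
apply: le_Rintegral => //.
  exact: (integrable_norm If1).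
Qed.

End SegmentIntegrals.

(** * Cauchy's theorem on rectangles *)

Section Goursat.
Variable R : realType.
Implicit Types (g : R[i] -> R[i]) (z w l : R[i]) (x y a b : R).

(** Weaker than [cdiff]; all that the bisection of a rectangle asks of the
    integrand away from the limit point. *)
Definition ccontinuous g z := forall e : R, 0 < e -> exists2 d : R, 0 < d &
  forall w, cmod (w - z) < d -> cmod (g w - g z) < e.

Lemma cdiff_ccontinuous g z l : cdiff g z l -> ccontinuous g z.
Proof.
move=> /cdiff_lip[d d0 dP] e e0.
have l0 : 0 < cmod l + 1 by rewrite ltr_wpDl// cmod_ge0.
exists (Num.min d (e / (cmod l + 1))); first by rewrite lt_min d0 divr_gt0.
move=> w; rewrite lt_min => /andP[wd we].
have := dP _ wd; rewrite [z + _]addrC subrK => /le_lt_trans; apply.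
by rewrite mulrC -ltr_pdivlMr.
Qed.

Lemma ccontinuous_curve g (p q : R -> R) (t : R) :
  ccontinuous g (p t +i* q t) ->
  {for t, continuous p} -> {for t, continuous q} ->
  {for t, continuous (fun s => Re (g (p s +i* q s)))} /\
  {for t, continuous (fun s => Im (g (p s +i* q s)))}.
Proof.
move=> cg cp cq.
have cgt e : 0 < e -> \forall s \near t, cmod (g (p s +i* q s) - g (p t +i* q t)) < e.
  move=> e0; have [d d0 dP] := cg e e0.
  have d2 : 0 < d / 2 by rewrite divr_gt0.
  move/cvgrPdist_lt : cp => /(_ _ d2) cp; move/cvgrPdist_lt : cq => /(_ _ d2) cq.
  near=> s; apply: dP; apply: le_lt_trans (cmod_le _) _ => /=.
  rewrite [d]splitr ltrD// distrC; first by near: s; exact: cp.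
  by near: s; exact: cq.
split; apply/cvgrPdist_lt => e /cgt; apply: filterS => s; apply: le_lt_trans.
- by rewrite -ReN -ReD cmodB; exact: Re_le_cmod.
- by rewrite -ImN -ImD cmodB; exact: Im_le_cmod.
Unshelve. all: by end_near. Qed.

Definition in_rect x y a b z := x <= Re z <= x + a /\ y <= Im z <= y + b.

(** Up to sign, the real part of the integral of [g] along the boundary of the
    rectangle with lower left corner [x +i* y] and sides [a] and [b]. *)
Definition rect_int g x y a b : R :=
  \int[mu]_(t in `[x, x + a]) (Re (g (t +i* (y + b))) - Re (g (t +i* y))) +
  \int[mu]_(t in `[y, y + b]) (Im (g ((x + a) +i* t)) - Im (g (x +i* t))).

Lemma rect_cont_h g x y a b v : (forall z, in_rect x y a b z -> ccontinuous g z) ->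
  y <= v <= y + b -> {in `[x, x + a], continuous (fun t => Re (g (t +i* v)))}.
Proof.
move=> cg vb t; rewrite in_itv /= => ta.
have [] // := @ccontinuous_curve g idfun (cst v) t _ (@cvg_id _ _) (cvg_cst v).
exact: cg.
Qed.

Lemma rect_cont_v g x y a b v : (forall z, in_rect x y a b z -> ccontinuous g z) ->
  x <= v <= x + a -> {in `[y, y + b], continuous (fun t => Im (g (v +i* t)))}.
Proof.
move=> cg vb t; rewrite in_itv /= => ta.
have [] // := @ccontinuous_curve g (cst v) idfun t _ (cvg_cst v) (@cvg_id _ _).
exact: cg.
Qed.

Lemma itv_continuousB (f h : R -> R) a b : {in `[a, b], continuous f} ->
  {in `[a, b], continuous h} -> {in `[a, b], continuous (fun t => f t - h t)}.
Proof. by move=> cf ch t tab; apply: cvgB; [exact: cf|exact: ch]. Qed.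

Lemma rect_int_hsplit g x y a a' b : 0 <= a -> 0 <= a' -> 0 <= b ->
  (forall z, in_rect x y (a + a') b z -> ccontinuous g z) ->
  rect_int g x y (a + a') b = rect_int g x y a b + rect_int g (x + a) y a' b.
Proof.
move=> a0 a'0 b0 cg; rewrite /rect_int.
have y1 : y <= y <= y + b by rewrite lexx lerDl.
have y2 : y <= y + b <= y + b by rewrite lexx lerDl b0.
have x1 : x <= x <= x + (a + a') by rewrite lexx lerDl addr_ge0.
have x2 : x <= x + a <= x + (a + a') by rewrite lerDl a0 addrA lerDl.
have x3 : x <= x + (a + a') <= x + (a + a') by rewrite lexx lerDl addr_ge0.
rewrite (@Rintegral_segment_split _ _ x (x + a) (x + (a + a')))//; first last.
- by apply: itv_continuousB; exact: rect_cont_h cg _.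
- by case/andP: x2.
- by case/andP: x2.
have -> : \int[mu]_(t in `[y, y + b]) (Im (g ((x + (a + a')) +i* t)) - Im (g (x +i* t))) =
    \int[mu]_(t in `[y, y + b]) (Im (g ((x + a) +i* t)) - Im (g (x +i* t))) +
    \int[mu]_(t in `[y, y + b]) (Im (g ((x + (a + a')) +i* t)) - Im (g ((x + a) +i* t))).
  rewrite -RintegralD //=; first last.
  - by apply: segment_integrable; apply: itv_continuousB; exact: rect_cont_v cg _.
  - by apply: segment_integrable; apply: itv_continuousB; exact: rect_cont_v cg _.
  by apply: eq_Rintegral => t _; ring.
by rewrite [x + (a + a')]addrA; ring.
Qed.

Lemma rect_int_vsplit g x y a b b' : 0 <= a -> 0 <= b -> 0 <= b' ->
  (forall z, in_rect x y a (b + b') z -> ccontinuous g z) ->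
  rect_int g x y a (b + b') = rect_int g x y a b + rect_int g x (y + b) a b'.
Proof.
move=> a0 b0 b'0 cg; rewrite /rect_int.
have x1 : x <= x <= x + a by rewrite lexx lerDl.
have x2 : x <= x + a <= x + a by rewrite lexx lerDl a0.
have y1 : y <= y <= y + (b + b') by rewrite lexx lerDl addr_ge0.
have y2 : y <= y + b <= y + (b + b') by rewrite lerDl b0 addrA lerDl.
have y3 : y <= y + (b + b') <= y + (b + b') by rewrite lexx lerDl addr_ge0.
rewrite (@Rintegral_segment_split _ _ y (y + b) (y + (b + b')))//; first last.
- by apply: itv_continuousB; exact: rect_cont_v cg _.
- by case/andP: y2.
- by case/andP: y2.
have -> : \int[mu]_(t in `[x, x + a]) (Re (g (t +i* (y + (b + b')))) - Re (g (t +i* y))) =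
    \int[mu]_(t in `[x, x + a]) (Re (g (t +i* (y + b))) - Re (g (t +i* y))) +
    \int[mu]_(t in `[x, x + a]) (Re (g (t +i* (y + (b + b')))) - Re (g (t +i* (y + b)))).
  rewrite -RintegralD //=; first last.
  - by apply: segment_integrable; apply: itv_continuousB; exact: rect_cont_h cg _.
  - by apply: segment_integrable; apply: itv_continuousB; exact: rect_cont_h cg _.
  by apply: eq_Rintegral => t _; ring.
by rewrite [y + (b + b')]addrA; ring.
Qed.

(** The affine part of [g] at a point of the rectangle integrates to zero along
    the boundary, and the remainder is [o(diameter)] on a perimeter of the same
    order. *)
Lemma rect_int_small g x y a b p l (e : R) : 0 <= a -> 0 <= b ->
  (forall z, in_rect x y a b z -> ccontinuous g z) -> in_rect x y a b p ->
  0 <= e ->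
  (forall z, in_rect x y a b z ->
     cmod (g z - g p - l * (z - p)) <= e * cmod (z - p)) ->
  `|rect_int g x y a b| <= 2 * e * (a + b) ^+ 2.
Proof.
move=> a0 b0 cg pr e0 lP.
have x1 : x <= x <= x + a by rewrite lexx lerDl.
have x2 : x <= x + a <= x + a by rewrite lexx lerDl a0.
have y1 : y <= y <= y + b by rewrite lexx lerDl.
have y2 : y <= y + b <= y + b by rewrite lexx lerDl b0.
have E z : in_rect x y a b z -> cmod (g z - g p - l * (z - p)) <= e * (a + b).
  move=> zr; rewrite (le_trans (lP _ zr))// ler_wpM2l// (le_trans (cmod_le _))//.
  case: zr => /andP[? ?] /andP[? ?]; case: pr => /andP[? ?] /andP[? ?].
  by apply: lerD; rewrite !(ReD, ReN, ImD, ImN) ler_norml; apply/andP; split; lra.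
have E2 z w : in_rect x y a b z -> in_rect x y a b w ->
    cmod (g z - g w - l * (z - w)) <= 2 * e * (a + b).
  move=> /E ez /E ew.
  rewrite (_ : _ - _ - _ = (g z - g p - l * (z - p)) - (g w - g p - l * (w - p))).
    by rewrite (le_trans (cmodD _ _))// cmodN -mulrA mulrDl mul1r lerD.
  by ring.
have h1 : `|\int[mu]_(t in `[x, x + a]) (Re (g (t +i* (y + b))) - Re (g (t +i* y)))
    - (- (b * Im l)) * (x + a - x)| <= 2 * e * (a + b) * (x + a - x).
  apply: Rintegral_segment_dev; first by rewrite lerDl.
    by apply: itv_continuousB; exact: rect_cont_h cg _.
  move=> t ta; have := E2 (t +i* (y + b)) (t +i* y) (conj ta y2) (conj ta y1).
  apply: le_trans; apply: le_trans (Re_le_cmod _).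
  rewrite !(ReD, ReN, ReM, ImD, ImN) /=.
  by rewrite (_ : _ - _ - - _ = Re (g (t +i* (y + b))) - Re (g (t +i* y)) -
     (Re l * (t - t) - Im l * (y + b - y))) //; ring.
have h2 : `|\int[mu]_(t in `[y, y + b]) (Im (g ((x + a) +i* t)) - Im (g (x +i* t)))
    - (a * Im l) * (y + b - y)| <= 2 * e * (a + b) * (y + b - y).
  apply: Rintegral_segment_dev; first by rewrite lerDl.
    by apply: itv_continuousB; exact: rect_cont_v cg _.
  move=> t ta; have := E2 ((x + a) +i* t) (x +i* t) (conj x2 ta) (conj x1 ta).
  apply: le_trans; apply: le_trans (Im_le_cmod _).
  rewrite !(ReD, ReN, ImM, ImD, ImN) /=.
  by rewrite (_ : _ - _ - _ = Im (g ((x + a) +i* t)) - Im (g (x +i* t)) -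
     (Re l * (t - t) + Im l * (x + a - x))) //; ring.
rewrite (_ : rect_int _ _ _ _ _ =
  (\int[mu]_(t in `[x, x + a]) (Re (g (t +i* (y + b))) - Re (g (t +i* y)))
    - (- (b * Im l)) * (x + a - x)) +
  (\int[mu]_(t in `[y, y + b]) (Im (g ((x + a) +i* t)) - Im (g (x +i* t)))
    - (a * Im l) * (y + b - y))); last by rewrite /rect_int; ring.
rewrite (le_trans (ler_normD _ _))// (le_trans (lerD h1 h2))//.
by rewrite le_eqVlt; apply/orP; left; apply/eqP; ring.
Qed.

Lemma nested_point (u v : nat -> R) : (forall n, u n <= u n.+1) ->
  (forall n, v n.+1 <= v n) -> (forall n, u n <= v n) ->
  exists p, forall n, u n <= p <= v n.
Proof.
move=> iu dv uv.
have um : {homo u : m n / (m <= n)%N >-> m <= n} by apply/nondecreasing_seqP.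
have vm : {homo v : m n / (m <= n)%N >-> n <= m} by apply/nonincreasing_seqP.
have ub m : ubound (range u) (v m).
  move=> _ [n _ <-]; rewrite (le_trans (um _ (maxn n m) (leq_maxl _ _)))//.
  by rewrite (le_trans (uv _))// vm// leq_maxr.
exists (sup (range u)) => n; apply/andP; split.
  by apply: ub_le_sup; [exists (v 0%N); exact: ub|exists n].
by apply: sup_le_ub => //; exists (u 0%N); exists 0%N.
Qed.

(** Goursat's bisection, since the derivative is not assumed continuous: of the
    four quarters of a rectangle one carries at least a quarter of the integral,
    while at the common point of the chosen quarters differentiability makes the
    integral small compared to the area. *)
Lemma goursat g x y a b : 0 <= a -> 0 <= b ->
  (forall z, in_rect x y a b z -> exists l, cdiff g z l) ->
  rect_int g x y a b = 0.
Proof.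
move=> a0 b0 dg.
pose A n := a / 2 ^+ n; pose B n := b / 2 ^+ n.
have A0 n : 0 <= A n by rewrite divr_ge0// exprn_ge0.
have B0 n : 0 <= B n by rewrite divr_ge0// exprn_ge0.
have AS n : A n = A n.+1 + A n.+1.
  by rewrite /A exprS; field; rewrite expf_neq0.
have BS n : B n = B n.+1 + B n.+1.
  by rewrite /B exprS; field; rewrite expf_neq0.
pose big n (c c' : R * R) := `|rect_int g c.1 c.2 (A n) (B n)| <=
  4 * `|rect_int g c'.1 c'.2 (A n.+1) (B n.+1)|.
(* Lower left corner of the [n]-th chosen quarter; if the first three quarters
   are all too small, the fourth is not. *)
pose fix corner n : R * R := if n is m.+1 then
    let c := corner m in
    let c1 := (c.1, c.2) in let c2 := (c.1 + A n, c.2) in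
    let c3 := (c.1, c.2 + B n) in let c4 := (c.1 + A n, c.2 + B n) in
    if big m c c1 then c1 else if big m c c2 then c2 else
    if big m c c3 then c3 else c4
  else (x, y).
have cornerS n : ((corner n.+1).1 = (corner n).1 \/
     (corner n.+1).1 = (corner n).1 + A n.+1) /\
    ((corner n.+1).2 = (corner n).2 \/
     (corner n.+1).2 = (corner n).2 + B n.+1).
  rewrite /=; case: ifP => _; first by split; left.
  case: ifP => _; first by split; [right|left].
  by case: ifP => _; split; [left|right|right|right].
have nx n : (corner n).1 <= (corner n.+1).1 /\
    (corner n.+1).1 + A n.+1 <= (corner n).1 + A n.
  by have [[->|->] _] := cornerS n; have := A0 n.+1; have := AS n; split; lra.
have ny n : (corner n).2 <= (corner n.+1).2 /\
    (corner n.+1).2 + B n.+1 <= (corner n).2 + B n.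
  by have [_ [->|->]] := cornerS n; have := B0 n.+1; have := BS n; split; lra.
have sub n z : in_rect (corner n).1 (corner n).2 (A n) (B n) z -> in_rect x y a b z.
  elim: n => [|n IH]; first by rewrite /A /B !expr0 !divr1.
  move=> [/andP[z1 z2] /andP[z3 z4]]; apply: IH.
  have [x1 x2] := nx n; have [y1 y2] := ny n.
  by split; apply/andP; split; lra.
have cg n z : in_rect (corner n).1 (corner n).2 (A n) (B n) z -> ccontinuous g z.
  by move=> /sub /dg[l]; exact: cdiff_ccontinuous.
have bigP n : big n (corner n) (corner n.+1).
  rewrite /=; case: ifP => // /negbT b1; case: ifP => // /negbT b2.
  case: ifP => // /negbT b3; move: b1 b2 b3; rewrite /big /= -!ltNge.
  have -> : rect_int g (corner n).1 (corner n).2 (A n) (B n) =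
    rect_int g (corner n).1 (corner n).2 (A n.+1) (B n.+1) +
    rect_int g ((corner n).1 + A n.+1) (corner n).2 (A n.+1) (B n.+1) +
    (rect_int g (corner n).1 ((corner n).2 + B n.+1) (A n.+1) (B n.+1) +
    rect_int g ((corner n).1 + A n.+1) ((corner n).2 + B n.+1) (A n.+1) (B n.+1)).
    have := cg n; rewrite AS BS => cgn.
    have Bn := B0 n.+1.
    rewrite rect_int_vsplit ?addr_ge0//.
    rewrite (@rect_int_hsplit g (corner n).1 (corner n).2 (A n.+1) (A n.+1) (B n.+1))//.
      rewrite (@rect_int_hsplit g (corner n).1 ((corner n).2 + B n.+1)
        (A n.+1) (A n.+1) (B n.+1))//.
      by move=> z [zx /andP[z1 z2]]; apply: cgn; split => //; apply/andP; split; lra.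
    by move=> z [zx /andP[z1 z2]]; apply: cgn; split => //; apply/andP; split; lra.
  set G1 := rect_int _ _ _ _ _; set G2 := rect_int _ _ _ _ _.
  set G3 := rect_int _ _ _ _ _; set G4 := rect_int _ _ _ _ _.
  move=> b1 b2 b3.
  have := ler_normD (G1 + G2) (G3 + G4); have := ler_normD G1 G2.
  have := ler_normD G3 G4; lra.
have bound n : `|rect_int g x y a b| <=
    4 ^+ n * `|rect_int g (corner n).1 (corner n).2 (A n) (B n)|.
  elim: n => [|n IH]; first by rewrite expr0 mul1r /A /B !expr0 !divr1.
  rewrite (le_trans IH)// exprSr -mulrA ler_wpM2l ?exprn_ge0//.
  exact: bigP.
have [px pxP] := @nested_point (fun n => (corner n).1) (fun n => (corner n).1 + A n)
  (fun n => (nx n).1) (fun n => (nx n).2) ltac:(by move=> n; rewrite lerDl).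
have [py pyP] := @nested_point (fun n => (corner n).2) (fun n => (corner n).2 + B n)
  (fun n => (ny n).1) (fun n => (ny n).2) ltac:(by move=> n; rewrite lerDl).
have pr n : in_rect (corner n).1 (corner n).2 (A n) (B n) (px +i* py) by split => /=.
have [l lP] := dg _ (sub _ _ (pr 0%N)).
have small e : 0 < e -> `|rect_int g x y a b| <= 2 * e * (a + b) ^+ 2.
  move=> e0; have [d d0 dP] := lP e e0.
  have [n nd] : exists n, A n + B n < d.
    exists (Num.truncn ((a + b) / d)).+1; rewrite /A /B -mulrDl.
    rewrite ltr_pdivrMr ?exprn_gt0// mulrC -ltr_pdivrMr//.
    apply: (lt_le_trans (truncnS_gt _)).
    by rewrite -natrX ler_nat ltnW// ltn_expl.
  rewrite (le_trans (bound n))//.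
  apply: (le_trans (y := 4 ^+ n * (2 * e * (A n + B n) ^+ 2))).
    rewrite ler_wpM2l ?exprn_ge0//.
    apply: (@rect_int_small _ _ _ _ _ (px +i* py) l) => //; first exact: cg.
      exact: ltW.
    move=> z zr; have := dP (z - (px +i* py)); rewrite [_ + (z - _)]addrC subrK; apply.
    apply: le_lt_trans nd; apply: le_trans (cmod_le _) _.
    case: zr => /andP[? ?] /andP[? ?]; case: (pr n) => /= /andP[? ?] /andP[? ?].
    by apply: lerD; rewrite !(ReD, ReN, ImD, ImN) ler_norml /=; apply/andP; split; lra.
  rewrite /A /B (_ : 4 = 2 ^+ 2 :> R); last by ring.
  rewrite -exprM mulnC exprM le_eqVlt; apply/orP; left; apply/eqP.
  by field; rewrite expf_neq0.
apply/eqP; rewrite -normr_le0; apply/ler_addgt0Pr => e e0; rewrite add0r.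
have ab0 : 0 <= (a + b) ^+ 2 by rewrite sqr_ge0.
have k0 : 0 < 2 * ((a + b) ^+ 2 + 1) by lra.
have := small (e / (2 * ((a + b) ^+ 2 + 1))) ltac:(by rewrite divr_gt0).
have k1 : (a + b) ^+ 2 + 1 != 0 by rewrite gt_eqF// ltr_wpDl.
move=> /le_trans; apply.
rewrite [X in X <= _](_ : _ = e * ((a + b) ^+ 2 / ((a + b) ^+ 2 + 1))); last by field.
rewrite ler_piMr ?ltW//; rewrite ltr_pdivrMr; last by rewrite ltr_wpDl.
by rewrite mul1r ltrDl.
Qed.

End Goursat.

(** * Dominated convergence for real integrals *)

Section DominatedConvergence.
Variable R : realType.
Implicit Types (f g : R -> R) (D : set R).

Lemma Rintegral_dct_ae D (f_ : nat -> R -> R) f g : measurable D ->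
  (forall n, measurable_fun D (f_ n)) -> measurable_fun D f ->
  {ae mu, forall x, D x -> f_ ^~ x @ \oo --> f x} ->
  mu.-integrable D (EFin \o g) ->
  (forall n x, D x -> `|f_ n x| <= g x) ->
  \int[mu]_(x in D) f_ n x @[n --> \oo] --> \int[mu]_(x in D) f x.
Proof.
move=> mD mf_ mf ff ig fg.
have [i1 _ i3] : [/\ mu.-integrable D (EFin \o f),
    (fun n => \int[mu]_(x in D) `|(EFin \o f_ n) x - (EFin \o f) x|)%E @ \oo --> 0%E &
    (fun n => \int[mu]_(x in D) (EFin \o f_ n) x)%E @ \oo -->
      (\int[mu]_(x in D) (EFin \o f) x)%E].
  apply: (@dominated_convergence _ _ _ mu D mD (fun n => EFin \o f_ n)
    (EFin \o f) (EFin \o g)) => //.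
  - by move=> n /=; apply/measurable_EFinP; exact: mf_.
  - by apply/measurable_EFinP.
  - move: ff; apply: filterS; first exact: (ae_filter_ringOfSetsType mu).
    by move=> x h Dx; apply: cvg_EFin; [exact: nearW|exact: h].
  - by apply: aeW => x n Dx; rewrite lee_fin; exact: fg.
apply: fine_cvg; rewrite fineK; last exact: integrable_fin_num.
exact: i3.
Qed.

Lemma Rintegral_dct D (f_ : nat -> R -> R) f g : measurable D ->
  (forall n, measurable_fun D (f_ n)) -> measurable_fun D f ->
  (forall x, D x -> f_ ^~ x @ \oo --> f x) ->
  mu.-integrable D (EFin \o g) ->
  (forall n x, D x -> `|f_ n x| <= g x) ->
  \int[mu]_(x in D) f_ n x @[n --> \oo] --> \int[mu]_(x in D) f x.
Proof. by move=> mD mf_ mf ff; apply: Rintegral_dct_ae => //; exact: aeW. Qed.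

Lemma bounded_integrable f (a b B : R) : measurable_fun `]a, b[ f ->
  (forall t, a < t < b -> `|f t| <= B) -> mu.-integrable `]a, b[ (EFin \o f).
Proof.
move=> mf fB; apply: (@le_integrable _ _ _ mu _ _ _ (EFin \o cst B)) => //.
- exact/measurable_EFinP.
- move=> t; rewrite /= in_itv /= => tab; rewrite lee_fin.
  by rewrite (le_trans (fB t tab))// ler_norm.
- apply: (@integrableS _ _ _ mu `[a, b]) => //.
    by move=> u /=; rewrite !in_itv /= => /andP[/ltW -> /ltW].
  by apply: segment_integrable => t _; exact: cvg_cst.
Qed.

Lemma open_itv_measurable f (a b : R) : {in `]a, b[, continuous f} ->
  measurable_fun `]a, b[ f.
Proof.
move=> cf; apply: open_continuous_measurable_fun; first exact: interval_open.
by move=> t; rewrite inE => tab; exact: cf.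
Qed.

Lemma Rintegral_segment_open f (a b : R) : {in `[a, b], continuous f} ->
  \int[mu]_(t in `[a, b]) f t = \int[mu]_(t in `]a, b[) f t.
Proof.
move=> cf; have If := segment_integrable cf.
rewrite -Rintegral_itv_obnd_cbnd; last first.
  by apply: integrableS If => //; apply: subset_itvr; rewrite bnd_simp.
rewrite -Rintegral_itv_bndo_bndc//.
by apply: integrableS If => // u /=; rewrite !in_itv /= => /andP[/ltW -> /ltW].
Qed.

End DominatedConvergence.

(** * The complex exponential *)

Section ComplexExponential.
Variable R : realType.
Implicit Types (z w : R[i]) (x e : R).

Lemma is_derive_remainder (f : R -> R) x l e : is_derive x 1 f l -> 0 < e ->
  exists2 d, 0 < d & forall h, `|h| < d -> `|f (x + h) - f x - l * h| <= e * `|h|.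
Proof.
move=> [fx <-] e0.
have : h^-1 *: (f (h + x) - f x) @[h --> 0^'] --> derive1 f x.
  move/cvg_ex : fx => [k fk].
  have fk' : h^-1 *: (f (h + x) - f x) @[h --> 0^'] --> k.
    move: fk; rewrite [X in X @ _](_ : _ = (fun h => h^-1 *: (f (h + x) - f x)))//.
    by apply/funext => h /=; congr (_ *: (f (_ + _) - _)); exact: mulr1.
  exact: (cvgP _ fk').
rewrite derive1E.
move/cvgrPdist_le => /(_ e e0).
rewrite /dnbhs /= /within /= => /nbhs_normP[d d0 dP]; exists d => // h hd.
have [->|h0] := eqVneq h 0.
  by rewrite addr0 subrr mulr0 subrr normr0 mulr0.
have := dP h; rewrite /= sub0r normrN => /(_ hd h0).
rewrite -(@ler_pM2r _ `|h|) ?normr_gt0// -normrM -normrN.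
rewrite [X in `|X|](_ : _ = f (x + h) - f x - 'D_1 f x * h)//.
by rewrite /GRing.scale /= [h + x]addrC; field.
Qed.

(** [expi w] is [exp (i w)]. *)
Definition expi w : R[i] := (expR (- Im w))%:C * (cos (Re w) +i* sin (Re w)).

Lemma expiD z w : expi (z + w) = expi z * expi w.
Proof.
rewrite /expi ReD ImD opprD expRD cosD sinD.
by apply: complex_eqP; rewrite !(ReM, ImM) /=; ring.
Qed.

Lemma cmod_expi w : cmod (expi w) = expR (- Im w).
Proof.
rewrite /expi cmodM cmod_real ger0_norm ?expR_ge0// cmodE /= cos2Dsin2 sqrtr1.
by rewrite mulr1.
Qed.

Lemma expi0 : expi 0 = 1.
Proof. by rewrite /expi /= oppr0 expR0 cos0 sin0 mul1r. Qed.

Lemma expi_neq0 w : expi w != 0.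
Proof. by rewrite -cmod_gt0 cmod_expi expR_gt0. Qed.

Lemma expi_real x : expi x%:C = cos x +i* sin x.
Proof. by rewrite /expi /= oppr0 expR0 mul1r. Qed.

Lemma expiXn w n : expi w ^+ n = expi (n%:R * w).
Proof.
elim: n => [|n IH]; first by rewrite mul0r expi0.
by rewrite exprS IH -expiD -[n.+1]add1n natrD mulrDl mul1r.
Qed.

Lemma expiN w : expi (- w) = (expi w)^-1.
Proof.
apply: (mulfI (expi_neq0 w)); rewrite mulfV ?expi_neq0//.
by rewrite -expiD subrr expi0.
Qed.

(** The remainders of [expR], [cos] and [sin] at 0 combine to that of the product;
    the functional equation transports the derivative to other points. *)
Lemma cdiff_expi0 : cdiff expi 0 'i.
Proof.
move=> e e0.
(* The two parts of the remainder will be at most 4 and 5 times [e1] times the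
   modulus of the increment. *)
pose e1 := Num.min 1 (e / 9).
have e10 : 0 < e1 by rewrite lt_min ltr01 divr_gt0.
have e11 : e1 <= 1 by rewrite ge_min lexx.
have e1e : 9 * e1 <= e.
  by rewrite mulrC -ler_pdivlMr// ge_min lexx orbT.
clearbody e1.
have [d1 d10 dP1] := is_derive_remainder (is_derive_expR 0) e10.
have [d2 d20 dP2] := is_derive_remainder (is_derive_cos 0) e10.
have [d3 d30 dP3] := is_derive_remainder (is_derive_sin 0) e10.
exists (Num.min (Num.min d1 d2) (Num.min d3 e1)); first by rewrite !lt_min d10 d20 d30 e10.
case=> h k; rewrite !lt_min => /andP[/andP[hd1 hd2] /andP[hd3 hd4]].
have hm := Re_le_cmod (h +i* k); have km := Im_le_cmod (h +i* k).
move: hm km => /= hm km; set m := cmod _ in hd1 hd2 hd3 hd4 hm km *.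
have := dP3 h (le_lt_trans hm hd3); rewrite add0r cos0 sin0 subr0 mul1r => hs.
have := dP2 h (le_lt_trans hm hd2); rewrite add0r cos0 sin0 oppr0 mul0r subr0 => hc.
have := dP1 (- k); rewrite normrN add0r expR0 mul1r => /(_ (le_lt_trans km hd1)) he.
rewrite expi0; apply: le_trans (cmod_le _) _.
rewrite /expi !(ReD, ImD, ReN, ImN, ReM, ImM) /= !(mul0r, mul1r, add0r, subr0, oppr0, addr0).
have m0 : 0 <= m := cmod_ge0 _.
set E := expR _ in he *; have E0 : 0 <= E := expR_ge0 _.
have he1 : `|E - 1| <= 2 * `|k|.
  rewrite (_ : E - 1 = (E - 1 - - k) - k); last by ring.
  rewrite (le_trans (ler_normD _ _))// normrN mulrDl !mul1r lerD//.
  by apply: (le_trans he); rewrite ler_piMl.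
have k1 : `|k| <= e1 by apply: le_trans km _; exact: ltW.
have E3 : E <= 3.
  have : E - 1 <= 2 * 1.
    apply: (le_trans (ler_norm _)); apply: (le_trans he1); rewrite ler_wpM2l//.
    by apply: (le_trans k1).
  by move=> ?; lra.
have p1 : `|E * cos h - 1 - - k| <= 4 * (e1 * m).
  rewrite (_ : E * _ - 1 - - k = (E - 1 - - k) + E * (cos h - 1)); last by ring.
  rewrite (le_trans (ler_normD _ _))// normrM (ger0_norm E0).
  have -> : 4 * (e1 * m) = e1 * m + 3 * (e1 * m) by ring.
  apply: lerD; first by apply: (le_trans he); rewrite ler_wpM2l// ltW.
  by apply: ler_pM => //; apply: (le_trans hc); rewrite ler_wpM2l// ltW.
have p2 : `|E * sin h - h| <= 5 * (e1 * m).
  rewrite (_ : E * _ - h = E * (sin h - h) + h * (E - 1)); last by ring.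
  rewrite (le_trans (ler_normD _ _))// !normrM (ger0_norm E0).
  have -> : 5 * (e1 * m) = 3 * (e1 * m) + m * (2 * e1) by ring.
  apply: lerD; last first.
    by apply: ler_pM => //; apply: (le_trans he1); rewrite ler_wpM2l.
  by apply: ler_pM => //; apply: (le_trans hs); rewrite ler_wpM2l// ltW.
apply: (le_trans (y := 4 * (e1 * m) + 5 * (e1 * m))); last first.
  by rewrite -mulrDl -natrD mulrA ler_wpM2r.
exact: lerD.
Qed.

Lemma cdiff_expi w : cdiff expi w ('i * expi w).
Proof.
move=> e e0; have E0 : 0 < cmod (expi w) by rewrite cmod_expi expR_gt0.
have [d d0 dP] := cdiff_expi0 (divr_gt0 e0 E0).
exists d => // h /dP; rewrite add0r expi0 => hd.
rewrite expiD (_ : _ - _ - _ = expi w * (expi h - 1 - 'i * h)); last by ring.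
by rewrite cmodM mulrC -ler_pdivlMr// mulrAC.
Qed.

End ComplexExponential.

(** * The Cayley transform *)

Section CayleyCircles.
Variable R : realType.
Implicit Types (z w : R[i]) (x y e B : R).

(** The Cayley transform of the unit disc onto the half-plane above the real
    axis that sends the centre to [x +i* y] and [-1] to infinity. *)
Definition cayley x y w : R[i] := x%:C + (y%:C * 'i) * ((1 - w) / (1 + w)).

Lemma cayley0 x y : cayley x y 0 = x +i* y.
Proof.
rewrite /cayley subr0 addr0 divr1 mulr1.
by apply: complex_eqP; rewrite !(ReD, ImD, ReM, ImM) /=; ring.
Qed.

Lemma Im_cayley_ge0 x y w : 0 <= y -> cmod w <= 1 -> 1 + w != 0 ->
  0 <= Im (cayley x y w).
Proof.
move=> y0 w1 w0; set q := (1 - w) / (1 + w).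
have qE : q * (1 + w) = 1 - w by rewrite divfK.
have -> : Im (cayley x y w) = y * Re q.
  by rewrite /cayley -/q !(ReD, ImD, ReM, ImM) /=; ring.
clearbody q; rewrite mulr_ge0//.
have : 0 < cmod (1 + w) ^+ 2 by rewrite exprn_gt0// cmod_gt0.
have : cmod w ^+ 2 <= 1 by rewrite exprn_ile1 ?cmod_ge0.
have := congr1 (@complex.Re R) qE; have := congr1 (@complex.Im R) qE.
rewrite !sqr_cmod !(ReD, ImD, ReM, ImM, ReN, ImN) /= => e1 e2 e3 e4.
have E : Re q * ((1 + Re w) ^+ 2 + (0 + Im w) ^+ 2) = 1 - (Re w ^+ 2 + Im w ^+ 2).
  rewrite (_ : Re q * _ = (1 + Re w) * (Re q * (1 + Re w) - Im q * (0 + Im w)) +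
    Im w * (Re q * (0 + Im w) + Im q * (1 + Re w))); last by ring.
  by rewrite e1 e2; ring.
by rewrite -(@pmulr_lge0 _ ((1 + Re w) ^+ 2 + (0 + Im w) ^+ 2)) // E subr_ge0.
Qed.

(** The unit circle goes to the line: the point of argument [2 t] is seen from
    [x +i* y] under the angle [t]. *)
Lemma cayley_expi x y t : cos t != 0 ->
  1 + expi ((2 * t)%:C) != 0 /\ cayley x y (expi ((2 * t)%:C)) = (x + y * tan t) +i* 0.
Proof.
move=> c0; set w := expi _.
have wE : w = expi t%:C * expi t%:C.
  by rewrite -expiD /w; congr expi; apply: complex_eqP => /=; ring.
have e0 := expi_neq0 t%:C.
have cE : expi t%:C + (expi t%:C)^-1 = (2 * cos t)%:C.
  rewrite -expiN -rmorphN !expi_real cosN sinN.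
  by apply: complex_eqP; rewrite !(ReD, ImD) /=; ring.
have sE : (expi t%:C)^-1 - expi t%:C = - (2 * sin t)%:C * 'i.
  rewrite -expiN -rmorphN !expi_real cosN sinN.
  by apply: complex_eqP; rewrite !(ReD, ImD, ReM, ImM, ReN, ImN) /=; ring.
have c0' : (2 * cos t)%:C != 0 :> R[i] by rewrite eq_complex /= eqxx andbT mulf_neq0.
have w1E : 1 + w = expi t%:C * (2 * cos t)%:C by rewrite -cE wE; field.
have w2E : 1 - w = expi t%:C * (- (2 * sin t)%:C * 'i) by rewrite -sE wE; field.
split; first by rewrite w1E mulf_neq0.
have qE : (1 - w) / (1 + w) = (- tan t)%:C * 'i.
  apply: (mulIf (x := 1 + w)); first by rewrite w1E mulf_neq0.
  rewrite divfK; last by rewrite w1E mulf_neq0.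
  rewrite w1E w2E [RHS]mulrCA; congr (_ * _).
  by apply: complex_eqP; rewrite !(ReM, ImM, ReN, ImN) /= /tan; field.
rewrite /cayley qE.
by apply: complex_eqP; rewrite !(ReD, ImD, ReM, ImM) /=; ring.
Qed.

Lemma cdiff_cayley x y w : 1 + w != 0 -> exists l, cdiff (cayley x y) w l.
Proof.
move=> w0.
have h1 := cdiff_affine 1 1 w.
have h2 : cdiff (fun z => (1 * z + 1)^-1) w (- ((1 * w + 1) ^+ 2)^-1 * 1).
  by apply: cdiff_comp h1 _; apply: cdiff_inv; rewrite mul1r addrC.
have h3 := cdiff_comp h2 (@cdiff_affine _ (2 * (y%:C * 'i)) (x%:C - y%:C * 'i) _).
eexists; apply: (cdiff_near (e := cmod (1 + w))) h3; first by rewrite cmod_gt0.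
move=> z zw; rewrite mul1r /cayley.
have z0 : 1 + z != 0.
  apply: contraTneq zw => z1; rewrite -leNgt.
  have -> : z - w = - (1 + w) + (1 + z) by ring.
  by rewrite z1 addr0 cmodN.
have -> : (1 - z) / (1 + z) = 2 * (z + 1)^-1 - 1 by field; rewrite addrC z0.
by ring.
Qed.

End CayleyCircles.

(** * Poisson's formula on horizontal lines *)

Section MeanValue.
Variable R : realType.
Implicit Types (f g : R[i] -> R[i]) (z w : R[i]).

Lemma Re_nat n : Re (n%:R : R[i]) = n%:R.
Proof. by elim: n => // n IH; rewrite -!natr1 ReD IH. Qed.

Lemma Im_nat n : Im (n%:R : R[i]) = 0.
Proof. by elim: n => // n IH; rewrite -!natr1 ImD IH addr0. Qed.

Lemma ccontinuous_seq g z (w_ : nat -> R[i]) : ccontinuous g z ->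
  cmod (w_ n - z) @[n --> \oo] --> 0 ->
  Re (g (w_ n)) @[n --> \oo] --> Re (g z).
Proof.
move=> cg wz; apply/cvgrPdist_lt => e /cg[d d0 dP].
move/cvgrPdist_lt : wz => /(_ d d0); apply: filterS => n.
rewrite sub0r normrN ger0_norm ?cmod_ge0// => /dP; apply: le_lt_trans.
by rewrite -ReN -ReD cmodB; exact: Re_le_cmod.
Qed.

Lemma ex_cdiff_comp f g z : (exists k, cdiff g z k) ->
  (exists l, cdiff f (g z) l) -> exists l, cdiff (fun z => f (g z)) z l.
Proof. by move=> [k gk] [l fl]; exists (l * k); exact: cdiff_comp. Qed.

Variable f : R[i] -> R[i].
Hypothesis hf : forall z, 0 < Im z -> exists l, cdiff f z l.
Variable B : R.
Hypothesis fB : forall z, 0 < Im z -> `|Re (f z)| <= B.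
Variables (x y e : R).
Hypotheses (y0 : 0 < y) (e0 : 0 < e).

(** Along [Im w = tau] the argument of [f] runs through a hyperbolic circle
    around [x +i* (y + e)] in the half-plane [Im > e]; the circles shrink to the
    centre as [tau] grows and open up to the boundary line as [tau] tends to 0. *)
Let disc w := f (cayley x y w + (0 +i* e)).
Let h w := disc (expi (2 * w)).

Let disc_cdiff w : cmod w <= 1 -> 1 + w != 0 -> exists l, cdiff disc w l.
Proof.
move=> w1 w0.
apply: (@ex_cdiff_comp f (fun w => cayley x y w + (0 +i* e))); last first.
  by apply: hf; rewrite ImD ltr_wpDl// Im_cayley_ge0// ltW.
have [l hl] := cdiff_cayley x y w0.
by exists (l + 0); apply: cdiffD => //; exact: cdiff_cst.
Qed.

Let cmod_e2 w : cmod (expi (2 * w)) = expR (- (2 * Im w)).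
Proof. by rewrite cmod_expi ImM Re_nat Im_nat mul0r addr0. Qed.

Let e2_le1 w : 0 <= Im w -> cmod (expi (2 * w)) <= 1.
Proof. by move=> w0; rewrite cmod_e2 -expR0 ler_expR oppr_le0 mulr_ge0. Qed.

Let h_cdiff w : 0 <= Im w -> 1 + expi (2 * w) != 0 -> exists l, cdiff h w l.
Proof.
move=> w0 w1; apply: (@ex_cdiff_comp disc (fun w => expi (2 * w))); last first.
  by apply: disc_cdiff => //; exact: e2_le1.
have h2 : cdiff (fun w => 2 * w + 0) w 2 by exact: cdiff_affine.
have h2' : cdiff (fun w => 2 * w) w 2.
  by apply: cdiff_near ltr01 _ h2 => z _; rewrite addr0.
by exists ('i * expi (2 * w) * 2); apply: cdiff_comp h2' _; exact: cdiff_expi.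
Qed.

Let e2_neqN1 w : 0 < Im w -> 1 + expi (2 * w) != 0.
Proof.
move=> w0; apply/eqP => /eqP; rewrite addrC addr_eq0 => /eqP /(congr1 (@cmod R)).
rewrite cmodN cmod1 cmod_e2 -[RHS]expR0 => /expR_inj /eqP.
by rewrite oppr_eq0 mulf_eq0 pnatr_eq0 /= gt_eqF.
Qed.

Let h_bound w : 0 <= Im w -> 1 + expi (2 * w) != 0 -> `|Re (h w)| <= B.
Proof.
move=> w0 w1; apply: fB; rewrite ImD ltr_wpDl// Im_cayley_ge0 ?e2_le1//.
exact: ltW.
Qed.

Let h_cont t v : 0 <= v -> 1 + expi (2 * (t +i* v)) != 0 ->
  {for t, continuous (fun s => Re (h (s +i* v)))}.
Proof.
move=> v0 w1; have [l hl] := @h_cdiff (t +i* v) v0 w1.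
by have [] := @ccontinuous_curve _ h id (cst v) t (cdiff_ccontinuous hl)
  (@cvg_id _ _) (cvg_cst v).
Qed.

Let M v := \int[mu]_(t in `[- (pi / 2), pi / 2]) Re (h (t +i* v)).

(** Cauchy's theorem on a rectangle one period wide: the contributions of the two
    vertical sides cancel. *)
Let M_const u v : 0 < u -> u <= v -> M u = M v.
Proof.
move=> u0 uv.
have pi0 := pi_gt0 R.
have hp t : h ((- (pi / 2) + pi) +i* t) = h ((- (pi / 2)) +i* t).
  rewrite /h; congr disc.
  rewrite (_ : 2 * _ = 2 * ((- (pi / 2)) +i* t) + (2 * pi)%:C); last first.
    by apply: complex_eqP; rewrite !(ReM, ImM, ReD, ImD, Re_nat, Im_nat) /=; ring.
  rewrite expiD [expi (2 * pi)%:C](_ : _ = 1) ?mulr1//.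
  by rewrite expi_real [2 * pi]mulr_natl cos2pi sin2pi.
have hc (r : R) : u <= r -> {in `[- (pi / 2), pi / 2], continuous (fun s => Re (h (s +i* r)))}.
  by move=> uw t _; apply: h_cont; [|apply: e2_neqN1 => /=]; lra.
have : rect_int h (- (pi / 2)) u pi (v - u) = 0.
  apply: goursat; [exact: ltW|by rewrite subr_ge0|move=> z [_ /andP[z1 _]]].
  by apply: h_cdiff; [|apply: e2_neqN1]; lra.
rewrite /rect_int (_ : - (pi / 2) + pi = pi / 2); last by field.
rewrite [X in _ + X](_ : _ = 0) ?addr0; last first.
  transitivity (\int[mu]_(t in `[u, (u + (v - u))%R]) cst 0 t).
    apply: eq_Rintegral => t _.
    have -> : h ((pi / 2) +i* t) = h (- (pi / 2) +i* t).
      have pE : pi / 2 = - (pi / 2) + pi :> R by field.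
      by rewrite {1}pE hp.
    by rewrite subrr.
  by rewrite Rintegral_cst//= mul0r.
rewrite [u + (v - u)]addrC subrK.
move/eqP; rewrite RintegralB//.
- by rewrite subr_eq0 => /eqP Muv; rewrite /M Muv.
- by apply: segment_integrable; apply: hc.
- by apply: segment_integrable; apply: hc.
Qed.

Let M_open v : 0 < v -> M v = \int[mu]_(t in `]- (pi / 2), pi / 2[) Re (h (t +i* v)).
Proof.
move=> v0; rewrite /M Rintegral_segment_open// => t _.
by apply: h_cont; [exact: ltW|exact: e2_neqN1].
Qed.

Let I : set R := `]- (pi / 2), pi / 2[.

Let integrable_cst : mu.-integrable I (EFin \o cst B).
Proof.
by apply: (@bounded_integrable _ _ _ _ `|B|) => //; exact: measurable_cst.
Qed.

Let h_meas v : 0 < v -> measurable_fun I (fun t => Re (h (t +i* v))).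
Proof.
move=> v0; apply: open_itv_measurable => t _.
by apply: h_cont; [exact: ltW|exact: e2_neqN1].
Qed.

Let M_cvg_center : M n.+1%:R @[n --> \oo] --> pi * Re (f (x +i* (y + e))).
Proof.
have -> : pi * Re (f (x +i* (y + e))) = \int[mu]_(t in I) (Re (disc 0)).
  rewrite /I Rintegral_cst//= lebesgue_measure_itv/= lte_fin.
  have -> : - (pi / 2) < pi / 2 :> R by have := pi_gt0 R; lra.
  rewrite /= /disc cayley0 mulrC; congr (Re (f _) * _).
  - by apply: complex_eqP => /=; rewrite ?addr0.
  - by field.
under eq_fun do rewrite M_open//.
apply: (@Rintegral_dct _ _ _ _ (cst B)) => //.
- exact: measurable_itv.
- by move=> n; apply: h_meas; rewrite ?invr_gt0 ltr0Sn.
- move=> t _; apply: (@ccontinuous_seq disc 0).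
    have [l hl] : exists l, cdiff disc 0 l.
      by apply: disc_cdiff; rewrite ?cmod0// addr0 oner_eq0.
    exact: cdiff_ccontinuous hl.
  under eq_fun do rewrite subr0 cmod_e2 /=.
  apply/cvgrPdist_le => d d0; near=> n.
  rewrite sub0r normrN ger0_norm ?expR_ge0// expRN.
  rewrite -[d]invrK lef_pV2 ?posrE ?invr_gt0 ?expR_gt0//.
  have := expR_ge1Dx (2 * n.+1%:R : R).
  apply: le_trans.
  have : d^-1 <= n%:R by near: n; exact: nbhs_infty_ger.
  by move=> dn; have := ler0n R n; rewrite -natr1; lra.
- by move=> n t _; apply: h_bound; [|apply: e2_neqN1]; rewrite /= ?invr_ge0 ?invr_gt0.
Unshelve. all: by end_near. Qed.

Let M_cvg_line : M n.+1%:R^-1 @[n --> \oo] -->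
  \int[mu]_(t in I) Re (f ((x + y * tan t) +i* e)).
Proof.
have cI t : I t -> cos t != 0.
  by rewrite /I /= in_itv /= => tI; rewrite gt_eqF// cos_gt0_pihalf.
have hE t : I t -> h (t +i* 0) = f ((x + y * tan t) +i* e).
  move=> /cI c0; rewrite /h /disc.
  rewrite (_ : 2 * (t +i* 0) = (2 * t)%:C); last first.
    by apply: complex_eqP; rewrite !(ReM, ImM, Re_nat, Im_nat) /=; ring.
  by rewrite (cayley_expi x y c0).2; congr f; apply: complex_eqP => /=; ring.
have h0 t : I t -> 1 + expi (2 * (t +i* 0)) != 0.
  move=> /cI c0; rewrite (_ : 2 * (t +i* 0) = (2 * t)%:C); last first.
    by apply: complex_eqP; rewrite !(ReM, ImM, Re_nat, Im_nat) /=; ring.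
  by have [] := cayley_expi 0 0 c0.
rewrite [X in _ --> X](_ : _ = \int[mu]_(t in I) Re (h (t +i* 0))); last first.
  by apply: eq_Rintegral => t; rewrite inE => /hE ->.
under eq_fun do rewrite M_open//.
apply: (@Rintegral_dct _ _ _ _ (cst B)) => //.
- exact: measurable_itv.
- by move=> n; apply: h_meas; rewrite ?invr_gt0 ltr0Sn.
- apply: open_itv_measurable => t tI; apply: h_cont => //.
  by apply: h0.
- move=> t tI; apply: (@ccontinuous_seq h (t +i* 0)).
    have [l hl] : exists l, cdiff h (t +i* 0) l by apply: h_cdiff (h0 t tI).
    exact: cdiff_ccontinuous hl.
  rewrite (_ : (fun n => _) = (fun n => n.+1%:R^-1)).
    exact: cvg_harmonic.
  apply/funext => n; rewrite cmodE !(ReD, ImD, ReN, ImN) /= subrr subr0 expr0n add0r.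
  by rewrite sqrtr_sqr ger0_norm.
- by move=> n t _; apply: h_bound; [|apply: e2_neqN1]; rewrite /= ?invr_ge0 ?invr_gt0.
Qed.

(** The mean value property of [Re f] over hyperbolic circles, in the limit
    where the circle opens up to the horizontal line at height [e]: Poisson's
    formula in the angular coordinate. *)
Lemma Poisson_angle :
  \int[mu]_(t in `]- (pi / 2), pi / 2[) Re (f ((x + y * tan t) +i* e)) =
  pi * Re (f (x +i* (y + e))).
Proof.
have M1 v : 0 < v -> M v = M 1.
  by move=> v0; case: (leP v 1) => v1; [exact: M_const|rewrite (@M_const 1 v)// ltW].
have c1 : M n.+1%:R^-1 @[n --> \oo] --> M 1.
  by rewrite (_ : (fun n => _) = cst (M 1)); [exact: cvg_cst|apply/funext => n; exact: M1].
have c2 : M n.+1%:R @[n --> \oo] --> M 1.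
  by rewrite (_ : (fun n => _) = cst (M 1)); [exact: cvg_cst|apply/funext => n; exact: M1].
rewrite (cvg_unique (@Rhausdorff R) M_cvg_line c1).
exact: (cvg_unique (@Rhausdorff R) c2 M_cvg_center).
Qed.

End MeanValue.

(** * The angular coordinate on the line *)

Section Substitution.
Variable R : realType.
Implicit Types (F f h : R -> R) (a b x y : R).

Lemma is_derive_affine f (t d x y : R) : is_derive t 1 f d ->
  is_derive t 1 (fun t => x + y * f t) (y * d).
Proof.
move=> df.
have h := @is_deriveD R R R _ _ t 1 _ _ (is_derive_cst x t 1) (is_deriveZ y df).
by apply: (is_derive_eq h); rewrite add0r.
Qed.

Lemma segment_substitution F f h a b a' b' : a' < a -> b < b' -> a <= b ->
  (forall t, a' < t < b' -> is_derive t 1 F (f t)) ->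
  (forall t, a' < t < b' -> {for t, continuous f}) ->
  {in `[a, b] &, {homo F : t u / t < u}} ->
  continuous h ->
  (\int[mu]_(t in `[F a, F b]) (h t)%:E =
   \int[mu]_(t in `[a, b]) (h (F t) * f t)%:E)%E.
Proof.
move=> a'a bb' ab dF cf iF ch.
have dFE t : a' < t < b' -> derive1 F t = f t.
  by move=> tab; have := dF t tab; rewrite derive1E => -[_ ->].
have cF' t : a' < t < b' -> {for t, continuous (derive1 F)}.
  move=> tab; have := cf t tab; rewrite /prop_for /continuous_at dFE//.
  apply: cvg_trans; apply: near_eq_cvg.
  have : \forall u \near t, u \in `]a', b'[ by apply: near_in_itvoo; rewrite in_itv.
  by apply: filterS => u; rewrite in_itv /= => /dFE.
have inab t : a <= t <= b -> a' < t < b' by move=> tab; lra.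
have cFt t : a' < t < b' -> {for t, continuous F}.
  move=> /dF [dFt _]; apply: differentiable_continuous.
  exact/derivable1_diffP.
rewrite (@integration_by_substitution_increasing R F h a b ab iF).
- apply: eq_integral => t; rewrite inE /= in_itv /= => tab.
  by rewrite -dFE ?inab.
- by move=> t; rewrite in_itv /= => tab; apply: cF'; lra.
- apply/cvg_ex; exists (derive1 F a).
  by apply: cvg_at_right_filter; apply: cF'; lra.
- apply/cvg_ex; exists (derive1 F b).
  by apply: cvg_at_left_filter; apply: cF'; lra.
- split.
  + by move=> t; rewrite in_itv /= => tab; have [] := dF t ltac:(lra).
  + by apply: cvg_at_right_filter; apply: cFt; lra.
  + by apply: cvg_at_left_filter; apply: cFt; lra.
- exact: continuous_subspaceT.
Qed.

Lemma cvg_atan_nat_cover (t : R) : - (pi / 2) < t < pi / 2 ->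
  exists n, - atan n%:R <= t <= atan (n%:R : R).
Proof.
move=> tpi; exists (Num.truncn `|tan t|).+1.
have tn : `|tan t| <= (Num.truncn `|tan t|).+1%:R by rewrite ltW// truncnS_gt.
have tI : t \in `]- (pi / 2), pi / 2[ by rewrite in_itv.
rewrite -[X in _ <= X <= _]tanK//; move: tn; rewrite ler_norml => /andP[n1 n2].
by rewrite -atanN; apply/andP; split; apply: le_atan.
Qed.

(** The angular coordinate [t = x + y * tan phi] of the boundary line, as seen
    from [x +i* y]. *)
Lemma tan_substitution h x y : 0 < y -> continuous h -> (forall t, 0 <= h t) ->
  (\int[mu]_t (h t)%:E = \int[mu]_(t in `](- (pi / 2))%R, (pi / 2)%R[)
     (h (x + y * tan t) * (y * (cos t) ^- 2))%:E)%E.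
Proof.
move=> y0 ch h0.
pose A n : R := atan n%:R.
have A0 n : 0 <= A n by rewrite -atan0; apply: le_atan.
have Api n : A n < pi / 2 by exact: atan_ltpi2.
have Am m n : (m <= n)%N -> A m <= A n by move=> mn; apply: le_atan; rewrite ler_nat.
have cI t : - (pi / 2) < t < pi / 2 -> cos t != 0 :> R.
  by move=> tI; rewrite gt_eqF// cos_gt0_pihalf.
have pi0 := pi_gt0 R.
pose F t : R := x + y * tan t.
have dF t : - (pi / 2) < t < pi / 2 -> is_derive t 1 F (y * (cos t) ^- 2).
  by move=> /cI c0; apply: is_derive_affine; exact: is_derive_tan.
have cF t : - (pi / 2) < t < pi / 2 -> {for t, continuous F}.
  move=> /dF [dFt _]; apply: differentiable_continuous; exact/derivable1_diffP.
have cf t : - (pi / 2) < t < pi / 2 -> {for t, continuous (fun t => y * (cos t) ^- 2)}.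
  move=> /cI c0; apply: continuousM; first exact: cvg_cst.
  apply: cvgV; first by rewrite expf_neq0.
  apply: (@continuous_comp _ _ _ cos (fun u => u ^+ 2)); first exact: continuous_cos.
  exact: exprn_continuous.
have sub n : (\int[mu]_(t in `[F (- A n)%R, F (A n)]) (h t)%:E =
    \int[mu]_(t in `[(- A n)%R, (A n)]) (h (F t) * (y * (cos t) ^- 2))%:E)%E.
  apply: (@segment_substitution _ _ _ _ _ (- (pi / 2)) (pi / 2)) => //.
  - by rewrite ltrN2.
  - by have := A0 n; lra.
  - move=> t u; rewrite !in_itv /= => /andP[t1 t2] /andP[u1 u2] tu.
    by rewrite /F ltrD2l ltr_pM2l// ltr_tan// in_itv /=; have := Api n; lra.
have FA n : F (A n) = x + y * n%:R by rewrite /F atanK.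
have FNA n : F (- A n) = x - y * n%:R by rewrite /F tanN atanK mulrN.
have c1 : (\int[mu]_(t in `[F (- A n)%R, F (A n)]) (h t)%:E)%E @[n --> \oo] -->
    (\int[mu]_t (h t)%:E)%E.
  have E : \bigcup_n `[F (- A n), F (A n)]%classic = [set: R].
    rewrite -subTset => t _; exists (Num.truncn `|(t - x) / y|).+1 => //=.
    rewrite in_itv /= FA FNA.
    have : `|(t - x) / y| <= (Num.truncn `|(t - x) / y|).+1%:R by rewrite ltW// truncnS_gt.
    move: (_.+1%:R) => N; rewrite ler_norml ler_pdivrMr// ler_pdivlMr// => /andP[n1 n2].
    by apply/andP; split; lra.
  rewrite -E; apply: ge0_nondecreasing_set_cvg_integral.
  - move=> m n mn; apply/subsetPset => t /=; rewrite !in_itv /= !FA !FNA.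
    have : y * m%:R <= y * n%:R by rewrite ler_pM2l// ler_nat.
    by move=> ? /andP[? ?]; apply/andP; split; lra.
  - by move=> n; exact: measurable_itv.
  - move=> n; apply/measurable_EFinP; apply: measurable_funTS.
    exact: continuous_measurable_fun.
  - by move=> n t _; rewrite lee_fin.
have c2 : (\int[mu]_(t in `[(- A n)%R, (A n)]) (h (F t) * (y * (cos t) ^- 2))%:E)%E
    @[n --> \oo] -->
    (\int[mu]_(t in `](- (pi / 2))%R, (pi / 2)%R[) (h (F t) * (y * (cos t) ^- 2))%:E)%E.
  have E : \bigcup_n `[- A n, A n]%classic = `]- (pi / 2), pi / 2[%classic :> set R.
    apply/seteqP; split => t /=.
      by move=> [n _] /=; rewrite !in_itv /=; have := Api n; lra.
    by rewrite in_itv /= => /cvg_atan_nat_cover[n tn]; exists n => //=; rewrite in_itv.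
  rewrite -E; apply: ge0_nondecreasing_set_cvg_integral.
  - move=> m n mn; apply/subsetPset => t /=; rewrite !in_itv /=.
    by have := Am _ _ mn; move=> ? /andP[? ?]; apply/andP; split; lra.
  - by move=> n; exact: measurable_itv.
  - move=> n; apply/measurable_EFinP.
    apply: (@measurable_funS _ _ _ _ `]- (pi / 2), pi / 2[%classic) => //.
      by move=> t /=; rewrite !in_itv /=; have := Api n; lra.
    apply: open_itv_measurable => t; rewrite in_itv /= => tI.
    apply: (@cvgM _ _ _ _ (h \o F)); last exact: cf.
    by apply: continuous_comp; [exact: cF|exact: ch].
  - move=> n t _; rewrite lee_fin; apply: mulr_ge0 => //; apply: mulr_ge0; first exact: ltW.
    by rewrite invr_ge0 sqr_ge0.
move: c1; under eq_fun do rewrite sub.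
by move=> c1; apply: (cvg_unique _ c1 c2); exact: ereal_hausdorff.
Qed.

End Substitution.

(** * Complex integrals over the line *)

Section TameIntegrals.
Variable R : realType.
Implicit Types (h k : R -> R[i]) (z : R[i]) (x y t B C : R).

Lemma oneDsqr_gt0 t : 0 < 1 + t ^+ 2.
Proof. by rewrite ltr_wpDr// sqr_ge0. Qed.

Lemma continuous_oneDsqrV : continuous (fun t : R => (1 + t ^+ 2)^-1).
Proof.
move=> t; apply: cvgV; first by rewrite gt_eqF// oneDsqr_gt0.
by apply: cvgD; [exact: cvg_cst|exact: exprn_continuous].
Qed.

(** The substitution [t = tan phi] makes the integrand 1. *)
Lemma integral_oneDsqrV :
  (\int[mu]_t ((1 + t ^+ 2)^-1)%:E = (pi : R)%:E)%E.
Proof.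
rewrite (@tan_substitution _ _ 0 1)//; first last.
- by move=> t; rewrite invr_ge0 ltW// oneDsqr_gt0.
- exact: continuous_oneDsqrV.
transitivity (\int[mu]_(t in `](- (pi / 2))%R, (pi / 2)%R[) (cst 1%:E t : \bar R))%E.
  apply: eq_integral => t; rewrite inE /= in_itv /= => tI; congr (_%:E).
  have c0 : cos t != 0 by rewrite gt_eqF// cos_gt0_pihalf.
  rewrite add0r !mul1r cos2_tan2// mulVf//.
  by rewrite gt_eqF// oneDsqr_gt0.
rewrite integral_cst//= mul1e lebesgue_measure_itv/= lte_fin.
have -> : - (pi / 2) < pi / 2 :> R by have := pi_gt0 R; lra.
by congr (_%:E); field.
Qed.

Lemma integrable_oneDsqrV :
  mu.-integrable [set: R] (EFin \o (fun t => (1 + t ^+ 2)^-1)).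
Proof.
apply/integrableP; split.
  by apply/measurable_EFinP; exact: continuous_measurable_fun continuous_oneDsqrV.
rewrite [X in (X < _)%E](_ : _ = \int[mu]_t ((1 + t ^+ 2)^-1)%:E)%E; last first.
  by apply: eq_integral => t _ /=; rewrite ger0_norm// invr_ge0 ltW// oneDsqr_gt0.
by rewrite integral_oneDsqrV ltry.
Qed.

Lemma integrable_le_oneDsqrV (f : R -> R) C : measurable_fun setT f ->
  (forall t, `|f t| <= C / (1 + t ^+ 2)) -> mu.-integrable setT (EFin \o f).
Proof.
move=> mf fC.
apply: (@le_integrable _ _ _ mu _ _ _ (EFin \o (fun t => C * (1 + t ^+ 2)^-1))) => //.
- exact/measurable_EFinP.
- by move=> t _; rewrite lee_fin (le_trans (fC t))// ler_norm.
- exact: (integrableZl measurableT C integrable_oneDsqrV).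
Qed.

Lemma Rintegral_le_oneDsqrV (f : R -> R) C : measurable_fun setT f ->
  (forall t, `|f t| <= C / (1 + t ^+ 2)) -> `|\int[mu]_t f t| <= C * pi.
Proof.
move=> mf fC; have If := integrable_le_oneDsqrV mf fC.
apply: le_trans (le_normr_Rintegral measurableT If) _.
apply: (@le_trans _ _ (\int[mu]_t (C * (1 + t ^+ 2)^-1))).
  apply: le_Rintegral => //; first exact: (integrable_norm If).
  exact: (integrableZl measurableT C integrable_oneDsqrV).
by rewrite RintegralZl ?integrable_oneDsqrV// /Rintegral integral_oneDsqrV.
Qed.

(** A class stable under complex linear combinations on which the integral is
    linear; its members decay like the square of a resolvent. *)
Definition tame h := [/\ measurable_fun setT (fun t => Re (h t)),
  measurable_fun setT (fun t => Im (h t)) &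
  exists C, forall t, cmod (h t) <= C / (1 + t ^+ 2)].

Definition cint h : R[i] :=
  (\int[mu]_t Re (h t)) +i* (\int[mu]_t Im (h t)).

Lemma tame_Re h : tame h -> mu.-integrable setT (EFin \o (fun t => Re (h t))).
Proof.
move=> [mr _ [C hC]]; apply: (@integrable_le_oneDsqrV _ C) => // t.
exact: le_trans (Re_le_cmod _) (hC t).
Qed.

Lemma tame_Im h : tame h -> mu.-integrable setT (EFin \o (fun t => Im (h t))).
Proof.
move=> [_ mi [C hC]]; apply: (@integrable_le_oneDsqrV _ C) => // t.
exact: le_trans (Im_le_cmod _) (hC t).
Qed.

Lemma tameD h k : tame h -> tame k -> tame (fun t => h t + k t).
Proof.
move=> [hr hi [C hC]] [kr ki [D kD]]; split.
- by under eq_fun do rewrite ReD; exact: measurable_funD.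
- by under eq_fun do rewrite ImD; exact: measurable_funD.
- by exists (C + D) => t; rewrite (le_trans (cmodD _ _))// mulrDl lerD.
Qed.

Lemma tameMl z h : tame h -> tame (fun t => z * h t).
Proof.
move=> [hr hi [C hC]]; split.
- by under eq_fun do rewrite ReM; apply: measurable_funB; apply: measurable_funM.
- by under eq_fun do rewrite ImM; apply: measurable_funD; apply: measurable_funM.
- by exists (cmod z * C) => t; rewrite cmodM -mulrA ler_wpM2l// cmod_ge0.
Qed.

Lemma cintD h k : tame h -> tame k ->
  cint (fun t => h t + k t) = cint h + cint k.
Proof.
move=> th tk; apply: complex_eqP; rewrite /cint ?ReD ?ImD /=.
- rewrite -RintegralD //; try exact: tame_Re.
  by apply: eq_Rintegral => t _; rewrite ReD.
- rewrite -RintegralD //; try exact: tame_Im.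
  by apply: eq_Rintegral => t _; rewrite ImD.
Qed.

Lemma cintMl z h : tame h -> cint (fun t => z * h t) = z * cint h.
Proof.
move=> th; have ir := tame_Re th; have ii := tame_Im th.
have iZ (c : R) (f : R -> R) : mu.-integrable setT (EFin \o f) ->
    mu.-integrable setT (EFin \o (fun t => c * f t)).
  by move=> fi; exact: (integrableZl measurableT c fi).
apply: complex_eqP; rewrite /cint ?ReM ?ImM /=.
- rewrite -!RintegralZl// -RintegralB//; try exact: iZ.
  by apply: eq_Rintegral => t _; rewrite ReM.
- rewrite -!RintegralZl// -RintegralD//; try exact: iZ.
  by apply: eq_Rintegral => t _; rewrite ImM.
Qed.

Lemma cmod_cint h C : tame h -> (forall t, cmod (h t) <= C / (1 + t ^+ 2)) ->
  cmod (cint h) <= 2 * C * pi.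
Proof.
move=> [hr hi _] hC; apply: le_trans (cmod_le _) _.
rewrite -mulrA mulr_natl mulr2n; apply: lerD; apply: Rintegral_le_oneDsqrV => // t.
- exact: le_trans (Re_le_cmod _) (hC t).
- exact: le_trans (Im_le_cmod _) (hC t).
Qed.

Lemma tame_weight (sg : R -> R) k B C :
  measurable_fun setT sg -> (forall t, `|sg t| <= B) ->
  continuous (fun t => Re (k t)) -> continuous (fun t => Im (k t)) ->
  (forall t, cmod (k t) <= C / (1 + t ^+ 2)) ->
  tame (fun t => (sg t)%:C * k t).
Proof.
move=> ms sB cr ci kC; split.
- under eq_fun do rewrite ReM /= mul0r subr0.
  by apply: measurable_funM => //; exact: continuous_measurable_fun.
- under eq_fun do rewrite ImM /= mul0r addr0.
  by apply: measurable_funM => //; exact: continuous_measurable_fun.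
- exists (B * C) => t; rewrite cmodM cmod_real -mulrA.
  by apply: ler_pM => //; exact: cmod_ge0.
Qed.

End TameIntegrals.

(** * Cauchy integrals of bounded densities *)

Section CauchyKernel.
Variable R : realType.
Implicit Types (h k : R -> R[i]) (z w : R[i]) (t B C : R).

Definition resolvent z t : R[i] := (t%:C - z)^-1.

(** The kernel [1 / (t - z) ^ (n + 1)]; for [n = 0] a real term without
    [z] is subtracted to make it integrable at infinity. *)
Definition kern n z t : R[i] :=
  if n is 0%N then resolvent z t - (t / (1 + t ^+ 2))%:C
  else resolvent z t ^+ n.+1.

Lemma Im_cmod_resolvent z t : `|Im z| <= cmod (t%:C - z).
Proof. by have := Im_le_cmod (t%:C - z); rewrite ImD ImN /= sub0r normrN. Qed.

Lemma resolvent_neq0 z t : 0 < Im z -> t%:C - z != 0.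
Proof.
move=> z0; rewrite -cmod_gt0; apply: lt_le_trans (Im_cmod_resolvent z t).
by rewrite normr_gt0 gt_eqF.
Qed.

Lemma cmod_resolvent_le z t : 0 < Im z -> cmod (resolvent z t) <= (Im z)^-1.
Proof.
move=> z0; rewrite cmodV lef_pV2 ?posrE ?cmod_gt0 ?resolvent_neq0//.
by apply: le_trans (Im_cmod_resolvent z t); rewrite ler_norm.
Qed.

Lemma sqr_cmod_resolvent_le z : 0 < Im z -> exists C, forall t,
  cmod (resolvent z t) ^+ 2 <= C / (1 + t ^+ 2).
Proof.
move=> z0; exists (2 + (1 + 2 * Re z ^+ 2) / Im z ^+ 2) => t.
have z2 : 0 < Im z ^+ 2 by rewrite exprn_gt0.
rewrite cmodV exprVn sqr_cmod ReD ImD ReN ImN /= sub0r sqrrN.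
have D0 : 0 < (t - Re z) ^+ 2 + Im z ^+ 2 by rewrite ltr_wpDl ?sqr_ge0.
rewrite ler_pdivlMr ?oneDsqr_gt0// mulrC ler_pdivrMr//.
have c0 : 0 <= (1 + 2 * Re z ^+ 2) / Im z ^+ 2.
  by apply: divr_ge0; [have := sqr_ge0 (Re z); lra|exact: ltW].
have E : (1 + 2 * Re z ^+ 2) / Im z ^+ 2 * Im z ^+ 2 = 1 + 2 * Re z ^+ 2.
  by rewrite divfK// gt_eqF.
move: c0 E; set c := (1 + _) / _ => c0 E.
have h1 : 0 <= c * (t - Re z) ^+ 2 by rewrite mulr_ge0 ?sqr_ge0.
have h2 : 0 <= (t - 2 * Re z) ^+ 2 by exact: sqr_ge0.
rewrite mulrDl [c * _]mulrDr E; move: h1; rewrite [c * _]mulrC.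
by move: h2 z2; nra.
Qed.

Definition ccts k := continuous (fun t => Re (k t)) /\ continuous (fun t => Im (k t)).

Lemma cctsM h k : ccts h -> ccts k -> ccts (fun t => h t * k t).
Proof.
move=> [hr hi] [kr ki]; split=> t.
- under eq_fun do rewrite ReM; apply: cvgB; apply: cvgM;
    [exact: hr|exact: kr|exact: hi|exact: ki].
- under eq_fun do rewrite ImM; apply: cvgD; apply: cvgM;
    [exact: hr|exact: ki|exact: hi|exact: kr].
Qed.

Lemma cctsX k n : ccts k -> ccts (fun t => k t ^+ n).
Proof.
move=> ck; elim: n => [|n IH]; first by split=> t; exact: cvg_cst.
by under eq_fun do rewrite exprS; exact: cctsM.
Qed.

Lemma ccts_resolvent z : 0 < Im z -> ccts (resolvent z).
Proof.
move=> z0.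
have cg t : ccontinuous (fun w => (w - z)^-1) (t +i* 0).
  have h1 : cdiff (fun w => 1 * w + (- z)) (t +i* 0) 1 by exact: cdiff_affine.
  have h2 := cdiff_comp h1 (@cdiff_inv R (1 * (t +i* 0) - z) ltac:(by rewrite mul1r; exact: resolvent_neq0)).
  have := cdiff_ccontinuous h2.
  by rewrite (_ : (fun w => (1 * w - z)^-1) = (fun w => (w - z)^-1))//;
    apply/funext => w; rewrite mul1r.
by split=> t; have [] := @ccontinuous_curve _ _ id (cst 0) t (cg t)
  (@cvg_id _ _) (cvg_cst 0).
Qed.

Lemma ccts_kern n z : 0 < Im z -> ccts (kern n z).
Proof.
move=> z0; have [cr ci] := ccts_resolvent z0.
case: n => [|n] /=; last exact: cctsX (ccts_resolvent z0).
split=> t.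
- under eq_fun do rewrite ReD ReN /=.
  apply: cvgB; first exact: cr.
  by apply: cvgM; [exact: cvg_id|exact: continuous_oneDsqrV].
- under eq_fun do rewrite ImD ImN /= subr0.
  exact: ci.
Qed.

(** The subtracted term is what makes the case [n = 0] decay like [1 / t ^ 2]. *)
Lemma kern_bound n z : 0 < Im z -> exists C, forall t,
  cmod (kern n z t) <= C / (1 + t ^+ 2).
Proof.
move=> z0; case: n => [|n] /=.
- exists (cmod z + cmod (1 + z ^+ 2) / Im z) => t.
  have t0 := oneDsqr_gt0 t; have rz := resolvent_neq0 t z0.
  have rt : (1 + t ^+ 2)%:C != 0 :> R[i] by rewrite eq_complex /= eqxx andbT gt_eqF.
  have -> : resolvent z t - (t / (1 + t ^+ 2))%:C =
      (z + (1 + z ^+ 2) * resolvent z t) * ((1 + t ^+ 2)%:C)^-1.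
    rewrite fmorph_div /= /resolvent rmorphD rmorphXn /= rmorph1 in rt *.
    by field; rewrite rz rt.
  rewrite cmodM cmodV cmod_real (gtr0_norm t0).
  apply: ler_wpM2r; first by rewrite invr_ge0 ltW.
  apply: le_trans (cmodD _ _) _; rewrite lerD2l cmodM ler_wpM2l ?cmod_ge0//.
  exact: cmod_resolvent_le.
- have [C hC] := sqr_cmod_resolvent_le z0.
  exists ((Im z)^-1 ^+ n * C) => t; rewrite cmodX -addn2 exprD -mulrA.
  apply: ler_pM => //; rewrite ?exprn_ge0 ?cmod_ge0//.
  apply: lerXn2r; last exact: cmod_resolvent_le.
    by rewrite nnegrE cmod_ge0.
  by rewrite nnegrE invr_ge0 ltW.
Qed.

(** The second order remainder of [a ^ m] when [a] moves to [a'] with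
    [a' - a = h a a'], as [1 / (t - z)] does when [z] moves by [h]. *)
Lemma power_remainder (A : R) m : 0 <= A -> exists2 C, 0 <= C &
  forall a a' h : R[i], a' - a = h * a * a' -> cmod a <= A -> cmod a' <= A ->
  cmod (a' ^+ m - a ^+ m - m%:R * h * a ^+ m.+1) <=
    C * cmod h ^+ 2 * cmod a ^+ 2.
Proof.
move=> A0; elim: m => [|m [C C0 IH]].
  by exists 0 => // a a' h _ _ _; rewrite !expr0 subrr !mul0r subr0 cmod0.
exists (A * C + m.+1%:R * A ^+ m.+1); first by rewrite addr_ge0 ?mulr_ge0 ?exprn_ge0.
move=> a a' h ha aA a'A.
have -> : a' ^+ m.+1 - a ^+ m.+1 - m.+1%:R * h * a ^+ m.+2 =
    a' * (a' ^+ m - a ^+ m - m%:R * h * a ^+ m.+1) +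
    m.+1%:R * (h ^+ 2 * a ^+ 2 * (a ^+ m * a')).
  have a'E : a' = a + h * a * a' by rewrite -ha; ring.
  rewrite -[m.+1%:R]natr1 !exprS.
  transitivity (a' * (a' ^+ m - a ^+ m - m%:R * h * (a * a ^+ m)) +
    (m%:R + 1) * h * a * a ^+ m * (a' - a)); last by rewrite ha; ring.
  transitivity (a' * (a' ^+ m - a ^+ m) + (a' - a) * a ^+ m - (m%:R + 1) * h * (a * (a * a ^+ m))).
    by ring.
  by rewrite {1}ha; ring.
apply: le_trans (cmodD _ _) _; rewrite !mulrDl; apply: lerD.
  rewrite cmodM; apply: (@le_trans _ _ (A * (C * cmod h ^+ 2 * cmod a ^+ 2))).
    by apply: ler_pM => //; [exact: cmod_ge0|exact: cmod_ge0|exact: IH].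
  by rewrite !mulrA.
rewrite cmodM (_ : m.+1%:R = (m.+1%:R)%:C); last by rewrite rmorph_nat.
rewrite cmod_real ger0_norm// !cmodM !cmodX.
rewrite [X in _ <= X](_ : _ = m.+1%:R * (cmod h ^+ 2 * cmod a ^+ 2 * A ^+ m.+1)); last by ring.
rewrite ler_wpM2l// ler_wpM2l ?mulr_ge0 ?exprn_ge0 ?cmod_ge0//.
rewrite exprSr; apply: ler_pM; rewrite ?exprn_ge0 ?cmod_ge0//.
by apply: lerXn2r; rewrite ?nnegrE ?cmod_ge0.
Qed.

(** The subtracted term does not depend on [z]. *)
Lemma kernB n z w t : kern n w t - kern n z t =
  resolvent w t ^+ n.+1 - resolvent z t ^+ n.+1.
Proof. by case: n => [|n] //=; rewrite !expr1; ring. Qed.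

Section Density.
Variables (sg : R -> R) (B : R).
Hypothesis msg : measurable_fun setT sg.
Hypothesis sgB : forall t, `|sg t| <= B.

Definition cauchy_int n z := cint (fun t => (sg t)%:C * kern n z t).

Lemma tame_kern n z : 0 < Im z -> tame (fun t => (sg t)%:C * kern n z t).
Proof.
move=> z0; have [C hC] := kern_bound n z0; have [cr ci] := ccts_kern n z0.
exact: tame_weight hC.
Qed.

(** Differentiation under the integral sign: by [power_remainder] the remainder of
    the kernel is [O (cmod h ^ 2)] uniformly against [1 / (1 + t ^ 2)], as long as
    the point stays above half its height. *)
Lemma cdiff_cauchy_int n z : 0 < Im z ->
  cdiff (cauchy_int n) z (n.+1%:R * cauchy_int n.+1 z).
Proof.
move=> z0 e e0.
have y2 : 0 < Im z / 2 by rewrite divr_gt0.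
have [C C0 hC] := @power_remainder (Im z / 2)^-1 n.+1 ltac:(by rewrite invr_ge0 ltW).
have [D hD] := sqr_cmod_resolvent_le z0.
have B0 : 0 <= B := le_trans (normr_ge0 _) (sgB 0).
have D0 : 0 <= D.
  by have := le_trans (sqr_ge0 _) (hD 0); rewrite expr0n addr0 divr1.
pose K := 2 * (B * (C * D)) * pi + 1.
have K0 : 0 < K by rewrite ltr_wpDl// !mulr_ge0// pi_ge0.
exists (Num.min (Im z / 2) (e / K)); first by rewrite lt_min y2 divr_gt0.
move=> h; rewrite lt_min => /andP[h1 h2].
have zh0 : Im z / 2 < Im (z + h).
  have := le_lt_trans (Im_le_cmod h) h1; rewrite ltr_norml ImD => /andP[? _]; lra.
have zh : 0 < Im (z + h) by rewrite (lt_trans _ zh0).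
have -> : cauchy_int n (z + h) - cauchy_int n z - n.+1%:R * cauchy_int n.+1 z * h =
  cint (fun t => (sg t)%:C * kern n (z + h) t + ((-1) * ((sg t)%:C * kern n z t) +
    (- (n.+1%:R * h)) * ((sg t)%:C * kern n.+1 z t))).
  have t1 := tame_kern n zh; have t2 := tame_kern n z0; have t3 := tame_kern n.+1 z0.
  rewrite (cintD t1); last by apply: tameD; exact: tameMl.
  rewrite cintD; [|exact: tameMl|exact: tameMl].
  by rewrite !cintMl// /cauchy_int; ring.
apply: (@le_trans _ _ (2 * (B * (C * D) * cmod h ^+ 2) * pi)).
  apply: cmod_cint.
    by apply: tameD; [exact: tame_kern|apply: tameD; apply: tameMl; exact: tame_kern].
  move=> t.
  have -> : (sg t)%:C * kern n (z + h) t + ((-1) * ((sg t)%:C * kern n z t) +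
    (- (n.+1%:R * h)) * ((sg t)%:C * kern n.+1 z t)) =
    (sg t)%:C * (resolvent (z + h) t ^+ n.+1 - resolvent z t ^+ n.+1 -
      n.+1%:R * h * resolvent z t ^+ n.+2).
    rewrite -kernB; case: n {hC} => [|n] /=; ring.
  rewrite cmodM cmod_real.
  apply: (@le_trans _ _ (B * (C * cmod h ^+ 2 * cmod (resolvent z t) ^+ 2))).
    apply: ler_pM; rewrite ?cmod_ge0//; apply: hC.
    - rewrite /resolvent.
      have z1 := resolvent_neq0 t z0; have z2 := resolvent_neq0 t zh.
      by field; rewrite z1 z2.
    - apply: le_trans (cmod_resolvent_le t z0) _.
      by rewrite lef_pV2 ?posrE//; lra.
    - apply: le_trans (cmod_resolvent_le t zh) _.
      by rewrite lef_pV2 ?posrE// ltW.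
  apply: (@le_trans _ _ (B * (C * cmod h ^+ 2 * (D / (1 + t ^+ 2))))).
    by rewrite ler_wpM2l// ler_wpM2l// mulr_ge0// sqr_ge0.
  by rewrite le_eqVlt; apply/orP; left; apply/eqP; ring.
rewrite (_ : _ * pi = (K - 1) * cmod h * cmod h); last by rewrite /K; ring.
rewrite ler_wpM2r ?cmod_ge0// (le_trans (y := K * cmod h))//.
  by rewrite ler_wpM2r ?cmod_ge0// lerBlDr lerDl.
by rewrite mulrC -ler_pdivlMr// ltW.
Qed.

End Density.

End CauchyKernel.

(** * Poisson integrals *)

Section Poisson.
Variable R : realType.
Implicit Types (z w : R[i]) (t : R) (sg : R -> R).

Lemma Im_resolvent z t : Im (resolvent z t) =
  Im z / ((t - Re z) ^+ 2 + Im z ^+ 2).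
Proof. by case: z => x y; rewrite /resolvent /= sub0r sqrrN mulNr opprK. Qed.

Lemma Im_kern0 z t : Im (kern 0 z t) = Im (resolvent z t).
Proof. by rewrite /= ImD ImN /= subr0. Qed.

Lemma Im_resolvent_ge0 z t : 0 < Im z -> 0 <= Im (resolvent z t).
Proof.
by move=> z0; rewrite Im_resolvent divr_ge0 ?addr_ge0 ?sqr_ge0 ?ltW.
Qed.

Lemma cos_angle_neq0 t : t \in `]- (pi / 2), pi / 2[ -> cos t != 0 :> R.
Proof. by rewrite in_itv /= => tI; rewrite gt_eqF// cos_gt0_pihalf. Qed.

(** The Poisson kernel is the density of the angular coordinate. *)
Lemma Im_resolvent_angle z t : 0 < Im z -> t \in `]- (pi / 2), pi / 2[ ->
  Im (resolvent z (Re z + Im z * tan t)) * (Im z * cos t ^- 2) = 1.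
Proof.
move=> z0 /cos_angle_neq0 c0; have y0 : Im z != 0 by rewrite gt_eqF.
rewrite Im_resolvent cos2_tan2//.
have t0 : 1 + tan t ^+ 2 != 0 by rewrite gt_eqF// oneDsqr_gt0.
rewrite [Re z + _]addrC addrK exprMn.
rewrite (_ : _ * _ + _ ^+ 2 = Im z ^+ 2 * (1 + tan t ^+ 2)); last by ring.
by field; rewrite t0 y0.
Qed.

Lemma Rintegral_tan (h : R -> R) z : 0 < Im z -> continuous h ->
  (forall t, 0 <= h t) ->
  \int[mu]_t h t = \int[mu]_(t in `]- (pi / 2), pi / 2[)
    (h (Re z + Im z * tan t) * (Im z * cos t ^- 2)).
Proof. by move=> z0 ch h0; rewrite /Rintegral (tan_substitution (Re z) z0 ch h0). Qed.

(** The substitution [t = Re z + Im z * tan phi] has Jacobian the inverse of the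
    Poisson kernel.  The rule of substitution asks for a nonnegative integrand,
    whence the shift of the density by its bound. *)
Lemma Rintegral_poisson sg (B : R) z : 0 < Im z -> continuous sg ->
  (forall t, `|sg t| <= B) ->
  \int[mu]_t (sg t * Im (kern 0 z t)) =
  \int[mu]_(t in `]- (pi / 2), pi / 2[) sg (Re z + Im z * tan t).
Proof.
move=> z0 cs sB.
have cP : continuous (fun t => Im (kern 0 z t)) by case: (ccts_kern 0 z0).
have P0 t : 0 <= Im (kern 0 z t) by rewrite Im_kern0 Im_resolvent_ge0.
have [C hC] := kern_bound 0 z0.
have PC t : `|Im (kern 0 z t)| <= C / (1 + t ^+ 2) := le_trans (Im_le_cmod _) (hC t).
have intw (k : R -> R) : continuous k -> (forall t, `|k t| <= B) ->
    mu.-integrable setT (EFin \o (fun t => k t * Im (kern 0 z t))).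
  move=> ck kB; apply: (@integrable_le_oneDsqrV _ _ (B * C)).
    by apply: measurable_funM; exact: continuous_measurable_fun.
  by move=> t; rewrite normrM -mulrA ler_pM.
have B0 : 0 <= B := le_trans (normr_ge0 _) (sB 0).
have cB : continuous (cst B : R -> R) by move=> t; exact: cvg_cst.
have intB := intw (cst B) cB (fun t => eq_ind_r (fun b => b <= B) (lexx B) (ger0_norm B0)).
have cT t : t \in `]- (pi / 2), pi / 2[ -> {for t, continuous (fun t : R => Re z + Im z * tan t)}.
  move=> /cos_angle_neq0 c0.
  have [d _] := is_derive_affine (Re z) (Im z) (is_derive_tan c0).
  by apply: differentiable_continuous; exact/derivable1_diffP.
have ms (k : R -> R) : continuous k -> (forall t, `|k t| <= B) ->
    mu.-integrable `]- (pi / 2), pi / 2[ (EFin \o (fun t => k (Re z + Im z * tan t))).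
  move=> ck kB; apply: (@bounded_integrable _ _ _ _ B) => //.
  apply: open_itv_measurable => t tI; apply: continuous_comp; [exact: cT|exact: ck].
have E (k : R -> R) : continuous k -> (forall t, 0 <= k t) ->
    \int[mu]_t (k t * Im (kern 0 z t)) =
    \int[mu]_(t in `]- (pi / 2), pi / 2[) k (Re z + Im z * tan t).
  move=> ck k0; rewrite (@Rintegral_tan (fun t => k t * Im (kern 0 z t)) z z0).
  - apply: eq_Rintegral => t; rewrite inE /= => tI.
    by rewrite Im_kern0 -mulrA Im_resolvent_angle// mulr1.
  - by move=> t; apply: cvgM; [exact: ck|exact: cP].
  - by move=> t; rewrite mulr_ge0.
have E1 := E (fun t => sg t + B).
have E2 := E (cst B) cB (fun=> B0).
apply: (addIr (\int[mu]_t (cst B t * Im (kern 0 z t)))).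
rewrite {2}E2.
have isg := intw sg cs sB.
have iI := ms sg cs sB.
have iIB : mu.-integrable `]- (pi / 2), pi / 2[
    (EFin \o (fun t => cst B (Re z + Im z * tan t))).
  by apply: ms => // t; rewrite ger0_norm.
rewrite -(RintegralD _ isg intB)// -(RintegralD _ iI iIB)//.
have -> : \int[mu]_t (sg t * Im (kern 0 z t) + cst B t * Im (kern 0 z t)) =
    \int[mu]_t ((sg t + B) * Im (kern 0 z t)).
  by apply: eq_Rintegral => t _; rewrite mulrDl.
rewrite E1//.
- by move=> t; apply: cvgD; [exact: cs|exact: cvg_cst].
- by move=> t; have := sB t; rewrite ler_norml => /andP[? _]; lra.
Qed.

(** Its real part is the Poisson integral of the density. *)
Definition poisson sg z : R[i] := (pi%:C * 'i)^-1 * cauchy_int sg 0 z.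

Lemma pii_neq0 : pi%:C * 'i != 0 :> R[i].
Proof.
by rewrite -cmod_gt0 cmodM cmod_real cmod_i mulr1 normr_gt0 gt_eqF// pi_gt0.
Qed.

Lemma Re_divpi (u : R[i]) : Re ((pi%:C * 'i)^-1 * u) = pi^-1 * Im u.
Proof.
have pi0 : pi != 0 :> R by rewrite gt_eqF// pi_gt0.
have -> : (pi%:C * 'i)^-1 = 0 +i* (- pi^-1) :> R[i].
  apply: (mulfI pii_neq0); rewrite mulfV ?pii_neq0//.
  apply: complex_eqP; rewrite !(ReM, ImM) /=; last by ring.
  by rewrite !(mulr0, mul0r, mulr1, addr0, sub0r) mulrN opprK mulfV.
by rewrite ReM /=; ring.
Qed.

Lemma Re_poisson sg (B : R) z : measurable_fun setT sg ->
  (forall t, `|sg t| <= B) -> 0 < Im z ->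
  Re (poisson sg z) = pi^-1 * \int[mu]_t (sg t * Im (kern 0 z t)).
Proof.
move=> ms sB z0; rewrite Re_divpi /cauchy_int /cint /=; congr (_ * _).
by apply: eq_Rintegral => t _; rewrite ImM /= mul0r addr0.
Qed.

(** Increments along the real and along the imaginary direction bound the two parts
    of the derivative. *)
Lemma cdiff_Re0 (g : R[i] -> R[i]) z l (d : R) : 0 < d -> cdiff g z l ->
  (forall w, cmod (w - z) < d -> Re (g w) = 0) -> l = 0.
Proof.
move=> d0 gl g0.
have small e : 0 < e -> `|Re l| <= e /\ `|Im l| <= e.
  move=> e0; have [d' d'0 dP] := gl e e0.
  pose r := Num.min d d' / 2.
  have r0 : 0 < r by rewrite divr_gt0// lt_min d0.
  have rd : r < d /\ r < d'.
    have : r < Num.min d d' by rewrite /r ltr_pdivrMr// ltr_pMr ?lt_min ?d0// ltr1n.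
    by rewrite lt_min => /andP.
  have gz : Re (g z) = 0 by apply: g0; rewrite subrr cmod0.
  have key h : cmod h = r -> `|Re (l * h)| <= e * r.
    move=> hr; have := dP h; rewrite hr => /(_ rd.2) /(le_trans (Re_le_cmod _)).
    have gh : Re (g (z + h)) = 0.
      by apply: g0; rewrite [z + h]addrC addrK hr; exact: rd.1.
    by rewrite !(ReD, ReN) gz gh subr0 sub0r normrN.
  split.
    have := key r%:C; rewrite cmod_real gtr0_norm// => /(_ erefl).
    by rewrite ReM /= mulr0 subr0 normrM (gtr0_norm r0) ler_pM2r.
  have := key (0 +i* r); rewrite cmodE /= expr0n add0r sqrtr_sqr gtr0_norm// => /(_ erefl).
  by rewrite ReM /= mulr0 sub0r normrN normrM (gtr0_norm r0) ler_pM2r.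
by apply: complex_eqP; apply/eqP; rewrite -normr_le0; apply/ler_addgt0Pr => e /small[];
  rewrite add0r.
Qed.

End Poisson.

(** * Derivatives as Cauchy integrals of the real part *)

Section Representation.
Variable R : realType.
Implicit Types (z w : R[i]) (t : R).
Variable f : R[i] -> R[i].
Hypothesis hf : forall z, 0 < Im z -> exists l, cdiff f z l.
Variable B : R.
Hypothesis fB : forall z, 0 < Im z -> `|Re (f z)| <= B.

Definition Re_line (e t : R) : R := Re (f (t +i* e)).

Lemma continuous_Re_line e : 0 < e -> continuous (Re_line e).
Proof.
move=> e0 t; have [l hl] := hf (e0 : 0 < Im (t +i* e)).
by have [] := @ccontinuous_curve _ f id (cst e) t (cdiff_ccontinuous hl)
  (@cvg_id _ _) (cvg_cst e).
Qed.

Lemma Re_line_bound e t : 0 < e -> `|Re_line e t| <= B.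
Proof. by move=> e0; exact: fB. Qed.

Lemma measurable_Re_line e : 0 < e -> measurable_fun setT (Re_line e).
Proof. by move=> e0; apply: continuous_measurable_fun; exact: continuous_Re_line. Qed.

Lemma Re_poisson_line e z : 0 < e -> 0 < Im z ->
  Re (poisson (Re_line e) z) = Re (f (z + (0 +i* e))).
Proof.
move=> e0 z0.
rewrite (Re_poisson (measurable_Re_line e0) (fun t => Re_line_bound t e0) z0).
rewrite (Rintegral_poisson z0 (continuous_Re_line e0) (fun t => Re_line_bound t e0)).
rewrite (Poisson_angle hf fB (Re z) z0 e0) mulKf ?gt_eqF ?pi_gt0//.
by congr (Re (f _)); apply: complex_eqP; rewrite ?ReD ?ImD /= ?addr0.
Qed.

(** [f] and the Poisson extension of its real part differ by a locally constant
    function, so they have the same derivatives. *)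
Lemma cderiv_cauchy s w e : 0 < e < Im w -> (0 < s)%N ->
  cderiv s f w =
  (pi%:C * 'i)^-1 * s`!%:R * cauchy_int (Re_line e) s (w - (0 +i* e)).
Proof.
move=> /andP[e0 ew] s0.
have ms := measurable_Re_line e0; have sB t := Re_line_bound t e0.
pose k := (pi%:C * 'i : R[i])^-1.
pose E : R[i] := 0 +i* e.
have shift (g : R[i] -> R[i]) z l : cdiff g (z - E) l -> cdiff (fun z => g (z - E)) z l.
  have h1 : cdiff (fun w => 1 * w + - E) z 1 by exact: cdiff_affine.
  rewrite -{1}[z]mul1r => /(cdiff_comp h1); rewrite mulr1.
  by apply: cdiff_near ltr01 _ => v _; rewrite mul1r.
pose g n : R[i] -> R[i] := if n is 0%N then f
  else fun w => k * (n`!%:R * cauchy_int (Re_line e) n (w - E)).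
have dC n z : e < Im z ->
    cdiff (fun w => k * (n`!%:R * cauchy_int (Re_line e) n (w - E))) z
      (k * (n.+1`!%:R * cauchy_int (Re_line e) n.+1 (z - E))).
  move=> ez; apply: cdiffMl.
  rewrite factS natrM [_%:R * _%:R]mulrC -mulrA; apply: cdiffMl.
  apply: shift; apply: cdiff_cauchy_int ms sB _ _ _.
  by rewrite ImD ImN /= subr_gt0.
have near_e z : e < Im z -> exists2 d : R, 0 < d & forall w, cmod (w - z) < d -> e < Im w.
  move=> ez; exists (Im z - e); first by rewrite subr_gt0.
  move=> v /(le_lt_trans (Im_le_cmod _)); rewrite ltr_norml ImD ImN => /andP[? _]; lra.
have d0 z : e < Im z -> cdiff f z (g 1%N z).
  move=> ez; have [l hl] := hf (lt_trans e0 ez).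
  have h2 := cdiffD hl (cdiffMl (-1) (dC 0%N z ez)).
  have [d d0 dP] := near_e z ez.
  suff E0 : l + -1 * g 1%N z = 0.
    by move: hl; rewrite (_ : l = g 1%N z)//; apply/eqP; rewrite -subr_eq0 -mulN1r E0.
  apply: (cdiff_Re0 d0 h2) => v /dP ev.
  rewrite mulN1r ReD ReN fact0 mul1r -/(poisson _ _) Re_poisson_line//.
    by rewrite subrK subrr.
  by rewrite ImD ImN /= subr_gt0.
have := @cderiv_chain R [set w | e < Im w] g near_e.
case: s s0 => // s _ /(_ _ s.+1 w ew); rewrite /= => ->; first by rewrite mulrA.
by case=> [|n] z ez; [exact: d0|exact: dC].
Qed.

End Representation.

(** * The best bound for a Cauchy integral *)

Section KernelIntegral.
Variable R : realType.
Implicit Types (z w c : R[i]) (t a : R) (s : nat).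

Lemma Re_realM t z : Re (t%:C * z) = t * Re z.
Proof. by rewrite ReM /= mul0r subr0. Qed.

Lemma unimodular_angle c : cmod c = 1 -> exists a, c = expi a%:C.
Proof.
move=> c1.
have E : Re c ^+ 2 + Im c ^+ 2 = 1 by rewrite -sqr_cmod c1 expr1n.
have rc : -1 <= Re c <= 1 by have := Re_le_cmod c; rewrite c1 ler_norml.
have s2 : Num.sqrt (1 - Re c ^+ 2) = `|Im c|.
  by rewrite (_ : 1 - Re c ^+ 2 = Im c ^+ 2) ?sqrtr_sqr// -E; ring.
have [i0|i0] := leP 0 (Im c).
- exists (acos (Re c)); rewrite expi_real acosK ?in_itv//= sin_acos// s2 ger0_norm//.
  by case: c {c1 E rc s2 i0}.
- exists (- acos (Re c)); rewrite expi_real cosN sinN acosK ?in_itv//= sin_acos// s2.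
  by rewrite ltr0_norm// opprK; case: c {c1 E rc s2 i0}.
Qed.

Lemma rotate_to_real z : exists2 c, cmod c = 1 & Re (c * z) = cmod z.
Proof.
have [->|z0] := eqVneq z 0; first by exists 1; rewrite ?cmod1// mulr0 cmod0.
have m0 : 0 < cmod z by rewrite cmod_gt0.
exists ((cmod z)%:C * z^-1).
  by rewrite cmodM cmod_real cmodV gtr0_norm// mulfV// gt_eqF.
by rewrite mulfVK.
Qed.

Lemma K_integrand_continuous s a :
  continuous (fun t : R => `|cos (a + s.+1%:R * t)| * cos t ^+ s.-1).
Proof.
move=> t; apply: cvgM.
  apply: (@continuous_comp _ _ _ (fun t => cos (a + s.+1%:R * t)) (fun u => `|u|)).
    apply: (@continuous_comp _ _ _ (fun t => a + s.+1%:R * t) cos).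
      by apply: cvgD; [exact: cvg_cst|apply: cvgM; [exact: cvg_cst|exact: cvg_id]].
    exact: continuous_cos.
  exact: norm_continuous.
apply: (@continuous_comp _ _ _ cos (fun u => u ^+ s.-1)); first exact: continuous_cos.
exact: exprn_continuous.
Qed.

Lemma K_integral_open s a : K_integral s a =
  \int[mu]_(t in `]- (pi / 2), pi / 2[) (`|cos (a + s.+1%:R * t)| * cos t ^+ s.-1).
Proof.
by rewrite /K_integral Rintegral_segment_open// => t _; exact: K_integrand_continuous.
Qed.

(** The vector from [z] to the boundary point has length [Im z / cos t] and makes
    the angle [t] with the downward normal. *)
Lemma resolvent_angle z t : 0 < Im z -> t \in `]- (pi / 2), pi / 2[ ->
  - 'i * resolvent z (Re z + Im z * tan t) =
  expi (- t%:C) * (cos t / Im z)%:C.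
Proof.
move=> z0 /cos_angle_neq0 c0; have y0 : Im z != 0 by rewrite gt_eqF.
apply: (mulIf (resolvent_neq0 (Re z + Im z * tan t) z0)).
rewrite -mulrA /resolvent mulVf ?resolvent_neq0// mulr1 -rmorphN expi_real cosN sinN.
have s2 : sin t * sin t = 1 - cos t * cos t.
  by have := cos2Dsin2 t; rewrite !expr2 => <-; ring.
apply: complex_eqP; rewrite !(ReM, ImM, ReD, ImD, ReN, ImN) /= /tan.
  by field; rewrite c0 y0.
transitivity (- (sin t * sin t + cos t * cos t)).
  by rewrite s2; ring.
by field; rewrite c0 y0.
Qed.

(** The angular coordinate turns the kernel into a power of [cos] times a
    unimodular factor whose argument is affine in the angle.  The powers of the
    height come from the kernel and from the Jacobian. *)
Lemma kernel_integral s z a : (0 < s)%N -> 0 < Im z ->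
  \int[mu]_t `|Re (expi (- a%:C) * (- 'i) ^+ s.+1 * kern s z t)| =
  K_integral s a / Im z ^+ s.
Proof.
case: s => // s _ z0.
have y0 : Im z != 0 by rewrite gt_eqF.
rewrite (@Rintegral_tan _ _ z)//; last first.
  move=> t; apply: (@continuous_comp _ _ _
    (fun t => Re (expi (- a%:C) * (- 'i) ^+ s.+2 * kern s.+1 z t)) (fun u => `|u|)); last first.
    exact: norm_continuous.
  have [ck _] := @cctsM R (fun=> expi (- a%:C) * (- 'i) ^+ s.+2) (kern s.+1 z)
    (conj (fun t => cvg_cst _) (fun t => cvg_cst _)) (ccts_kern s.+1 z0).
  exact: ck.
rewrite K_integral_open.
have cK := @K_integrand_continuous s.+1 a.
rewrite -RintegralZr//; last first.
  apply: (@integrableS _ _ _ mu `[- (pi / 2), pi / 2]) => //.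
    by move=> u /=; rewrite !in_itv /= => /andP[/ltW -> /ltW].
  by apply: segment_integrable => t _; exact: cK.
apply: eq_Rintegral => t; rewrite inE /= => tI.
have c0 := cos_angle_neq0 tI.
have cp : 0 < cos t by apply: cos_gt0_pihalf; move: tI; rewrite in_itv.
have -> : expi (- a%:C) * (- 'i) ^+ s.+2 * kern s.+1 z (Re z + Im z * tan t) =
    expi (- (a + s.+2%:R * t))%:C * ((cos t / Im z) ^+ s.+2)%:C.
  rewrite /kern -mulrA -exprMn resolvent_angle// exprMn expiXn mulrA -expiD -rmorphXn.
  by congr (expi _ * _); rewrite rmorphN rmorphD rmorphM rmorph_nat; ring.
have : 0 <= (cos t / Im z) ^+ s.+2 by rewrite exprn_ge0// divr_ge0// ltW.
have : (cos t / Im z) ^+ s.+2 * (Im z * cos t ^- 2) = cos t ^+ s / Im z ^+ s.+1.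
  by rewrite exprMn exprVn !exprS; field; rewrite y0 c0 expf_neq0.
move: (_ ^+ s.+2) => P PE P0.
rewrite expi_real ReM /= mulr0 subr0 cosN normrM (ger0_norm P0).
by rewrite -!mulrA PE.
Qed.

Lemma K_integral_le s a : K_integral s a <= pi.
Proof.
have := @Rintegral_segment_dev R (fun t => `|cos (a + s.+1%:R * t)| * cos t ^+ s.-1)
  (- (pi / 2)) (pi / 2) 0 1 _ (fun t _ => @K_integrand_continuous s a t).
rewrite mul0r subr0 mul1r (_ : pi / 2 - - (pi / 2) = pi); last by field.
move=> h; apply: (le_trans (ler_norm _)); apply: h; first by have := pi_gt0 R; lra.
move=> t _; rewrite subr0 normrM normr_id normrX -[leRHS]mulr1.
apply: ler_pM => //; rewrite ?cos_max//.
by apply: exprn_ile1 => //; exact: cos_max.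
Qed.

Lemma K_integral_sup s a : K_integral s a <= sup (range (@K_integral R s)).
Proof.
apply: ub_le_sup; last by exists a.
by exists pi => _ [b _ <-]; exact: K_integral_le.
Qed.

(** After a rotation that makes the value real only the real part of the rotated
    kernel contributes, and the best bound is its norm in [L1]. *)
Lemma cmod_cauchy_int_le (sg : R -> R) (M : R) s z : (0 < s)%N -> 0 < Im z ->
  measurable_fun setT sg -> (forall t, `|sg t| <= M) ->
  cmod (cauchy_int sg s z) <= M * sup (range (@K_integral R s)) / Im z ^+ s.
Proof.
move=> s0 z0 ms sM.
have M0 : 0 <= M := le_trans (normr_ge0 _) (sM 0).
have [c c1 <-] := rotate_to_real (cauchy_int sg s z).
have [a ca] : exists a, c = expi (- a%:C) * (- 'i) ^+ s.+1.
  have [|b bE] := @unimodular_angle (c * 'i ^+ s.+1).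
    by rewrite cmodM cmodX cmod_i expr1n mulr1.
  exists (- b); rewrite rmorphN opprK -bE -mulrA -exprMn.
  by rewrite mulrN -expr2 sqr_i opprK expr1n mulr1.
have tk := tame_kern ms sM s z0.
rewrite -cintMl// /cint /=.
have tc := tameMl c tk.
apply: le_trans (ler_norm _) _.
apply: le_trans (le_normr_Rintegral measurableT (tame_Re tc)) _.
have [ck _] : ccts (fun t => c * kern s z t).
  by apply: cctsM (ccts_kern s z0); split=> t; exact: cvg_cst.
have [C hC] := kern_bound s z0.
have ik : mu.-integrable setT (EFin \o (fun t => `|Re (c * kern s z t)|)).
  apply: (@integrable_le_oneDsqrV _ _ C).
    apply: continuous_measurable_fun => t.
    apply: (@continuous_comp _ _ _ (fun t => Re (c * kern s z t)) (fun u => `|u|)); first exact: ck.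
    exact: norm_continuous.
  move=> t; rewrite normr_id (le_trans (Re_le_cmod _))// cmodM c1 mul1r.
  exact: hC.
apply: (@le_trans _ _ (\int[mu]_t (M * `|Re (c * kern s z t)|))).
  apply: le_Rintegral => //.
  - exact: (integrable_norm (tame_Re tc)).
  - exact: (integrableZl measurableT M ik).
  - move=> t _; rewrite [c * _]mulrCA Re_realM normrM.
    by rewrite ler_wpM2r.
rewrite RintegralZl// ca kernel_integral// mulrA.
apply: ler_wpM2r; first by rewrite invr_ge0 exprn_ge0// ltW.
by rewrite ler_wpM2l// K_integral_sup.
Qed.

End KernelIntegral.

(** * The estimate by the supremum over the half-plane *)

Section SupEstimate.
Variable R : realType.
Implicit Types (z w : R[i]) (t : R).

Lemma cmod_divpi (u : R[i]) : cmod ((pi%:C * 'i)^-1 * u) = pi^-1 * cmod u.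
Proof.
by rewrite cmodM cmodV cmodM cmod_real cmod_i mulr1 gtr0_norm// pi_gt0.
Qed.

(** The representation holds from every line below [z]; the line is then lowered
    to the boundary. *)
Lemma half_plane_sup_estimate (f : R[i] -> R[i]) (M : R) s z : (0 < s)%N ->
  (forall z, 0 < Im z -> exists l, cdiff f z l) ->
  (forall z, 0 < Im z -> `|Re (f z)| <= M) -> 0 < Im z ->
  cmod (cderiv s f z) <= K R s * M / Im z ^+ s.
Proof.
move=> s0 hf fM z0.
have M0 : 0 <= M := le_trans (normr_ge0 _) (fM z z0).
rewrite ler_pdivlMr ?exprn_gt0//.
have key e : 0 < e < Im z -> cmod (cderiv s f z) * (Im z - e) ^+ s <= K R s * M.
  move=> ez; have /andP[e0 ei] := ez.
  rewrite (cderiv_cauchy hf fM ez s0) -mulrA cmod_divpi cmodM.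
  rewrite -(rmorph_nat (real_complex R)) cmod_real ger0_norm//.
  have z1 : 0 < Im (z - (0 +i* e)) by rewrite ImD ImN /= subr_gt0.
  have := cmod_cauchy_int_le s0 z1 (measurable_Re_line hf e0)
    (fun t => Re_line_bound fM t e0).
  rewrite ImD ImN /= => h.
  rewrite -ler_pdivlMr ?exprn_gt0 ?subr_gt0//.
  have k0 : 0 <= pi^-1 * s`!%:R :> R by rewrite mulr_ge0// invr_ge0 pi_ge0.
  rewrite mulrA (le_trans (ler_wpM2l k0 h))//.
  by rewrite /K le_eqVlt; apply/orP; left; apply/eqP; ring.
have c0 : Im z - Im z * n.+2%:R^-1 @[n --> \oo] --> Im z - Im z * 0.
  apply: cvgB; first exact: cvg_cst.
  apply: cvgM; first exact: cvg_cst.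
  by have := @cvg_harmonic R; rewrite -cvg_shiftS.
have c1 := cvg_comp _ _ c0 (@exprn_continuous R s (Im z - Im z * 0)).
have c : cmod (cderiv s f z) * (Im z - Im z * n.+2%:R^-1) ^+ s @[n --> \oo] -->
    cmod (cderiv s f z) * (Im z - Im z * 0) ^+ s.
  by apply: cvgM; [exact: cvg_cst|exact: c1].
rewrite mulr0 subr0 in c.
apply: (cvgr_to_le c); apply: nearW => n; apply: key.
have n0 : (0 : R) < n.+2%:R^-1 by rewrite invr_gt0 ltr0n.
have n1 : n.+2%:R^-1 < 1 :> R by rewrite invf_lt1 ?ltr0n// ltr1n.
by rewrite mulr_gt0//= gtr_pMr.
Qed.

End SupEstimate.

(** * The norm of the boundary values *)

Section BoundaryNorm.
Variable R : realType.
Implicit Types (f : R[i] -> R[i]) (M : R).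

(** Valid also where the limit does not exist: its default value is 0. *)
Lemma lim_norm_le (h : R -> R) (F : set_system R) (FF : ProperFilter F) M : 0 <= M ->
  (\forall x \near F, `|h x| <= M) -> `|lim (h @ F)| <= M.
Proof.
move=> M0 hM; have [ch|nch] := pselect (cvg (h @ F)).
  by apply: (cvgr_to_le (cvg_norm ch)).
rewrite /lim /lim_in; case: xgetP => [l lE hl|_]; last by rewrite [point]/= normr0.
by exfalso; apply: nch; apply/cvg_ex; exists l.
Qed.

Lemma Re_bdry_le f M x : (forall z, 0 < Im z -> `|Re (f z)| <= M) ->
  `|Re_bdry f x| <= M.
Proof.
move=> fM; have M0 : 0 <= M by apply: (le_trans (normr_ge0 _) (fM (0 +i* 1) _)) => /=.
apply: lim_norm_le => //; near=> y; apply: fM => /=.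
by near: y; exact: nbhs_right_gt.
Unshelve. all: by end_near. Qed.

Lemma lebesgue_setT_gt0 : (0 < mu [set: R])%E.
Proof.
have : (mu `[0%R, 1%R] <= mu [set: R])%E by apply: le_measure; rewrite ?inE.
by apply: lt_le_trans; rewrite lebesgue_measure_itv/= lte_fin ltr01 oppr0 adde0 lte_fin.
Qed.

Lemma Re_bdry_normE f : Re_bdry_norm f =
  ess_sup mu (fun x => `|Re_bdry f x|%:E).
Proof. by rewrite /Re_bdry_norm unlock lebesgue_setT_gt0. Qed.

Lemma Re_bdry_norm_le f M : (forall z, 0 < Im z -> `|Re (f z)| <= M) ->
  (Re_bdry_norm f <= M%:E)%E.
Proof.
move=> fM; rewrite Re_bdry_normE; apply/ess_supP; apply: aeW => x.
by rewrite lee_fin; exact: Re_bdry_le.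
Qed.

Lemma open_half_plane : open (@half_plane R).
Proof.
apply/open_cmodP => z z0; exists (Im z) => // w wz.
have := le_lt_trans (Im_le_cmod _) wz; rewrite ltr_norml ImD ImN => /andP[? _].
rewrite /half_plane /=; lra.
Qed.

End BoundaryNorm.

(** * Sharpness of the constant *)

Section Sharpness.
Variable R : realType.
Implicit Types (z w c : R[i]) (t a C : R).

Section Extension.
Variables (sg : R -> R) (B : R).
Hypothesis msg : measurable_fun setT sg.
Hypothesis sgB : forall t, `|sg t| <= B.

Lemma cdiff_poisson z : 0 < Im z -> cdiff (poisson sg) z
  ((pi%:C * 'i)^-1 * (1%:R * cauchy_int sg 1 z)).
Proof. by move=> z0; apply: cdiffMl; exact: cdiff_cauchy_int msg sgB _ _ z0. Qed.

Lemma cderiv_poisson s z : 0 < Im z ->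
  cderiv s (poisson sg) z = (pi%:C * 'i)^-1 * (s`!%:R * cauchy_int sg s z).
Proof.
move=> z0.
have -> : poisson sg = (fun z => (pi%:C * 'i)^-1 * ((0`!)%:R * cauchy_int sg 0 z)).
  by apply/funext => w; rewrite fact0 mul1r.
apply: (@cderiv_chain R (@half_plane R)
  (fun n z => (pi%:C * 'i)^-1 * (n`!%:R * cauchy_int sg n z))) => //.
  exact/open_cmodP/open_half_plane.
move=> m w w0; apply: cdiffMl; rewrite factS natrM [_%:R * _%:R]mulrC -mulrA.
by apply: cdiffMl; exact: cdiff_cauchy_int msg sgB _ _ w0.
Qed.

Lemma Re_poisson_bound z : (forall t, `|sg t| <= 1) -> 0 < Im z ->
  `|Re (poisson sg z)| <= 1.
Proof.
move=> sg1 z0; rewrite (Re_poisson msg sgB z0) normrM.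
have pi0 := pi_gt0 R.
rewrite gtr0_norm ?invr_gt0// mulrC ler_pdivrMr// mul1r.
have c1 : continuous (cst 1 : R -> R) by move=> t; exact: cvg_cst.
have E := Rintegral_poisson z0 c1 (fun t => eq_ind_r (fun b => b <= 1) (lexx (1 : R)) (normr1 R)).
rewrite Rintegral_cst//= lebesgue_measure_itv/= lte_fin in E.
have pp : - (pi / 2) < pi / 2 :> R by lra.
rewrite pp /= mul1r (_ : pi / 2 - - (pi / 2) = pi) in E; last by field.
rewrite -E.
have [_ ck] := ccts_kern 0 z0; have [C hC] := kern_bound 0 z0.
have ik (k : R -> R) : measurable_fun setT k -> (forall t, `|k t| <= 1) ->
    mu.-integrable setT (EFin \o (fun t => k t * Im (kern 0 z t))).
  move=> mk k1; apply: (@integrable_le_oneDsqrV _ _ C).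
    by apply: measurable_funM => //; exact: continuous_measurable_fun.
  move=> t; rewrite normrM; apply: le_trans (hC t).
  apply: le_trans (Im_le_cmod _); rewrite -[leRHS]mul1r.
  by apply: ler_wpM2r.
apply: le_trans (le_normr_Rintegral measurableT (ik sg msg sg1)) _.
apply: le_Rintegral => //.
- exact: (integrable_norm (ik sg msg sg1)).
- by apply: ik => // t; rewrite normr1.
- move=> t _; rewrite normrM Im_kern0 (ger0_norm (Im_resolvent_ge0 t z0)).
  by rewrite ler_wpM2r// Im_resolvent_ge0.
Qed.

End Extension.

(** Tested on a constant function, whose boundary norm is not 0. *)
Lemma half_plane_estimate_ge0 s C : half_plane_estimate s C -> 0 <= C.
Proof.
move=> /(_ (cst 1)) h.
have : ((cmod (cderiv s (cst 1) 'i))%:E <=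
    (C / complex.Im ('i : R[i]) ^+ s)%:E * Re_bdry_norm (cst (1 : R[i])%R))%E.
  apply: h; last by rewrite /half_plane /=.
    split; first exact: open_half_plane.
    by move=> z _; have [] := cdiff_is_derive (@cdiff_cst R 1 z).
  by exists 1 => z _ /=; rewrite normr1.
rewrite Re_bdry_normE (_ : (fun x => _) = cst 1%:E).
  rewrite ess_sup_cst ?lebesgue_setT_gt0// mule1 lee_fin /= expr1n divr1.
  by apply: le_trans; exact: cmod_ge0.
apply/funext => x; by rewrite /Re_bdry /= lim_cst ?normr1.
Qed.

(** The extremal boundary function is the sign of the real part of the rotated
    kernel; its Poisson extension is bounded by one. *)
Lemma half_plane_estimate_sharp s C : (0 < s)%N ->
  half_plane_estimate s C -> K R s <= C.
Proof.
move=> s0 hC; have C0 := half_plane_estimate_ge0 hC.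
have f0 : 0 < s`!%:R / pi :> R by rewrite divr_gt0 ?pi_gt0// ltr0n fact_gt0.
rewrite /K mulrC -ler_pdivlMr//; apply: sup_le_ub; first by exists (K_integral s 0); exists 0.
move=> _ [a _ <-].
have i0 : 0 < Im ('i : R[i]) by rewrite /= ltr01.
pose c := expi (- a%:C) * (- 'i) ^+ s.+1.
pose g t := Re (c * kern s 'i t).
have [cg _] : ccts (fun t => c * kern s 'i t).
  by apply: cctsM (ccts_kern s i0); split=> t; exact: cvg_cst.
have mg : measurable_fun setT g by exact: continuous_measurable_fun.
pose sg t : R := if 0 <= g t then 1 else -1.
have sg1 t : `|sg t| <= 1 by rewrite /sg; case: ifP; rewrite ?normrN normr1.
have msg : measurable_fun setT sg.
  apply: measurable_fun_ifT => //.
  apply: (measurable_fun_bool true); rewrite setTI.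
  rewrite (_ : _ @^-1` _ = g @^-1` `[0, +oo[%classic); last first.
    by apply/seteqP; split=> t /=; rewrite in_itv /= andbT.
  by rewrite -[_ @^-1` _]setTI; apply: mg => //; exact: measurable_itv.
have c1 : cmod c = 1.
  rewrite /c cmodM cmod_expi ImN /= !oppr0 expR0 cmodX cmodN cmod_i expr1n mulr1//.
have : ((cmod (cderiv s (poisson sg) 'i))%:E <=
    (C / complex.Im ('i : R[i]) ^+ s)%:E * Re_bdry_norm (poisson sg))%E.
  apply: hC => //.
    split; first exact: open_half_plane.
    by move=> z z0; have [] := cdiff_is_derive (cdiff_poisson msg sg1 z0).
  by exists 1 => z z0; exact: (Re_poisson_bound msg sg1 sg1 z0).
rewrite [complex.Im _]/= expr1n divr1.
have nb : (Re_bdry_norm (poisson sg) <= 1%:E)%E.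
  by apply: Re_bdry_norm_le => z z0; exact: Re_poisson_bound.
move=> /le_trans /(_ (lee_wpmul2l _ nb)); rewrite lee_fin => /(_ C0).
rewrite mule1 lee_fin (cderiv_poisson msg sg1 s i0) cmod_divpi cmodM.
rewrite -(rmorph_nat (real_complex R)) cmod_real ger0_norm// => h.
rewrite ler_pdivlMr// mulrC; apply: le_trans h.
rewrite mulrA [pi^-1 * _]mulrC; apply: ler_wpM2l; first exact: ltW.
have <- : Re (c * cauchy_int sg s 'i) = K_integral s a.
  have := @kernel_integral R s 'i a s0 i0; rewrite [Im 'i]/= expr1n divr1 => <-.
  rewrite /cauchy_int -cintMl ?tame_kern//; last exact: tame_kern msg sg1 _ _ i0.
  rewrite /cint [LHS]/=; apply: eq_Rintegral => t _.
  rewrite mulrCA Re_realM -/(g t) /sg.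
  case: (leP 0 (g t)) => g0; first by rewrite mul1r ger0_norm.
  by rewrite mulN1r ltr0_norm.
apply: le_trans (ler_norm _) _; apply: le_trans (Re_le_cmod _) _.
by rewrite cmodM c1 mul1r.
Qed.

End Sharpness.

(** * Nearest points of convex sets *)

Section NearestPoint.
Variable R : realType.
Implicit Types (A : set R[i]) (z w g : R[i]) (t d e : R).

Lemma closure_cmodP A z : closure A z <->
  forall d, 0 < d -> exists2 w, A w & cmod (w - z) < d.
Proof.
split=> [cA d d0|h B /nbhs_cmodP[d d0 dB]].
  have [|w [Aw wz]] := cA [set w | cmod (w - z) < d].
    by apply/nbhs_cmodP; exists d.
  by exists w.
by have [w Aw wz] := h d d0; exists w; split => //; exact: dB.
Qed.

Definition dot z w := Re z * Re w + Im z * Im w.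

Lemma sqr_cmodD z w : cmod (z + w) ^+ 2 = cmod z ^+ 2 + 2 * dot z w + cmod w ^+ 2.
Proof. by rewrite !sqr_cmod ReD ImD /dot; ring. Qed.

Definition convex_cplx A := forall z w t, A z -> A w -> 0 <= t <= 1 ->
  A (z + t%:C * (w - z)).

Lemma convex_setP A : @convex_set R (Rcomplex R) A -> convex_cplx A.
Proof.
move=> cA z w t Az Aw /andP[t0 t1].
have := cA w z (Itv01 t0 t1); rewrite !inE => /(_ Aw Az).
rewrite [conv _ _ _](_ : _ = z + t%:C * (w - z))//.
rewrite /conv /=.
apply: complex_eqP; rewrite !(ReD, ImD, ReM, ImM, ReN, ImN) /=.
  by case: z w {Az Aw} => x y [u v] /=; rewrite /unstable.onem; ring.
by case: z w {Az Aw} => x y [u v] /=; rewrite /unstable.onem; ring.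
Qed.

(** A minimizing sequence is Cauchy by the parallelogram identity.  The second
    clause, that the set lies on the far side of the line through [w] orthogonal
    to [z - w], expresses that moving from [w] towards a point of the set does not
    decrease the distance to first order. *)
Lemma nearest_point A z : A !=set0 -> convex_cplx A -> exists w,
  closure A w /\ forall g, closure A g -> dot (g - w) (z - w) <= 0.
Proof.
move=> [g0 Ag0] cA.
pose S := [set cmod (z - g) ^+ 2 | g in A].
have Slb : lbound S 0 by move=> _ [g _ <-]; exact: sqr_ge0.
have hS : has_inf S by split; [exists (cmod (z - g0) ^+ 2), g0|exists 0].
pose D := inf S.
have DS g : A g -> D <= cmod (z - g) ^+ 2.
  by move=> Ag; apply: ge_inf; [exists 0|exists g].
have /choice[g gP] n : exists g, A g /\ cmod (z - g) ^+ 2 < D + n.+1%:R^-1.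
  have e0 : 0 < (n.+1%:R : R)^-1 by rewrite invr_gt0.
  have [_ [h Ah <-] hn] := inf_adherent e0 hS.
  by exists h.
have par n m : cmod (g n - g m) ^+ 2 <= 2 * (n.+1%:R^-1 + m.+1%:R^-1).
  have h2 : 0 <= (2^-1 : R) <= 1 by rewrite invr_ge0 ler0n invf_le1// ler1n.
  have := DS _ (cA _ _ _ (gP n).1 (gP m).1 h2).
  have := (gP n).2; have := (gP m).2; rewrite !sqr_cmod.
  rewrite !(ReD, ImD, ReM, ImM, ReN, ImN) /= => a1 a2 a3.
  move: (n.+1%:R^-1) (m.+1%:R^-1) a1 a2 a3 => p q a1 a2 a3.
  move: a1 a2 a3; move: (Re (g n)) (Im (g n)) (Re (g m)) (Im (g m)) (Re z) (Im z).
  by move=> a b c e x y a1 a2 a3; lra.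
(* Applied to the real and to the imaginary part. *)
have cau (h : R[i] -> R) : (forall v, `|h v| <= cmod v) ->
    (forall v u, h (v - u) = h v - h u) -> cvg (h (g n) @[n --> \oo]).
  move=> hc hB; apply/cauchy_cvgP; apply: cauchy_exP => e e0.
  pose N := (Num.truncn (4 / e ^+ 2)).+1.
  exists (h (g N)).
  suff : \forall n \near \oo, `|h (g N) - h (g n)| < e by [].
  near=> n.
  rewrite -hB.
  apply: le_lt_trans (hc _) _.
  rewrite -(@ltr_pXn2r _ 2)// ?nnegrE ?cmod_ge0 ?ltW//.
  apply: le_lt_trans (par _ _) _.
  have nN : (n.+1%:R : R)^-1 <= N.+1%:R^-1.
    by rewrite lef_pV2 ?posrE// ler_nat ltnS; near: n; exact: nbhs_infty_ge.
  have : 4 / e ^+ 2 < N.+1%:R :> R.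
    by apply: (lt_trans (truncnS_gt _)); rewrite ltr_nat.
  rewrite ltr_pdivrMr ?exprn_gt0// mulrC -ltr_pdivrMr// => h4.
  move: nN h4; move: (N.+1%:R^-1) (n.+1%:R^-1) (e ^+ 2) => p q r nN h4.
  by lra.
have cr := cau (@complex.Re R) (@Re_le_cmod R) (fun v u => etrans (ReD _ _) (congr1 _ (ReN _))).
have ci := cau (@complex.Im R) (@Im_le_cmod R) (fun v u => etrans (ImD _ _) (congr1 _ (ImN _))).
pose w : R[i] := lim (Re (g n) @[n --> \oo]) +i* lim (Im (g n) @[n --> \oo]).
have sqc (a : R) (u v : R[i]) :
    cmod (u - (g n + a%:C * (v - g n))) ^+ 2 @[n --> \oo] -->
    cmod (u - (w + a%:C * (v - w))) ^+ 2.
  rewrite sqr_cmod; under eq_fun do rewrite sqr_cmod.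
  have cX (h : nat -> R) (l : R) : h n @[n --> \oo] --> l -> h n ^+ 2 @[n --> \oo] --> l ^+ 2.
    by move=> hl; exact: (cvg_comp _ _ hl (@exprn_continuous R 2 l)).
  apply: cvgD; apply: cX.
  - rewrite !(ReD, ReN, ReM); under eq_fun do rewrite !(ReD, ReN, ReM, ImD, ImN) [Re _%:C]/= [Im _%:C]/=.
    apply: cvgB; first exact: cvg_cst.
    apply: cvgD; first exact: cr.
    apply: cvgB; apply: cvgM; try exact: cvg_cst.
    + by apply: cvgB; [exact: cvg_cst|exact: cr].
    + by rewrite ImD ImN; apply: cvgB; [exact: cvg_cst|exact: ci].
  - rewrite !(ImD, ImN, ImM); under eq_fun do rewrite !(ReD, ReN, ImM, ImD, ImN) [Re _%:C]/= [Im _%:C]/=.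
    apply: cvgB; first exact: cvg_cst.
    apply: cvgD; first exact: ci.
    apply: cvgD; apply: cvgM; try exact: cvg_cst.
    + by apply: cvgB; [exact: cvg_cst|exact: ci].
    + by rewrite ReD ReN; apply: cvgB; [exact: cvg_cst|exact: cr].
have sq0 u : cmod (u - g n) ^+ 2 @[n --> \oo] --> cmod (u - w) ^+ 2.
  have := sqc 0 u 0; rewrite mul0r addr0; apply: cvg_trans; apply: near_eq_cvg.
  by apply: nearW => n; rewrite mul0r addr0.
have wD : cmod (z - w) ^+ 2 = D.
  apply/eqP; rewrite eq_le; apply/andP; split.
    have hc : D + n.+1%:R^-1 @[n --> \oo] --> D + 0.
      by apply: cvgD; [exact: cvg_cst|exact: cvg_harmonic].
    rewrite addr0 in hc; apply: (ler_cvg_to (sq0 z) hc).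
    by apply: nearW => n; exact: ltW (gP n).2.
  apply: (cvgr_to_ge (sq0 z)); apply: nearW => n; exact: DS (gP n).1.
have wcl : closure A w.
  apply/closure_cmodP => d d0.
  have := sq0 w; rewrite subrr cmod0 expr0n /= => /cvgrPdist_lt /(_ (d ^+ 2)).
  rewrite exprn_gt0// => /(_ isT) [N _ /(_ N (leqnn N))].
  rewrite sub0r normrN ger0_norm ?sqr_ge0// => h; exists (g N); first exact: (gP N).1.
  by rewrite cmodB -(@ltr_pXn2r _ 2)// ?nnegrE ?cmod_ge0 ?ltW.
have key v : A v -> dot (v - w) (z - w) <= 0.
  move=> Av; rewrite leNgt; apply/negP => p0.
  set p := dot _ _ in p0; pose q := cmod (v - w) ^+ 2.
  have q0 : 0 <= q by exact: sqr_ge0.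
  have tP t : 0 <= t <= 1 -> 2 * t * p <= t ^+ 2 * q.
    move=> t01; have : D <= cmod (z - (w + t%:C * (v - w))) ^+ 2.
      apply: (cvgr_to_ge (sqc t z v)); apply: nearW => n; apply: DS.
      exact: cA (gP n).1 Av t01.
    rewrite -wD (_ : z - (w + _) = (z - w) + (- t)%:C * (v - w)); last first.
      by rewrite rmorphN; ring.
    rewrite [X in _ <= X]sqr_cmodD cmodM exprMn cmod_real real_normK ?num_real// sqrrN -/q.
    have -> : dot (z - w) ((- t)%:C * (v - w)) = - t * p.
      by rewrite /p /dot ReM ImM /=; ring.
    by move=> h; lra.
  have s0 : 0 < q + p by lra.
  pose t := p / (q + p).
  have tE : t * (q + p) = p by rewrite divfK// gt_eqF.
  have t0 : 0 < t by rewrite divr_gt0.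
  have t1 : t <= 1 by rewrite ler_pdivrMr// mul1r lerDr.
  have := tP t; rewrite (ltW t0) t1 => /(_ isT).
  rewrite (_ : 2 * t * p = t * (2 * p)); last by ring.
  rewrite (_ : t ^+ 2 * q = t * (t * q)); last by ring.
  rewrite ler_pM2l// => h.
  have : 0 <= t * p by rewrite mulr_ge0// ltW.
  by move: tE h; rewrite mulrDr => tE h hh; lra.
exists w; split => // g1 /closure_cmodP cg; rewrite leNgt; apply/negP => p0.
have m0 : 0 < cmod (z - w).
  rewrite cmod_gt0; apply: contraTneq p0 => ->.
  by rewrite /dot /= !mulr0 addr0 ltxx.
have [v Av vg] := cg (dot (g1 - w) (z - w) / (2 * cmod (z - w))) ltac:(by rewrite divr_gt0// mulr_gt0).
have := key v Av.
have -> : dot (v - w) (z - w) = dot (g1 - w) (z - w) + dot (v - g1) (z - w).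
  by rewrite /dot !(ReD, ReN, ImD, ImN); ring.
have : `|dot (v - g1) (z - w)| <= 2 * cmod (z - w) * cmod (v - g1).
  rewrite /dot mulrAC mulr_natl mulr2n mulrDl; apply: le_trans (ler_normD _ _) _.
  by rewrite !normrM; apply: lerD; apply: ler_pM;
    rewrite ?Re_le_cmod ?Im_le_cmod.
move: vg; rewrite ltr_pdivlMr ?mulr_gt0// [cmod _ * _]mulrC => vg.
by rewrite ler_norml => /andP[h1 _] h2; lra.
Unshelve. all: by end_near. Qed.

End NearestPoint.

(** * Exteriors of convex sets *)

Section ConvexExterior.
Variable R : realType.
Implicit Types (z w : R[i]) (f : R[i] -> R[i]) (M : R).

Lemma le_of_sqr (a b : R) : 0 <= a -> 0 <= b -> a ^+ 2 <= b ^+ 2 -> a <= b.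
Proof. by move=> a0 b0; rewrite ler_pXn2r. Qed.

Lemma cmod_normalize z (d : R) : 0 < d -> cmod z = d -> cmod (z / d%:C) = 1.
Proof.
move=> d0 zd; rewrite cmodM zd cmodV cmod_real (gtr0_norm d0).
by apply: divff; rewrite gt_eqF.
Qed.

(** Holomorphic functions are infinitely differentiable; here read off the
    representation of the derivatives as Cauchy integrals. *)
Lemma cdiff_cderiv f M s z : (forall z, 0 < Im z -> exists l, cdiff f z l) ->
  (forall z, 0 < Im z -> `|Re (f z)| <= M) -> 0 < Im z ->
  cdiff (cderiv s f) z (cderiv s.+1 f z).
Proof.
move=> hf fM z0.
have [l hl] : exists l, cdiff (cderiv s f) z l; last first.
  rewrite {2}/cderiv derive1nS -/(cderiv s f) (cdiff_derive1 hl); exact: hl.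
case: s => [|s]; first exact: hf.
pose e := Im z / 2.
have e0 : 0 < e by rewrite divr_gt0.
have ez : e < Im z by rewrite /e; lra.
have ms := measurable_Re_line hf e0; have sB t := Re_line_bound fM t e0.
pose E : R[i] := 0 +i* e.
have h1 : cdiff (fun w => 1 * w + - E) z 1 by exact: cdiff_affine.
have zE : 0 < Im (1 * z - E) by rewrite mul1r ImD ImN /= subr_gt0.
have h2 := cdiff_comp h1 (cdiff_cauchy_int ms sB s.+1 zE).
have h3 := cdiffMl ((pi%:C * 'i)^-1 * s.+1`!%:R) h2.
eexists; apply: (cdiff_near e0 _ h3) => w wz.
rewrite mul1r (cderiv_cauchy hf fM (w := w) (e := e))// e0 /=.
have := le_lt_trans (Im_le_cmod _) wz; rewrite ltr_norml ImD ImN => /andP[? _].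
have zE2 : Im z = e + e by rewrite /e; field.
lra.
Qed.

(** The complement contains the half-plane beyond the supporting line at the point
    [w] of the closed convex set nearest to [z], and the distances from [z] to that
    line and to the boundary agree.  So the bound in the half-plane transports by
    the rigid motion [v |-> w - i e v], with [e] the unit vector from [w] to [z]. *)
Lemma convex_exterior_estimate (G : set R[i]) f s z : (0 < s)%N ->
  convex_domain G -> holomorphic_on (~` closure G) f ->
  bounded_Re (~` closure G) f -> (~` closure G) z ->
  cmod (cderiv s f z) <= K R s / dist z (boundary (~` closure G)) ^+ s
    * sup_Re (~` closure G) f.
Proof.
move=> s0 [oG G0 /convex_setP cG] [oW hW] [M0 hM0] zW.
have [w [wG wP]] := nearest_point z G0 cG.
set W := ~` closure G in oW hW hM0 zW *.
have [d dE] : exists d : R, cmod (z - w) = d by exists (cmod (z - w)).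
have d0 : 0 < d by rewrite -dE cmod_gt0 subr_eq0; apply: contraPneq zW => -> /(_ wG).
pose e := (z - w) / d%:C.
have dC : d%:C != 0 :> R[i] by rewrite eq_complex /= eqxx andbT gt_eqF.
have e1 : cmod e = 1 := cmod_normalize d0 dE.
have eNz : e != 0 by rewrite -cmod_gt0 e1.
have zwE : z - w = d%:C * e by rewrite mulrC divfK.
clearbody e.
have inW v : 0 < dot (v - w) (z - w) -> W v.
  by move=> p0 /wP; rewrite leNgt p0.
have dotE v : dot (- 'i * e * v) (z - w) = d * Im v.
  have := sqr_cmod e; rewrite e1 expr1n => e2.
  rewrite zwE /dot !(ReM, ImM, ReN, ImN) /=.
  transitivity (d * Im v * (Re e ^+ 2 + Im e ^+ 2)); first by ring.
  by rewrite -e2 mulr1.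
have hpW v : 0 < Im v -> W (w + - 'i * e * v).
  by move=> v0; apply: inW; rewrite addrAC subrr add0r dotE mulr_gt0.
pose M := sup_Re W f.
have fM v : W v -> `|Re (f v)| <= M.
  move=> Wv; apply: ub_le_sup; last by exists v.
  by exists M0 => _ [u Wu <-]; exact: hM0.
have M_ge0 : 0 <= M := le_trans (normr_ge0 _) (fM z zW).
pose F v := f (w + - 'i * e * v).
have hF v : 0 < Im v -> exists l, cdiff F v l.
  move=> /hpW Wv; eexists.
  have h1 : cdiff (fun v => - 'i * e * v + w) v (- 'i * e) by exact: cdiff_affine.
  have h2 := derivable_cdiff (hW _ Wv); rewrite addrC in h2.
  have := cdiff_comp h1 h2; apply: cdiff_near ltr01 _ => u _.
  by rewrite /F addrC.
have FM v : 0 < Im v -> `|Re (F v)| <= M by move=> /hpW /fM.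
pose k := 'i / e.
have kE : k * (- 'i * e) = 1.
  transitivity (- ('i * 'i) * (e^-1 * e)); first by rewrite /k; ring.
  by rewrite (mulVf eNz) mulr1 -expr2 sqr_i opprK.
have k1 : cmod k = 1 by rewrite cmodM cmod_i cmodV e1 invr1 mulr1.
have fE v : f v = F (k * (v - w)).
  rewrite /F; congr f; rewrite mulrA [- 'i * e * k]mulrC kE mul1r.
  by rewrite addrC subrK.
have Imk v : d * Im (k * (v - w)) = dot (v - w) (z - w).
  by rewrite -dotE mulrA [- 'i * e * k]mulrC kE mul1r.
have kz : k * (z - w) = 0 +i* d.
  rewrite zwE /k mulrCA -mulrA (mulVf eNz) mulr1.
  by apply: complex_eqP; rewrite !(ReM, ImM) /=; ring.
clearbody k.
have chain : cderiv s f z = k ^+ s * cderiv s F (0 +i* d).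
  have fF : f = (fun v => k ^+ 0 * cderiv 0 F (k * (v - w))).
    by apply/funext => v; rewrite expr0 mul1r fE.
  rewrite fF -kz.
  apply: (@cderiv_chain R [set v | 0 < Im (k * (v - w))]
    (fun n v => k ^+ n * cderiv n F (k * (v - w)))).
  - move=> v /= v0; exists (Im (k * (v - w))); [exact: v0|move=> u uv].
    have : cmod (k * (u - w) - k * (v - w)) < Im (k * (v - w)).
      by rewrite -mulrBr cmodM k1 mul1r opprB addrA subrK.
    by move=> /(le_lt_trans (Im_le_cmod _)); rewrite ltr_norml ImD ImN => /andP[? _]; lra.
  - move=> n v /= v0; rewrite exprSr -mulrA; apply: cdiffMl.
    have h1 : cdiff (fun u => k * (u - w)) v k.
      by apply: (cdiff_near ltr01 _ (cdiff_affine k (- (k * w)) v)) => u _; rewrite mulrBr.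
    by have := cdiff_comp h1 (cdiff_cderiv n hF FM v0); rewrite [_ * k]mulrC.
  - by rewrite /= kz.
have near_b b : closure G b -> d <= cmod (z - b).
  move=> /wP bP; apply: le_of_sqr; [exact: ltW|exact: cmod_ge0|].
  have -> : z - b = (z - w) + (w - b) by ring.
  have E : dot (z - w) (w - b) = - dot (b - w) (z - w).
    by rewrite /dot !(ReD, ReN, ImD, ImN); ring.
  have := sqr_cmodD (z - w) (w - b); rewrite dE E.
  have := sqr_ge0 (cmod (w - b)); lra.
have wbd : boundary W w.
  split; last by move=> /interior_subset /(_ wG).
  apply/closure_cmodP => r r0; exists (w + - 'i * e * (0 +i* (r / 2))).
    by apply: hpW; rewrite /= divr_gt0.
  rewrite addrAC subrr add0r cmodM cmodM cmodN cmod_i e1 !mul1r cmodE /= expr0n add0r.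
  have r2 : 0 < r / 2 by rewrite divr_gt0.
  by rewrite sqrtr_sqr (gtr0_norm r2); lra.
pose D := [set cmod (z - b) | b in boundary W].
have Dlb : lbound D d.
  move=> _ [b [_ nb] <-]; apply: near_b; apply: contrapT => bW; apply: nb.
  by move: oW; rewrite openE; apply.
have distE : dist z (boundary W) = d.
  apply/eqP; rewrite eq_le; apply/andP; split.
    by rewrite -dE; apply: ge_inf; [exists d; exact: Dlb|exists w].
  apply: lb_le_inf; last exact: Dlb.
  by exists d, w; [exact: wbd|exact: dE].
have := half_plane_sup_estimate s0 hF FM (z := 0 +i* d) d0.
by rewrite chain cmodM cmodX k1 expr1n mul1r distE mulrAC.
Qed.

End ConvexExterior.

(** * Lipschitz functions of a real variable *)

Section LipschitzDifferentiable.
Variable R : realType.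

Section TruncatedCDF.
Variables (Phi : R -> R) (B N : R).
Hypotheses (B0 : 0 < B) (N0 : 0 < N).
Hypothesis lip : forall x y, x <= y -> `|Phi y - Phi x| <= B * (y - x).

Let cl x := Num.max (- N) (Num.min x N).

Let total := Phi N - Phi (- N) + 4 * B * N.

(** A Lipschitz function made increasing by a linear term, cut off outside
    [(- N, N)] and normalized into a probability distribution function. *)
Definition lip_cdf x := (Phi (cl x) - Phi (- N) + 2 * B * (cl x + N)) / total.

Let total_gt0 : 0 < total.
Proof.
have NN : - N <= N by move: N0; lra.
have := lip NN; rewrite ler_norml => /andP[h _].
have BN : 0 < B * N by rewrite mulr_gt0.
have E1 : B * (N - - N) = 2 * (B * N) by ring.
have E2 : 4 * B * N = 4 * (B * N) by ring.
rewrite E1 in h; rewrite /total E2; move: h BN; lra.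
Qed.

Let clE x : - N <= x <= N -> cl x = x.
Proof.
by move=> /andP[x1 x2]; rewrite /cl (min_idPl x2) (max_idPr x1).
Qed.

Let cl_le x y : x <= y -> cl x <= cl y /\ cl y - cl x <= y - x.
Proof.
have n0 := N0; move=> xy; rewrite /cl /Num.max /Num.min.
by case: (ltP x N) => ?; case: (ltP y N) => ?; case: ltP => ?; case: ltP => ?; split; lra.
Qed.

Lemma lip_cdf_diff x y : x <= y ->
  0 <= lip_cdf y - lip_cdf x <= 3 * B / total * (y - x).
Proof.
have n0 := N0; have b0 := B0; move=> xy; have [c1 c2] := cl_le xy.
have := lip c1; rewrite ler_norml => /andP[h1 h2].
have Bc : 0 <= B * (cl y - cl x) by rewrite mulr_ge0 ?subr_ge0// ltW.
have Bx : B * (cl y - cl x) <= B * (y - x) by rewrite ler_pM2l.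
have E : lip_cdf y - lip_cdf x =
  (Phi (cl y) - Phi (cl x) + 2 * (B * (cl y - cl x))) / total.
  by rewrite /lip_cdf; field; rewrite gt_eqF.
rewrite E; apply/andP; split.
  by apply: divr_ge0; [lra|exact: ltW].
rewrite mulrAC ler_pM2r ?invr_gt0//; lra.
Qed.

Lemma lip_cdf_nondecreasing : nondecreasing lip_cdf.
Proof. by move=> x y /lip_cdf_diff; rewrite subr_ge0 => /andP[]. Qed.

Lemma lip_cdf_right_continuous : right_continuous lip_cdf.
Proof.
apply: right_continuousW => x; apply/cvgrPdist_lt => e e0.
pose c := 3 * B / total.
have c0 : 0 < c by rewrite divr_gt0// mulr_gt0.
apply/nbhs_normP; exists (e / c) => [|y]; first by rewrite /= divr_gt0.
move=> xyc; have : `|x - y| < e / c by [].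
rewrite ltr_pdivlMr// mulrC => xy.
have [l|l] := leP x y.
  have /andP[h1 h2] := lip_cdf_diff l.
  rewrite distrC ger0_norm//; apply: le_lt_trans h2 _.
  by move: xy; rewrite distrC ger0_norm// subr_ge0.
have /andP[h1 h2] := lip_cdf_diff (ltW l).
rewrite ger0_norm//; apply: le_lt_trans h2 _.
by move: xy; rewrite ger0_norm// subr_ge0 ltW.
Qed.

HB.instance Definition _ := isCumulative.Build R _ R lip_cdf
  lip_cdf_nondecreasing lip_cdf_right_continuous.

Lemma lip_cdfNy : lip_cdf @ -oo --> (0 : R).
Proof.
have E : \forall x \near -oo, 0 = lip_cdf x.
  near=> x; have xN : x <= - N by near: x; apply: nbhs_ninfty_le; exact: num_real.
  rewrite /lip_cdf (_ : cl x = - N).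
    by rewrite subrr addNr mulr0 addr0 mul0r.
  have n0 := N0; have xN' : x <= N by lra.
  by rewrite /cl (min_idPl xN') (max_idPl xN).
apply: cvg_trans; [exact: near_eq_cvg E|exact: cvg_cst].
Unshelve. all: by end_near. Qed.

Lemma lip_cdfy : lip_cdf @ +oo --> (1 : R).
Proof.
have E : \forall x \near +oo, 1 = lip_cdf x.
  near=> x; have xN : N <= x by near: x; apply: nbhs_pinfty_ge; exact: num_real.
  rewrite /lip_cdf (_ : cl x = N); last first.
    have n0 := N0; have nN : - N <= N by lra.
    by rewrite /cl (min_idPr xN) (max_idPr nN).
  rewrite (_ : _ + _ = total) ?divff ?gt_eqF//.
  by rewrite /total; ring.
apply: cvg_trans; [exact: near_eq_cvg E|exact: cvg_cst].
Unshelve. all: by end_near. Qed.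

HB.instance Definition _ := isCumulativeBounded.Build R 0 1 lip_cdf
  lip_cdfNy lip_cdfy.

Let nu := lebesgue_stieltjes_measure lip_cdf.

Let nu_itv x y : x <= y -> nu `]x, y] = (lip_cdf y - lip_cdf x)%:E.
Proof.
move=> xy; rewrite /nu /lebesgue_stieltjes_measure /measure_extension.
by rewrite measurable_mu_extE/=; [rewrite wlength_itv_bnd|exact: is_ocitv].
Qed.

(** Intervals have measure at most a multiple of their length, hence Lebesgue
    null sets, which have covers of arbitrarily small total length, are null. *)
Let nu_dom : nu `<< (lebesgue_measure : {measure set (measurableTypeR R) -> \bar R}).
Proof.
apply/null_content_dominatesP => A mA A0.
pose c := 3 * B / total.
have c0 : 0 < c by rewrite divr_gt0// mulr_gt0.
apply/eqP; rewrite eq_le measure_ge0 andbT; apply/lee_addgt0Pr => e e0.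
rewrite add0e.
have : (lebesgue_measure A < (e / c)%:E)%E by rewrite A0 lte_fin divr_gt0.
rewrite /lebesgue_measure /lebesgue_stieltjes_measure /measure_extension /mu_ext.
move=> /ereal_inf_lt[_ [F FA <-]] Fe.
have wle k : (wlength lip_cdf (F k) <= c%:E * wlength idfun (F k))%E.
  have /ocitvP[->|[x x12 ->]] : ocitv (F k) by exact: (cover_measurable FA).
    by rewrite !wlength0 mule0.
  rewrite !wlength_itv_bnd ?(ltW x12)//= -EFinM lee_fin.
  by have /andP[] := lip_cdf_diff (ltW x12).
have w0 k : (0 <= wlength idfun (F k))%E by exact: wlength_ge0.
apply: (@le_trans _ _ (\sum_(k <oo) wlength lip_cdf (F k))%E).
  by apply: ereal_inf_lbound; exists F.
apply: (@le_trans _ _ (\sum_(k <oo) (c%:E * wlength idfun (F k)))%E).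
  by apply: lee_nneseries => k _ //; exact: wlength_ge0.
rewrite nneseriesZl//.
apply: (@le_trans _ _ (c%:E * (e / c)%:E)%E).
  by apply: lee_wpmul2l; [rewrite lee_fin ltW|exact: ltW].
by rewrite -EFinM mulrC divfK// gt_eqF.
Qed.

(** The distribution function is the indefinite integral of the Radon-Nikodym
    derivative of its measure, hence differentiable almost everywhere by
    Lebesgue's differentiation theorem. *)
Lemma lip_ae_derivable_itv :
  {ae mu, forall x, - N < x < N -> derivable Phi x 1}.
Proof.
pose h := Radon_Nikodym_SigmaFinite.f nu (@lebesgue_measure R).
have hfin x : h x \is a fin_num by exact: (Radon_Nikodym_SigmaFinite.f_fin_num nu_dom).
have hE : h = EFin \o (fine \o h) by apply/funext => x /=; rewrite fineK.
have hint : mu.-integrable setT (EFin \o (fine \o h)).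
  by rewrite -hE; exact: (Radon_Nikodym_SigmaFinite.f_integrable nu_dom).
have hintS (i : interval R) : mu.-integrable [set` i] (EFin \o (fine \o h)).
  by apply: integrableS hint => //; exact: measurable_itv.
have hloc : locally_integrable setT (fine \o h).
  by apply: open_integrable_locally => //; exact: openT.
have := FTC1 (a := BRight (- N)) (fun y => hintS _) hloc.
apply: filterS; first exact: (ae_filter_ringOfSetsType mu).
move=> x /= dx /andP[x1 x2]; have [{}dx _] := dx x1.
have FE y : - N <= y ->
    \int[mu]_(t in `]- N, y]) (fine \o h) t = lip_cdf y - lip_cdf (- N).
  move=> Ny; rewrite /Rintegral -/(EFin \o _) -hE.
  have fi : (\int[mu]_(t in `](- N)%R, y]) h t)%E = (lip_cdf y - lip_cdf (- N))%:E.
    rewrite -(Radon_Nikodym_SigmaFinite.f_integral nu_dom (measurable_itv _)).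
    exact: nu_itv.
  by rewrite fi.
have clN : cl (- N) = - N by rewrite clE// lexx/=; move: N0; lra.
have near_in : \forall y \near x, y \in `]- N, N[.
  by apply: near_in_itvoo; rewrite in_itv /= x1.
pose G y := (total * \int[mu]_(t in `]- N, y]) (fine \o h) t) +
  ((Phi (- N) - 2 * B * N) + (- (2 * B)) * id y).
apply: (@near_eq_derivable _ _ _ G).
  move: near_in; apply: filterS => y; rewrite in_itv /= => /andP[y1 y2].
  rewrite /G FE ?ltW// /lip_cdf clN clE ?ltW//.
  by field; rewrite gt_eqF.
have [d2 _] := is_derive_affine (Phi (- N) - 2 * B * N) (- (2 * B)) (is_derive_id x 1).
have d1 := @derivableZ R R R _ total x 1 dx.
exact: (derivableD d1 d2).
Qed.

End TruncatedCDF.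

(** Rademacher's theorem on the line: reduced to intervals, where the truncation
    has no effect. *)
Lemma lip_ae_derivable (Phi : R -> R) (B : R) :
  (forall x y, x <= y -> `|Phi y - Phi x| <= B * (y - x)) ->
  {ae mu, forall x, derivable Phi x 1}.
Proof.
move=> lip.
have B10 : 0 < B + 1.
  have := le_trans (normr_ge0 _) (lip 0 1 ler01); rewrite subr0 mulr1 => B0.
  by rewrite ltr_wpDl.
have lip1 x y : x <= y -> `|Phi y - Phi x| <= (B + 1) * (y - x).
  move=> xy; apply: le_trans (lip _ _ xy) _.
  by rewrite ler_wpM2r ?subr_ge0// lerDl.
have H n : {ae mu, forall x, - n.+1%:R < x < n.+1%:R -> derivable Phi x 1}.
  by apply: lip_ae_derivable_itv B10 _ lip1; rewrite ltr0n.
have Hall := ae_foralln H.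
have sub x : (forall n, - n.+1%:R < x < n.+1%:R -> derivable Phi x 1) ->
    derivable Phi x 1.
  move=> h; apply: (h (Num.truncn `|x|)).
  by rewrite -ltr_norml truncnS_gt.
by apply: filterS Hall => x; exact: sub.
Qed.

End LipschitzDifferentiable.

(** * Antiderivatives *)

Section Antiderivative.
Variable R : realType.
Implicit Types (f g : R -> R) (x y a b : R).

Lemma is_derive_cont f x l : is_derive x 1 f l -> {for x, continuous f}.
Proof. by move=> [df _]; apply: differentiable_continuous; exact/derivable1_diffP. Qed.

(** The integral from 0 to [x], oriented. *)
Definition prim g x : R :=
  if 0 <= x then \int[mu]_(t in `[0, x]) g t else - \int[mu]_(t in `[x, 0]) g t.

Lemma prim0 g : prim g 0 = 0.
Proof. by rewrite /prim lexx set_itv1 Rintegral_set1. Qed.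

Lemma prim_base g a x : continuous g -> a <= 0 -> a <= x ->
  prim g x = \int[mu]_(t in `[a, x]) g t - \int[mu]_(t in `[a, 0]) g t.
Proof.
move=> cg a0 ax; rewrite /prim; case: (leP 0 x) => x0.
  rewrite (@Rintegral_segment_split _ g a 0 x)//.
  by ring.
have x0' := ltW x0; rewrite (@Rintegral_segment_split _ g a x 0)//.
by ring.
Qed.

Lemma is_derive_prim g x : continuous g -> is_derive x 1 (prim g) (g x).
Proof.
move=> cg; pose a := Num.min 0 x - 1.
have m0 : Num.min 0 x <= 0 by rewrite ge_min lexx.
have mx : Num.min 0 x <= x by rewrite ge_min lexx orbT.
have a0 : a <= 0 by rewrite /a; move: m0; lra.
have ax : a < x by rewrite /a; move: mx; lra.
have xx : x < x + 1 by rewrite ltrDl.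
have ig : mu.-integrable `[a, x + 1] (EFin \o g).
  by apply: segment_integrable => t _; exact: cg.
have [d dE] := continuous_FTC1_closed xx ig ax (cg x).
have dF : is_derive x 1 (fun y => \int[mu]_(t in `[a, y]) g t
    + cst (- \int[mu]_(t in `[a, 0]) g t) y) (g x).
  have h : is_derive x 1 (fun y => \int[mu]_(t in `[a, y]) g t) (g x).
    by split; [exact: d|rewrite -derive1E; exact: dE].
  have h2 := @is_deriveD R R R _ _ x 1 _ _ h (is_derive_cst (- \int[mu]_(t in `[a, 0]) g t) x 1).
  by apply: (is_derive_eq h2); rewrite addr0.
apply: near_eq_is_derive dF.
have : \forall y \near x, a < y by exact: lt_nbhsr.
by apply: filterS => y ay; rewrite (prim_base cg a0 (ltW ay)).
Qed.

Lemma continuous_prim g : continuous g -> continuous (prim g).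
Proof. by move=> cg x; exact: is_derive_cont (is_derive_prim x cg). Qed.

Lemma prim_lip g (B : R) x y : continuous g -> (forall t, `|g t| <= B) ->
  `|prim g y - prim g x| <= B * `|y - x|.
Proof.
move=> cg gB; wlog xy : x y / x <= y.
  move=> H; have [xy|yx] := leP x y; first exact: H.
  by rewrite distrC [`|y - x|]distrC; apply: H; exact: ltW.
have [|c _ ->] := @MVT_segment R (prim g) g x y xy (fun t _ => is_derive_prim t cg).
  by apply: continuous_subspaceT; exact: continuous_prim.
by rewrite normrM ler_wpM2r.
Qed.

End Antiderivative.

(** * The primitive of the boundary values *)

Section BoundaryPrimitive.
Variable R : realType.
Variable f : R[i] -> R[i].
Hypothesis hf : forall z : R[i], 0 < Im z -> exists l, cdiff f z l.
Variable B : R.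
Hypothesis fB : forall z : R[i], 0 < Im z -> `|Re (f z)| <= B.
Implicit Types (x y e h : R).

Let I : set R := `]- (pi / 2), pi / 2[.
Let mI : measurable I. Proof. exact: measurable_itv. Qed.

Let U e := prim (Re_line f e).

Let cU e : 0 < e -> continuous (U e).
Proof. by move=> e0; apply: continuous_prim; exact: continuous_Re_line. Qed.

Let lipU e x y : 0 < e -> `|U e y - U e x| <= B * `|y - x|.
Proof.
move=> e0; apply: prim_lip; first exact: continuous_Re_line.
by move=> t; exact: Re_line_bound.
Qed.

Let B0 : 0 <= B.
Proof. by apply: (le_trans (normr_ge0 _) (fB (z := 0 +i* 1) _)); rewrite /= ltr01. Qed.

Let cT x y t : I t -> {for t, continuous (fun t => x + y * tan t)}.
Proof.
move=> tI; have c0 : cos t != 0 by apply: cos_angle_neq0; exact: tI.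
exact: is_derive_cont (is_derive_affine x y (is_derive_tan c0)).
Qed.

Let cUT e x y : 0 < e -> measurable_fun I (fun t => U e (x + y * tan t)).
Proof.
move=> e0; apply: open_itv_measurable => t tI.
by apply: (@continuous_comp _ _ _ (fun t => x + y * tan t) (U e)); [exact: cT|exact: cU].
Qed.

Let Poisson_line e h x : 0 < e -> 0 < h ->
  \int[mu]_(t in I) Re_line f e (x + h * tan t) = pi * Re_line f (e + h) x.
Proof.
move=> e0 h0; have := Poisson_angle hf fB x h0 e0.
by rewrite [h + e]addrC.
Qed.

(** Poisson's formula integrated once along the line: passing from height [e] to
    height [e + h] averages the primitive. *)
Lemma prim_average e h x : 0 < e -> 0 < h ->
  pi * U (e + h) x = \int[mu]_(t in I) (U e (x + h * tan t) - U e (h * tan t)).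
Proof.
move=> e0 h0; have eh0 : 0 < e + h by rewrite addr_gt0.
pose V x := \int[mu]_(t in I) (U e (x + h * tan t) - U e (h * tan t)).
have V0 : V 0 = 0.
  rewrite /V; transitivity (\int[mu]_(t in I) cst 0 t).
    by apply: eq_Rintegral => t _; rewrite add0r subrr.
  by rewrite Rintegral_cst//= mul0r.
have mk u : measurable_fun I (fun t => U e (u + h * tan t) - U e (h * tan t)).
  apply: measurable_funB; first exact: cUT.
  by have := @cUT e 0 h e0; under eq_fun do rewrite add0r.
have d1 (u t : R) : is_derive u 1 (fun x : R => U e (x + h * tan t) - U e (h * tan t))
    (Re_line f e (u + h * tan t)).
  have d0 := is_derive_prim (u + h * tan t) (continuous_Re_line hf e0).
  have d1 : is_derive u 1 (fun x : R => x + h * tan t) 1.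
    have h1 := @is_deriveD R R R _ _ u 1 _ _ (is_derive_id u 1) (is_derive_cst (h * tan t) u 1).
    by apply: (is_derive_eq h1); rewrite addr0.
  have d2 := @is_derive1_comp R (U e) (fun x => x + h * tan t) u _ _ d0 d1.
  have h2 := @is_deriveD R R R _ _ u 1 _ _ d2 (is_derive_cst (- U e (h * tan t)) u 1).
  by apply: (is_derive_eq h2); rewrite addr0 mulr1.
have bk (u t : R) : `|U e (u + h * tan t) - U e (h * tan t)| <= B * `|u|.
  by have := @lipU e (h * tan t) (u + h * tan t) e0; rewrite addrK.
have ik (u : R) : mu.-integrable I (EFin \o (fun t => U e (u + h * tan t) - U e (h * tan t))).
  by apply: (@bounded_integrable _ _ _ _ (B * `|u|)) => //.
have dV (u : R) : is_derive u 1 V (pi * Re_line f (e + h) u).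
  have u1 : u - 1 < u < u + 1 by apply/andP; split; lra.
  have GB v t : `]u - 1, u + 1[%classic v -> I t ->
      `|partial1of2 (fun x t => U e (x + h * tan t) - U e (h * tan t)) v t| <= cst B t.
    move=> _ _; rewrite /partial1of2 derive1E; have [_ ->] := d1 v t.
    exact: Re_line_bound.
  have iB : mu.-integrable I (EFin \o cst B).
    by apply: (@bounded_integrable _ _ _ _ `|B|) => //; exact: measurable_cst.
  have u1' : `]u - 1, u + 1[%classic u by rewrite /= in_itv.
  have ik' v : `]u - 1, u + 1[%classic v ->
      mu.-integrable I (EFin \o (fun t => U e (v + h * tan t) - U e (h * tan t))).
    by move=> _; exact: ik.
  have dr' v t : `]u - 1, u + 1[%classic v -> I t ->
      derivable (fun x => U e (x + h * tan t) - U e (h * tan t)) v 1.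
    by move=> _ _; have [] := d1 v t.
  have dd := @derivable_under_integral R _ (measurableTypeR R) (@lebesgue_measure R)
    (fun x t => U e (x + h * tan t) - U e (h * tan t)) I mI u (u - 1) (u + 1) u1' ik' dr'
    (cst B) (fun=> B0) iB GB.
  have dE := @differentiation_under_integral R _ (measurableTypeR R) (@lebesgue_measure R)
    (fun x t => U e (x + h * tan t) - U e (h * tan t)) I mI u (u - 1) (u + 1) u1' ik' dr'
    (cst B) (fun=> B0) iB GB.
  split; first exact: dd.
  rewrite -derive1E; apply: etrans dE _; rewrite -Poisson_line//.
  by apply: eq_Rintegral => t _; rewrite /partial1of2 derive1E; have [_ ->] := d1 u t.
pose D x := pi * U (e + h) x + (- V x).
have dD (u : R) : is_derive u 1 D 0.
  have h1 := is_derive_prim u (continuous_Re_line hf eh0).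
  have h2 := @is_deriveD R R R _ _ u 1 _ _ (is_deriveZ pi h1) (is_deriveN (dV u)).
  by apply: (is_derive_eq h2); rewrite /GRing.scale /= subrr.
have := is_derive_0_is_cst x 0 dD; rewrite /D V0 /U prim0 mulr0 subr0.
by move/eqP; rewrite subr_eq0 => /eqP.
Qed.

(** A modulus of continuity in the height, uniform in the lower line: it dominates
    the change of the primitive, and decreases to 0 with [h]. *)
Let W h x := \int[mu]_(t in I) (2 * B * Num.min (h * `|tan t|) `|x|).

Let mW h x : measurable_fun I (fun t => 2 * B * Num.min (h * `|tan t|) `|x|).
Proof.
apply: measurable_funM => //.
apply: (@measurable_minr _ _ _ _ (fun t => h * `|tan t|) (cst `|x|)); last exact: measurable_cst.
apply: measurable_funM => //; apply: measurableT_comp => //.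
apply: open_itv_measurable => t tI; apply: continuous_tan.
by apply: cos_angle_neq0.
Qed.

Let bW h x t : 0 <= h -> `|2 * B * Num.min (h * `|tan t|) `|x| | <= 2 * B * `|x|.
Proof.
move=> h0; have m0 : 0 <= Num.min (h * `|tan t|) `|x| by rewrite le_min normr_ge0 mulr_ge0.
have b2 : 0 <= 2 * B by rewrite mulr_ge0.
by rewrite ger0_norm ?mulr_ge0// ler_wpM2l// ge_min lexx orbT.
Qed.

Let iW h x : 0 <= h ->
  mu.-integrable I (EFin \o (fun t => 2 * B * Num.min (h * `|tan t|) `|x|)).
Proof. by move=> h0; apply: (bounded_integrable (mW h x)) => t _; exact: bW. Qed.

Let prim_diff e h x : 0 < e -> 0 < h -> `|U (e + h) x - U e x| <= pi^-1 * W h x.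
Proof.
move=> e0 h0; have pi0 := pi_gt0 R.
have E : pi * (U (e + h) x - U e x) =
    \int[mu]_(t in I) (U e (x + h * tan t) - U e (h * tan t) - U e x).
  have ik : mu.-integrable I (EFin \o (fun t => U e (x + h * tan t) - U e (h * tan t))).
    apply: (@bounded_integrable _ _ _ _ (B * `|x|)) => //.
      apply: measurable_funB; first exact: cUT.
      by have := @cUT e 0 h e0; under eq_fun do rewrite add0r.
    by move=> t _; have := @lipU e (h * tan t) (x + h * tan t) e0; rewrite addrK.
  have ic : mu.-integrable I (EFin \o cst (U e x)).
    by apply: (@bounded_integrable _ _ _ _ `|U e x|) => //; exact: measurable_cst.
  rewrite RintegralB//.
  rewrite mulrBr prim_average//; congr (_ - _).
  rewrite /I Rintegral_cst//= lebesgue_measure_itv/= lte_fin.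
  have -> : - (pi / 2) < pi / 2 :> R by lra.
  by rewrite /= mulrC; congr (_ * _); field.
rewrite mulrC ler_pdivlMr// -[X in _ * X](gtr0_norm pi0) -normrM mulrC E.
have ms : measurable_fun I (fun t => U e (x + h * tan t) - U e (h * tan t) - U e x).
  apply: measurable_funB => //; apply: measurable_funB; first exact: cUT.
  by have := @cUT e 0 h e0; under eq_fun do rewrite add0r.
have bd t : `|U e (x + h * tan t) - U e (h * tan t) - U e x| <=
    2 * B * Num.min (h * `|tan t|) `|x|.
  rewrite minr_pMr ?mulr_ge0// le_min; apply/andP; split.
    rewrite (_ : _ - _ = (U e (x + h * tan t) - U e x) - (U e (h * tan t) - U e 0)); last first.
      by rewrite [U e 0]prim0; ring.
    rewrite -mulrA mulr_natl mulr2n; apply: le_trans (ler_normB _ _) _.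
    apply: lerD.
      by apply: le_trans (lipU _ _ e0) _; rewrite addrAC subrr add0r normrM gtr0_norm.
    by apply: le_trans (lipU _ _ e0) _; rewrite subr0 normrM gtr0_norm.
  rewrite (_ : _ - _ = (U e (x + h * tan t) - U e (h * tan t)) - (U e x - U e 0)); last first.
    by rewrite [U e 0]prim0; ring.
  rewrite -mulrA mulr_natl mulr2n; apply: le_trans (ler_normB _ _) _.
  apply: lerD.
    by apply: le_trans (lipU _ _ e0) _; rewrite addrK.
  by apply: le_trans (lipU _ _ e0) _; rewrite subr0.
have is1 : mu.-integrable I
    (EFin \o (fun t => U e (x + h * tan t) - U e (h * tan t) - U e x)).
  apply: (bounded_integrable ms) => t _; apply: le_trans (bd t) _.
  by apply: le_trans (ler_norm _) (bW x t (ltW h0)).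
pose F t := U e (x + h * tan t) - U e (h * tan t) - U e x.
apply: (@le_trans _ _ (\int[mu]_(t in I) `|F t|)); first exact: le_normr_Rintegral.
apply: le_Rintegral => //; [exact: (integrable_norm is1)|apply: iW; exact: ltW|].
by move=> t _; exact: bd.
Qed.

Let W_cvg x : W n.+1%:R^-1 x @[n --> \oo] --> 0.
Proof.
have -> : 0 = \int[mu]_(t in I) cst 0 t by rewrite Rintegral_cst//= mul0r.
apply: (@Rintegral_dct _ _ _ _ (cst (2 * B * `|x|))) => //.
- move=> t tI; rewrite [cst 0 t](_ : _ = 2 * B * Num.min (0 * `|tan t|) `|x|); last first.
    by rewrite mul0r (min_idPl (normr_ge0 x)) mulr0.
  apply: cvgM; first exact: cvg_cst.
  rewrite mul0r (min_idPl (normr_ge0 x)).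
  apply: (@squeeze_cvgr _ _ _ _ (cst 0) (fun n => n.+1%:R^-1 * `|tan t|)).
  - apply: nearW => n; rewrite le_min ge_min lexx normr_ge0 mulr_ge0 ?invr_ge0//.
  - exact: cvg_cst.
  - rewrite -[X in _ --> X](mul0r `|tan t|).
    by apply: cvgM; [exact: cvg_harmonic|exact: cvg_cst].
- by apply: (@bounded_integrable _ _ _ _ `|2 * B * `|x| |) => //; exact: measurable_cst.
- by move=> n t _; apply: bW; rewrite invr_ge0.
Qed.

Let W_mono h h' x : 0 <= h <= h' -> W h x <= W h' x.
Proof.
move=> /andP[h0 hh']; apply: le_Rintegral => //.
- exact: iW.
- exact: (iW x (le_trans h0 hh')).
- move=> t _; rewrite ler_wpM2l ?mulr_ge0// le_min ge_min [X in _ && X]ge_min lexx orbT andbT.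
  by rewrite ler_wpM2r.
Qed.

(** The primitives along horizontal lines converge as the line approaches the
    boundary: a primitive of the boundary values, though these are not yet known
    to exist. *)
Lemma cvg_prim_line x : cvg (U n.+1%:R^-1 x @[n --> \oo]).
Proof.
apply/cauchy_cvgP; apply: cauchy_exP => e e0.
have pi0 := pi_gt0 R.
have ep : 0 < e * pi by rewrite mulr_gt0.
have /cvgrPdist_lt /(_ _ ep) [N _ NP] := W_cvg x.
exists (U N.+1%:R^-1 x).
suff : \forall n \near \oo, `|U N.+1%:R^-1 x - U n.+1%:R^-1 x| < e by [].
exists N => // n /= Nn.
have := NP N (leqnn N); rewrite sub0r normrN => /(le_lt_trans (ler_norm _)) WN.
have [->|nN] := eqVneq n N; first by rewrite subrr normr0.
have n0 : (0 : R) < n.+1%:R^-1 by rewrite invr_gt0.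
have nlt : n.+1%:R^-1 < N.+1%:R^-1 :> R.
  by rewrite ltf_pV2 ?posrE// ltr_nat ltnS ltn_neqAle eq_sym nN.
have h0 : 0 < N.+1%:R^-1 - n.+1%:R^-1 :> R by rewrite subr_gt0.
have := @prim_diff _ _ x n0 h0; rewrite [_ + (_ - _)]addrC subrK => /le_lt_trans; apply.
rewrite mulrC ltr_pdivrMr//; apply: le_lt_trans WN; apply: W_mono.
by rewrite (ltW h0) lerBlDr lerDl ltW.
Qed.

Definition bdry_prim x := lim (U n.+1%:R^-1 x @[n --> \oo]).

Lemma bdry_prim_lip x y : `|bdry_prim y - bdry_prim x| <= B * `|y - x|.
Proof.
have c z : U n.+1%:R^-1 z @[n --> \oo] --> bdry_prim z by exact: cvg_prim_line.
apply: (cvgr_to_le (cvg_norm (cvgB (c y) (c x)))); apply: nearW => n.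
by apply: lipU; rewrite invr_gt0.
Qed.

End BoundaryPrimitive.

(** * Integration by parts in the angular coordinate *)

Section ByParts.
Variable R : realType.
Implicit Types (g H k : R -> R) (x y t : R).

Let I : set R := `]- (pi / 2), pi / 2[.
Let mI : measurable I. Proof. exact: measurable_itv. Qed.

(** The fundamental theorem of calculus on the open interval for a primitive that
    vanishes at both ends. *)
Lemma integral_derive_angle H k (C D : R) :
  (forall t, I t -> is_derive t 1 H (k t)) ->
  {in I, continuous k} -> (forall t, I t -> `|k t| <= C) ->
  (forall t, I t -> `|H t| <= D * cos t) ->
  \int[mu]_(t in I) k t = 0.
Proof.
move=> dH ck kC HD.
pose a n : R := pi / 2 - n.+1%:R^-1.
have p2 := @pi_ge2 R.
have aE : a n @[n --> \oo] --> pi / 2.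
  rewrite -[X in _ --> X]subr0; apply: cvgB; [exact: cvg_cst|exact: cvg_harmonic].
have n1 n : 0 < (n.+1%:R^-1 : R) <= 1 by rewrite invr_gt0 ltr0n invf_le1 ?ler1n.
have aI n : 0 <= a n < pi / 2.
  rewrite /a; move: (n.+1%:R^-1 : R) (n1 n) => u /andP[u0 u1]; apply/andP; split; lra.
have inI n t : `[- a n, a n]%classic t -> I t.
  have /andP[h1 h2] := aI n.
  by rewrite /I /= !in_itv /= => /andP[t1 t2]; apply/andP; split; lra.
have mk : measurable_fun I k.
  by apply: open_itv_measurable => t tI; apply: ck; rewrite inE.
have part n : \int[mu]_(t in `[- a n, a n]) k t = H (a n) - H (- a n).
  have /andP[h1 h2] := aI n.
  have [a0|a0] := eqVneq (a n) 0.
    by rewrite a0 oppr0 set_itv1 Rintegral_set1 subrr.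
  have a_gt0 : 0 < a n by rewrite lt_neqAle eq_sym a0.
  have aa : - a n < a n by lra.
  have dHt t : t \in `[- a n, a n] -> is_derive t 1 H (k t).
    by move=> tI; apply: dH; exact: (inI n).
  have cH t : t \in `[- a n, a n] -> {for t, continuous H}.
    by move=> tI; exact: is_derive_cont (dHt t tI).
  have cka : {within `[- a n, a n], continuous k}.
    apply: continuous_in_subspaceT => t; rewrite inE => tI.
    by apply: ck; rewrite inE; exact: (inI n).
  rewrite /Rintegral (@continuous_FTC2 _ k H)//.
    split.
    - by move=> t ti; have [] := dHt t (subset_itv_oo_cc ti).
    - by apply: cvg_at_right_filter; apply: cH; rewrite in_itv /= lexx ltW.
    - by apply: cvg_at_left_filter; apply: cH; rewrite in_itv /= lexx ltW.
  by move=> t ti; rewrite derive1E; have [] := dHt t (subset_itv_oo_cc ti).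
have lim1 : \int[mu]_(t in I) (k \_ `[- a n, a n]) t @[n --> \oo] --> \int[mu]_(t in I) k t.
  apply: (@Rintegral_dct _ _ _ _ (cst C)) => //.
  - move=> n; apply/measurable_restrict => //.
    apply: measurable_funS mk => //; exact: subIsetl.
  - move=> t; rewrite /I /= in_itv /= => /andP[t1 t2].
    have tp : `|t| < pi / 2 by rewrite ltr_norml t1.
    have near_t : \forall n \near \oo, `|t| < a n by exact: (cvgr_gt _ aE _ tp).
    apply: cvg_near_cst; apply: filterS near_t => n tn.
    rewrite patchE; case: ifPn => //; rewrite notin_setE => h; exfalso; apply: h.
    by rewrite /= in_itv /= -ler_norml ltW.
  - by apply: (@bounded_integrable _ _ _ _ `|C|) => //; exact: measurable_cst.
  - move=> n t tI; rewrite patchE; case: ifP => _; first exact: kC.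
    by rewrite normr0; exact: le_trans (kC t tI).
have lim2 : \int[mu]_(t in I) (k \_ `[- a n, a n]) t @[n --> \oo] --> (0 : R).
  have cosa : cos (a n) @[n --> \oo] --> (0 : R).
    rewrite -(@cos_pihalf R); exact: (cvg_comp a (@cos R) aE (@continuous_cos R (pi / 2))).
  have E n : \int[mu]_(t in I) (k \_ `[- a n, a n]) t = H (a n) - H (- a n).
    rewrite -part -Rintegral_mkcondr; congr (Rintegral _ _ _).
    by rewrite setIidr// => t; exact: (inI n).
  under eq_fun do rewrite E.
  have D0 : (fun n => 2 * D * cos (a n)) @ \oo --> (0 : R).
    by rewrite -(mulr0 (2 * D)); apply: cvgM; [exact: cvg_cst|].
  apply/norm_cvg0P; apply: (squeeze_cvgr _ (cvg_cst 0) D0).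
  apply: nearW => n; rewrite normr_ge0 /=.
  have /andP[h1 h2] := aI n.
  have i1 : I (a n) by apply: (inI n); rewrite /= in_itv /= lexx andbT; lra.
  have i2 : I (- a n) by apply: (inI n); rewrite /= in_itv /= lexx/=; lra.
  apply: le_trans (ler_normB _ _) _; rewrite -mulrA mulr_natl mulr2n.
  by apply: lerD; [exact: HD|rewrite -cosN; exact: HD].
by apply: (cvg_unique _ lim1 lim2).
Qed.

(** For [d] the increment of a [B]-Lipschitz function over [y * tan t], divided by
    [y]: the factors [sin t] and [cos t] compensate the growth of [tan t]. *)
Lemma slope_bound (t d B : R) : 0 <= B -> I t -> `|d| <= B * `|tan t| ->
  `|2 * sin t * cos t * d| <= 2 * B /\ `|cos t ^+ 2 * d| <= B * cos t.
Proof.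
move=> B0 tI dB; have c0 : 0 < cos t by apply: cos_gt0_pihalf; move: tI; rewrite /I /= in_itv.
have cd : `|cos t * d| <= B * `|sin t|.
  rewrite normrM (gtr0_norm c0) mulrC -ler_pdivlMr// -mulrA -[X in _ / X](gtr0_norm c0).
  by rewrite -normf_div.
have s1 : `|sin t| <= 1 by rewrite ler_norml sin_geN1 sin_le1.
have Bs : B * `|sin t| <= B by rewrite ler_piMr.
split.
  have -> : 2 * sin t * cos t * d = 2 * (sin t * (cos t * d)) by ring.
  rewrite normrM ger0_norm// ler_pM2l// normrM.
  by apply: le_trans Bs; apply: le_trans cd; rewrite ler_piMl.
rewrite expr2 -mulrA normrM (gtr0_norm c0) mulrC ler_pM2r//.
exact: le_trans cd Bs.
Qed.

(** The derivative of [cos t ^ 2] times the slope is the difference of the two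
    integrands, and it vanishes at the ends. *)
Lemma angle_by_parts g (B : R) x y : continuous g -> (forall t, `|g t| <= B) -> 0 < y ->
  \int[mu]_(t in I) g (x + y * tan t) = \int[mu]_(t in I)
    (2 * sin t * cos t * ((prim g (x + y * tan t) - prim g x) / y)).
Proof.
move=> cg gB y0.
have B0 : 0 <= B by exact: le_trans (gB 0).
pose D t := (prim g (x + y * tan t) - prim g x) / y.
have DB t : `|D t| <= B * `|tan t|.
  rewrite normrM normfV (gtr0_norm y0) ler_pdivrMr//.
  apply: le_trans (prim_lip _ _ cg gB) _.
  by rewrite [x + _]addrC addrK normrM (gtr0_norm y0) [y * _]mulrC mulrA.
have c0 t : I t -> cos t != 0 by move=> tI; apply: cos_angle_neq0.
have dT t : I t -> is_derive t 1 (fun t => x + y * tan t) (y * cos t ^- 2).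
  by move=> tI; exact: is_derive_affine (is_derive_tan (c0 t tI)).
have dD t : I t -> is_derive t 1 D (g (x + y * tan t) * cos t ^- 2).
  move=> tI.
  have h1 := @is_derive1_comp R (prim g) (fun t => x + y * tan t) t _ _
    (is_derive_prim (x + y * tan t) cg) (dT t tI).
  have h2 := @is_deriveD R R R _ _ t 1 _ _ (is_deriveZ y^-1 h1)
    (is_derive_cst (- (y^-1 * prim g x)) t 1).
  have -> : D = (fun t => y^-1 * prim g (x + y * tan t)) + cst (- (y^-1 * prim g x)).
    by apply/funext => u; rewrite /D /= mulrBl mulrC [prim g x / y]mulrC.
  apply: (is_derive_eq h2); rewrite addr0 /GRing.scale /=.
  have ct := c0 t tI; have y00 : y != 0 by rewrite gt_eqF.
  by field; rewrite ct y00.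
pose k t := g (x + y * tan t) - 2 * sin t * cos t * D t.
have dH t : I t -> is_derive t 1 (fun t => cos t ^+ 2 * D t) (k t).
  move=> tI; have h0 := is_deriveM (is_derive_cos t) (is_derive_cos t).
  have h1 : is_derive t 1 (fun t => cos t ^+ 2) (- (2 * sin t * cos t)).
    by apply: (is_derive_eq h0); rewrite /GRing.scale /=; ring.
  have h2 := is_deriveM h1 (dD t tI); apply: (is_derive_eq h2).
  rewrite /k /GRing.scale /=.
  have ct := c0 t tI; by field.
have cgT t : I t -> {for t, continuous (fun t => g (x + y * tan t))}.
  move=> tI; apply: (@continuous_comp _ _ _ (fun t => x + y * tan t) g); last exact: cg.
  exact: is_derive_cont (dT t tI).
have csD t : I t -> {for t, continuous (fun t => 2 * sin t * cos t * D t)}.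
  move=> tI; apply: continuousM; last exact: is_derive_cont (dD t tI).
  apply: continuousM; last exact: continuous_cos.
  by apply: continuousM; [exact: cst_continuous|exact: continuous_sin].
have bD t : I t -> `|2 * sin t * cos t * D t| <= 2 * B.
  by move=> tI; have [] := slope_bound B0 tI (DB t).
have k0 : \int[mu]_(t in I) k t = 0.
  apply: (@integral_derive_angle (fun t => cos t ^+ 2 * D t) _ (B + 2 * B) B) => //.
  - by move=> t; rewrite inE => tI; rewrite /k; apply: cvgB; [exact: cgT|exact: csD].
  - move=> t tI; apply: le_trans (ler_normB _ _) _.
    by apply: lerD; [exact: gB|exact: bD].
  - by move=> t tI; have [] := slope_bound B0 tI (DB t).
move: k0; rewrite /k RintegralB//.
- by move/eqP; rewrite subr_eq0 => /eqP.
- apply: (@bounded_integrable _ _ _ _ B) => //; apply: open_itv_measurable => t tI; exact: cgT.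
- apply: (@bounded_integrable _ _ _ _ (2 * B)) => //.
  by apply: open_itv_measurable => t tI; exact: csD.
Qed.

Lemma integrable_sin2 : mu.-integrable I (EFin \o (fun t => 2 * sin t ^+ 2)).
Proof.
apply: (@bounded_integrable _ _ _ _ 2) => //.
  apply: open_itv_measurable => t tI; apply: (@continuousM _ _ (cst 2) (fun t => sin t ^+ 2)); first exact: cst_continuous.
  by apply: (@continuous_comp _ _ _ (@sin R) (fun u => u ^+ 2)); [exact: continuous_sin|exact: exprn_continuous].
move=> t _; have s0 := sqr_ge0 (sin t).
rewrite ger0_norm; last exact: (mulr_ge0 (ler0n R 2) s0).
have := cos2Dsin2 t; have := sqr_ge0 (cos t); lra.
Qed.

Lemma integral_sin2 : \int[mu]_(t in I) (2 * sin t ^+ 2) = pi.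
Proof.
pose k (t : R) := 1 - 2 * sin t ^+ 2.
have k0 : \int[mu]_(t in I) k t = 0.
  apply: (@integral_derive_angle (fun t => sin t * cos t) _ 3 1) => //.
  - move=> t tI; have h := is_deriveM (is_derive_sin t) (is_derive_cos t).
    apply: (is_derive_eq h); rewrite /k /GRing.scale /=.
    transitivity (cos t ^+ 2 + sin t ^+ 2 - 2 * sin t ^+ 2); first by ring.
    by rewrite cos2Dsin2.
  - move=> t _; rewrite /k; apply: cvgB; first exact: cst_continuous.
    apply: (@continuousM _ _ (cst 2) (fun t => sin t ^+ 2)); first exact: cst_continuous.
    by apply: (@continuous_comp _ _ _ (@sin R) (fun u => u ^+ 2)); [exact: continuous_sin|exact: exprn_continuous].
  - move=> t _; have := cos2Dsin2 t; have := sqr_ge0 (cos t); have := sqr_ge0 (sin t).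
    rewrite /k ler_norml; move: (sin t ^+ 2) (cos t ^+ 2) => u v; lra.
  - move=> t; rewrite /I /= in_itv /= => tI; rewrite normrM mul1r.
    have c0 := cos_gt0_pihalf tI; rewrite (gtr0_norm c0) ler_piMl//; first exact: ltW.
    by rewrite ler_norml sin_geN1 sin_le1.
have E : \int[mu]_(t in I) cst 1 t = pi :> R.
  rewrite /I Rintegral_cst//= lebesgue_measure_itv/= lte_fin.
  have p0 := pi_gt0 R; have -> : - (pi / 2) < pi / 2 :> R by lra.
  by rewrite /= mul1r; field.
move: k0; rewrite /k RintegralB//.
- by move/eqP; rewrite subr_eq0 E => /eqP.
- by apply: (@bounded_integrable _ _ _ _ 1) => // t _; rewrite normr1.
- exact: integrable_sin2.
Qed.

End ByParts.

(** * Fatou's theorem *)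

Section Fatou.
Variable R : realType.
Variable f : R[i] -> R[i].
Hypothesis hf : forall z : R[i], 0 < Im z -> exists l, cdiff f z l.
Variable B : R.
Hypothesis fB : forall z : R[i], 0 < Im z -> `|Re (f z)| <= B.
Implicit Types (x y : R).

Let I : set R := `]- (pi / 2), pi / 2[.
Let mI : measurable I. Proof. exact: measurable_itv. Qed.

Let B0 : 0 <= B.
Proof. by apply: (le_trans (normr_ge0 _) (fB (z := 0 +i* 1) _)); rewrite /= ltr01. Qed.

Let Phi := bdry_prim f.

Let slope x y t := (Phi (x + y * tan t) - Phi x) / y.

Let continuous_Phi : continuous Phi.
Proof.
move=> x; apply/cvgrPdist_lt => e e0.
have B1 : 0 < B + 1 by rewrite ltr_wpDl.
apply/nbhs_normP; exists (e / (B + 1)) => [|y]; first by rewrite /= divr_gt0.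
move=> xyc; have : `|x - y| < e / (B + 1) by [].
rewrite ltr_pdivlMr// mulrC; apply: le_lt_trans.
apply: le_trans (bdry_prim_lip hf fB y x) _.
by rewrite ler_wpM2r// lerDl.
Qed.

Let slopeB x y t : 0 < y -> `|slope x y t| <= B * `|tan t|.
Proof.
move=> y0; rewrite normrM normfV (gtr0_norm y0) ler_pdivrMr//.
apply: le_trans (bdry_prim_lip hf fB _ _) _.
by rewrite [x + _]addrC addrK normrM (gtr0_norm y0) [y * _]mulrC mulrA.
Qed.

Let measurable_slope (P : R -> R) x y : continuous P ->
  measurable_fun I (fun t => 2 * sin t * cos t * ((P (x + y * tan t) - P x) / y)).
Proof.
move=> cP; apply: open_itv_measurable => t tI.
have c0 : cos t != 0 by exact: cos_angle_neq0.
apply: cvgM.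
  apply: cvgM; last exact: continuous_cos.
  by apply: cvgM; [exact: cvg_cst|exact: continuous_sin].
apply: cvgM; last exact: cvg_cst.
apply: cvgB; last exact: cvg_cst.
apply: (@continuous_comp _ _ _ (fun t => x + y * tan t) P); last exact: cP.
exact: is_derive_cont (is_derive_affine x y (is_derive_tan c0)).
Qed.

Let integrable_cst (C : R) : mu.-integrable I (EFin \o cst C).
Proof. by apply: (@bounded_integrable _ _ _ _ `|C|) => //; exact: measurable_cst. Qed.

(** Poisson's formula after integration by parts holds for the limit function,
    because the difference quotients converge boundedly; it involves the boundary
    values only through their primitive [Phi]. *)
Lemma Re_slope x y : 0 < y -> pi * Re (f (x +i* y)) =
  \int[mu]_(t in I) (2 * sin t * cos t * slope x y t).
Proof.
move=> y0; pose e n : R := n.+1%:R^-1.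
have e0 n : 0 < e n by rewrite invr_gt0.
have E n : pi * Re_line f (e n + y) x = \int[mu]_(t in I)
    (2 * sin t * cos t * ((prim (Re_line f (e n)) (x + y * tan t) -
       prim (Re_line f (e n)) x) / y)).
  rewrite -(angle_by_parts (B := B))//.
  - by rewrite /I (Poisson_angle hf fB x y0 (e0 n)) addrC.
  - exact: continuous_Re_line.
  - by move=> t; exact: Re_line_bound.
have lim1 : pi * Re_line f (e n + y) x @[n --> \oo] --> pi * Re (f (x +i* y)).
  apply: cvgM; first exact: cvg_cst.
  have [l hl] := hf (y0 : 0 < Im (x +i* y)).
  apply: (ccontinuous_seq (w_ := fun n => x +i* (e n + y)) (cdiff_ccontinuous hl)).
  rewrite (_ : (fun n => _) = e); first exact: cvg_harmonic.
  apply/funext => n; rewrite (_ : _ - _ = (e n)%:C * 'i); last first.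
    by apply: complex_eqP; rewrite !(ReD, ImD, ReN, ImN, ReM, ImM) /=; ring.
  by rewrite cmodM cmod_real cmod_i mulr1 gtr0_norm.
have lim2 : pi * Re_line f (e n + y) x @[n --> \oo] -->
    \int[mu]_(t in I) (2 * sin t * cos t * slope x y t).
  under eq_fun do rewrite E.
  apply: (@Rintegral_dct _ _ _ _ (cst (2 * B))) => //.
  - by move=> n; apply: measurable_slope; apply: continuous_prim; exact: continuous_Re_line.
  - exact: measurable_slope.
  - move=> t _; apply: cvgM; first exact: cvg_cst.
    apply: cvgM; last exact: cvg_cst.
    by apply: cvgB; exact: (cvg_prim_line hf fB).
  - move=> n t tI; apply: (proj1 (slope_bound B0 tI _)).
    rewrite normrM normfV (gtr0_norm y0) ler_pdivrMr//.
    apply: le_trans (prim_lip _ _ (continuous_Re_line hf (e0 n))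
      (fun t => Re_line_bound fB t (e0 n))) _.
    by rewrite [x + _]addrC addrK normrM (gtr0_norm y0) [y * _]mulrC mulrA.
exact: (cvg_unique _ lim1 lim2).
Qed.

(** As [y] tends to 0 the slopes tend to [tan t] times the derivative of [Phi],
    under the bound by the Lipschitz constant; the weight [2 sin t ^ 2] has
    integral [pi], so the limit is that derivative. *)
Lemma Re_bdry_cvg_derivable x : derivable Phi x 1 ->
  cvg (Re (f (x +i* y)) @[y --> (0 : R)^'+]).
Proof.
move=> /derivableP dP; set L := 'D_1 Phi x in dP; apply/cvg_ex; exists L.
apply/cvg_at_rightP => y_ [y0 ylim].
have pi0 : pi != 0 :> R by rewrite gt_eqF// pi_gt0.
have -> : L = pi^-1 * \int[mu]_(t in I) (2 * sin t * cos t * (L * tan t)).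
  transitivity (pi^-1 * \int[mu]_(t in I) (L * (2 * sin t ^+ 2))).
    rewrite RintegralZl//.
      by rewrite integral_sin2 mulrCA mulVf ?mulr1.
    exact: integrable_sin2.
  congr (_ * _); apply: eq_Rintegral => t; rewrite inE => tI.
  have c0 : cos t != 0 by exact: cos_angle_neq0.
  by rewrite /tan; field.
have E n : Re (f (x +i* y_ n)) =
    pi^-1 * \int[mu]_(t in I) (2 * sin t * cos t * slope x (y_ n) t).
  by rewrite -Re_slope// mulKf.
under eq_fun do rewrite E.
apply: cvgM; first exact: cvg_cst.
apply: (@Rintegral_dct _ _ _ _ (cst (2 * B))) => //.
- by move=> n; exact: measurable_slope.
- apply: open_itv_measurable => t tI; have c0 : cos t != 0 by exact: cos_angle_neq0.
  apply: cvgM.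
    apply: cvgM; last exact: continuous_cos.
    by apply: cvgM; [exact: cvg_cst|exact: continuous_sin].
  by apply: cvgM; [exact: cvg_cst|exact: continuous_tan].
- move=> t tI; apply: cvgM; first exact: cvg_cst.
  apply/cvgrPdist_le => e e0.
  have T0 : 0 < `|tan t| + 1 by rewrite ltr_wpDl.
  have [d d0 dE] := is_derive_remainder dP (divr_gt0 e0 T0).
  have nd : \forall n \near \oo, `|y_ n| < d / (`|tan t| + 1).
    by apply: cvgr0_norm_lt => //; exact: divr_gt0.
  apply: filterS nd => n.
  rewrite (gtr0_norm (y0 n)) ltr_pdivlMr// => yd.
  have hd : `|y_ n * tan t| < d.
    rewrite (normrM (y_ n) (tan t)) (gtr0_norm (y0 n)); apply: le_lt_trans yd.
    by rewrite ler_pM2l// lerDl.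
  have := dE _ hd; rewrite (normrM (y_ n) (tan t)) (gtr0_norm (y0 n)) => h.
  rewrite distrC (_ : _ - _ = (Phi (x + y_ n * tan t) - Phi x - L * (y_ n * tan t)) / y_ n).
    rewrite normrM normfV (gtr0_norm (y0 n)) ler_pdivrMr//; apply: le_trans h _.
    rewrite mulrAC ler_pdivrMr// -mulrA ler_pM2l// ler_pM2l// lerDl//.
  by rewrite /slope; field; rewrite gt_eqF.
- by move=> n t tI; apply: (proj1 (slope_bound B0 tI _)); exact: slopeB.
Qed.

(** Fatou's theorem, for limits along the normal: the primitive [Phi] is Lipschitz,
    hence differentiable almost everywhere. *)
Lemma Re_bdry_cvg_ae : {ae mu, forall x, cvg (Re (f (x +i* y)) @[y --> (0 : R)^'+])}.
Proof.
have /lip_ae_derivable : forall x y, x <= y -> `|Phi y - Phi x| <= B * (y - x).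
  move=> x y xy; apply: le_trans (bdry_prim_lip hf fB x y) _.
  by rewrite ger0_norm ?subr_ge0.
apply: filterS; first exact: (ae_filter_ringOfSetsType mu).
exact: Re_bdry_cvg_derivable.
Qed.

End Fatou.

(** * The estimate by the boundary norm *)

Section MaximumPrinciple.
Variable R : realType.
Variable f : R[i] -> R[i].
Hypothesis hf : forall z : R[i], 0 < Im z -> exists l, cdiff f z l.
Variable B : R.
Hypothesis fB : forall z : R[i], 0 < Im z -> `|Re (f z)| <= B.
Implicit Types (z : R[i]) (t : R).

Let B0 : 0 <= B.
Proof. by apply: (le_trans (normr_ge0 _) (fB (z := 0 +i* 1) _)); rewrite /= ltr01. Qed.

Lemma Re_bdry_norm_fin : exists2 M : R, 0 <= M & Re_bdry_norm f = M%:E.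
Proof.
have h1 := Re_bdry_norm_le fB.
have h0 : (0 <= Re_bdry_norm f)%E.
  by rewrite Re_bdry_normE; apply: ess_sup_gee; [exact: lebesgue_setT_gt0|apply: aeW => x; rewrite lee_fin].
have fin : Re_bdry_norm f \is a fin_num.
  by rewrite ge0_fin_numE//; apply: le_lt_trans h1 _; rewrite ltry.
by exists (fine (Re_bdry_norm f)); [exact: fine_ge0|rewrite fineK].
Qed.

(** The lines approaching the boundary satisfy Poisson's formula, and along them
    the excess over the boundary norm tends to 0 almost everywhere.  Dominated
    convergence is applied to the excess because its limit is plainly measurable,
    unlike the boundary values. *)
Lemma Re_le_bdry_norm z : 0 < Im z -> (`|Re (f z)|%:E <= Re_bdry_norm f)%E.
Proof.
move=> z0; have [M M0 ME] := Re_bdry_norm_fin; rewrite ME lee_fin.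
pose e n : R := n.+1%:R^-1.
have e0 n : 0 < e n by rewrite invr_gt0.
pose sg n t := Re_line f (e n) t.
pose h n t := Num.max (`|sg n t| - M) 0.
pose P t := Im (kern 0 z t).
have [_ cP] := ccts_kern 0 z0.
have mP : measurable_fun setT P by exact: continuous_measurable_fun.
have P0 t : 0 <= P t by rewrite /P Im_kern0 Im_resolvent_ge0.
have [C hC] := kern_bound 0 z0.
have PC t : `|P t| <= C / (1 + t ^+ 2) := le_trans (Im_le_cmod _) (hC t).
have iP (k : R -> R) (D : R) : measurable_fun setT k -> (forall t, `|k t| <= D) ->
    mu.-integrable setT (EFin \o (fun t => k t * P t)).
  move=> mk kD; apply: (@integrable_le_oneDsqrV _ _ (D * C)).
    exact: measurable_funM.
  by move=> t; rewrite normrM -mulrA ler_pM.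
have msg n : measurable_fun setT (sg n) by exact: measurable_Re_line.
have sgB n t : `|sg n t| <= B by exact: Re_line_bound.
have mh n : measurable_fun setT (h n).
  apply: (@measurable_maxr _ _ _ _ (fun t => `|sg n t| - M) (cst 0)); last exact: measurable_cst.
  by apply: measurable_funB; [exact: measurableT_comp|exact: measurable_cst].
have h0 n t : 0 <= h n t by rewrite le_max lexx orbT.
have hB n t : `|h n t| <= B.
  rewrite ger0_norm// ge_max B0 andbT.
  by rewrite lerBlDr (le_trans (sgB n t))// lerDl.
have intP : \int[mu]_t (cst M t * P t) = M * pi.
  have cM : continuous (cst M : R -> R) by move=> t; exact: cvg_cst.
  rewrite (@Rintegral_poisson _ (cst M) M z z0 cM); last by move=> t; rewrite ger0_norm.
  rewrite Rintegral_cst//= lebesgue_measure_itv/= lte_fin.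
  have p0 := pi_gt0 R; have -> : - (pi / 2) < pi / 2 :> R by lra.
  by congr (_ * _); rewrite /=; field.
have pi0 := pi_gt0 R.
have key n : `|Re (f (z + (0 +i* e n)))| <= M + pi^-1 * \int[mu]_t (h n t * P t).
  rewrite -(Re_poisson_line hf fB (e0 n) z0) (Re_poisson (msg n) (sgB n) z0).
  rewrite normrM gtr0_norm ?invr_gt0//.
  have -> : M = pi^-1 * (M * pi) by rewrite mulrCA mulVf ?mulr1// gt_eqF.
  rewrite -mulrDr ler_pM2l ?invr_gt0// -intP.
  have i1 : mu.-integrable setT (EFin \o (fun t => cst M t * P t)).
    by apply: (iP _ M) => // t; rewrite ger0_norm.
  have i2 : mu.-integrable setT (EFin \o (fun t => h n t * P t)) by exact: (iP _ B).
  rewrite -RintegralD//.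
  apply: (@le_trans _ _ (\int[mu]_t `|sg n t * P t|)).
    by apply: le_normr_Rintegral => //; exact: (iP _ B).
  apply: le_Rintegral => //.
  - by apply: integrable_norm; exact: (iP _ B).
  - have -> : (fun t => cst M t * P t + h n t * P t) = (fun t => (M + h n t) * P t).
      by apply/funext => t; rewrite mulrDl.
    apply: (iP _ (M + B)); first exact: measurable_funD.
    by move=> t; apply: le_trans (ler_normD _ _) _; rewrite (ger0_norm M0) lerD2l.
  - move=> t _; rewrite normrM (ger0_norm (P0 t)) -mulrDl ler_wpM2r//.
    by rewrite -lerBlDl le_max lexx.
have hlim : \int[mu]_t (h n t * P t) @[n --> \oo] --> (0 : R).
  have -> : 0 = \int[mu]_t cst (0 : R) t :> R by rewrite Rintegral_cst//= mul0r.
  apply: (@Rintegral_dct_ae _ _ _ _ (fun t => B * P t)) => //.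
  - by move=> n; exact: measurable_funM.
  - have ae1 : \forall t \ae mu, (`|Re_bdry f t|%:E <= M%:E)%E.
      by rewrite -ME Re_bdry_normE; exact: ess_sup_ge.
    have ae2 := Re_bdry_cvg_ae hf fB.
    have step t : (`|Re_bdry f t|%:E <= M%:E)%E ->
        cvg (Re (f (t +i* y)) @[y --> (0 : R)^'+]) ->
        setT t -> h n t * P t @[n --> \oo] --> cst (0 : R) t.
      rewrite lee_fin => LM ct _.
      have sL : sg n t @[n --> \oo] --> Re_bdry f t.
        by apply: (proj1 (cvg_at_rightP _ _ _) ct); split => //; exact: cvg_harmonic.
      rewrite [cst 0 t](_ : _ = 0 * P t); last by rewrite mul0r.
      apply: cvgM; last exact: cvg_cst.
      apply/cvgrPdist_le => d d0.
      have nn : \forall n \near \oo, `|sg n t| <= M + d.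
        by apply: (cvgr_norm_le _ sL); apply: le_lt_trans LM _; rewrite ltrDl.
      apply: filterS nn => n sM; rewrite sub0r normrN (ger0_norm (h0 n t)).
      by rewrite ge_max (ltW d0) andbT lerBlDl.
    exact: (@filterS2 _ _ (ae_filter_ringOfSetsType mu) _ _ _ step ae1 ae2).
  - by apply: (iP (cst B) B) => // t; rewrite ger0_norm.
  - by move=> n t _; rewrite normrM (ger0_norm (P0 t)) ler_wpM2r.
have lim1 : `|Re (f (z + (0 +i* e n)))| @[n --> \oo] --> `|Re (f z)|.
  apply: cvg_norm; have [l hl] := hf z0.
  apply: (ccontinuous_seq (w_ := fun n => z + (0 +i* e n)) (cdiff_ccontinuous hl)).
  rewrite (_ : (fun n => _) = e); first exact: cvg_harmonic.
  apply/funext => n; rewrite (_ : _ - _ = (e n)%:C * 'i); last first.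
    by apply: complex_eqP; rewrite !(ReD, ImD, ReN, ImN, ReM, ImM) /=; ring.
  by rewrite cmodM cmod_real cmod_i mulr1 gtr0_norm.
have lim2 : M + pi^-1 * \int[mu]_t (h n t * P t) @[n --> \oo] --> M.
  rewrite -[X in _ --> X]addr0; apply: cvgD; first exact: cvg_cst.
  by rewrite -(mulr0 pi^-1); apply: cvgM; first exact: cvg_cst.
rewrite -(cvg_lim (@Rhausdorff R) lim1) -(cvg_lim (@Rhausdorff R) lim2).
apply: ler_lim; [exact: (cvgP _ lim1)|exact: (cvgP _ lim2)|exact: nearW].
Qed.

End MaximumPrinciple.

Section HalfPlaneEstimate.
Variable R : realType.

(** The boundary norm bounds the real part in the whole half-plane. *)
Lemma half_plane_estimate_K s : (0 < s)%N -> half_plane_estimate s (K R s).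
Proof.
move=> s0 f [_ df] [B fB] z z0.
have hf w : 0 < Im w -> exists l, cdiff f w l.
  by move=> w0; exists (derive1 f w); apply: derivable_cdiff; exact: df.
have [M M0 ME] := Re_bdry_norm_fin fB.
rewrite ME -EFinM lee_fin mulrAC.
apply: half_plane_sup_estimate => // w w0.
by have := Re_le_bdry_norm hf fB w0; rewrite ME lee_fin.
Qed.

End HalfPlaneEstimate.

(** * The kernel integral as a sum over zeros *)

Section KernelZeros.
Variable R : realType.
Implicit Types (a b t x y : R).

Lemma cosD_npi x m : cos (x + m%:R * pi) = (-1) ^+ m * cos x.
Proof.
elim: m => [|m IH]; first by rewrite mul0r addr0 mul1r.
by rewrite -addn1 natrD mulrDl mul1r addrA cosDpi IH exprD expr1 mulrN1 mulNr.
Qed.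

Lemma sinD_npi x m : sin (x + m%:R * pi) = (-1) ^+ m * sin x.
Proof.
by rewrite -!cosBpihalf addrAC cosD_npi.
Qed.

Section Degree.
Variables (s : nat) (a : R).

Let n : R := s.+2%:R.
Let g x := cos (a + n * x) * cos x ^+ s.
(** A primitive of [g]: the product rule yields the addition formula for
    [cos ((a + s.+1 x) + x)]. *)
Let G x := s.+1%:R^-1 * (sin (a + s.+1%:R * x) * cos x ^+ s.+1).

Let dG x : is_derive x 1 G (g x).
Proof.
have h1 := @is_derive1_comp R (@sin R) (fun x => a + s.+1%:R * x) x _ _
  (is_derive_sin (a + s.+1%:R * x)) (is_derive_affine a s.+1%:R (is_derive_id x 1)).
have h2 := is_deriveX s.+1 (is_derive_cos x); rewrite exprfctE in h2.
have h3 := is_deriveZ (s.+1%:R^-1) (is_deriveM h1 h2).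
apply: (is_derive_eq h3); rewrite /GRing.scale /= /g.
have -> : a + n * x = (a + s.+1%:R * x) + x by rewrite /n -[in LHS]natr1; ring.
rewrite (cosD (a + s.+1%:R * x) x); have s0 : s.+1%:R != 0 :> R by rewrite pnatr_eq0.
rewrite exprS; move: (cos x ^+ s) => c.
by field.
Qed.

Let piece m u v : u <= v ->
  (forall x, u <= x <= v -> 0 <= (-1) ^+ m * cos (a + n * x) /\ 0 <= cos x) ->
  \int[mu]_(x in `[u, v]) (`|cos (a + n * x)| * cos x ^+ s) = (-1) ^+ m * (G v - G u).
Proof.
rewrite le_eqVlt => /predU1P[->|uv] H.
  by rewrite set_itv1 Rintegral_set1 subrr mulr0.
have cg : continuous g.
  move=> x; apply: cvgM.
    apply: (@continuous_comp _ _ _ (fun x => a + n * x) (@cos R)); last exact: continuous_cos.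
    exact: is_derive_cont (is_derive_affine a n (is_derive_id x 1)).
  by apply: (@continuous_comp _ _ _ (@cos R) (fun u => u ^+ s)); [exact: continuous_cos|exact: exprn_continuous].
have dH x : is_derive x 1 (fun x => (-1) ^+ m * G x) ((-1) ^+ m * g x).
  exact: is_deriveZ.
have E : \int[mu]_(x in `[u, v]) (`|cos (a + n * x)| * cos x ^+ s) =
    \int[mu]_(x in `[u, v]) ((-1) ^+ m * g x).
  apply: eq_Rintegral => x; rewrite inE /= in_itv /= => /H[h1 h2].
  rewrite /g mulrA; congr (_ * _); rewrite -[RHS]ger0_norm//.
  by rewrite normrM normrX normrN1 expr1n mul1r.
rewrite E /Rintegral (@continuous_FTC2 _ (fun x => (-1) ^+ m * g x)
  (fun x => (-1) ^+ m * G x))//; first by rewrite /= mulrBr.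
- apply: continuous_subspaceT => x; apply: cvgM; [exact: cvg_cst|exact: cg].
- split.
  + by move=> x _; have [] := dH x.
  + by apply: cvg_at_right_filter; exact: is_derive_cont (dH _).
  + by apply: cvg_at_left_filter; exact: is_derive_cont (dH _).
- by move=> x _; rewrite derive1E; have [] := dH x.
Qed.

Variable th : R.
Hypothesis aE : a = - (pi / 2) - n * th.
Hypothesis th_itv : - (pi / 2) <= th <= - (pi / 2) + pi / n.

Let n_gt0 : 0 < n. Proof. by rewrite /n ltr0n. Qed.

(** The zeros of the cosine in the interval, [ph 0] up to [ph s.+1]. *)
Let ph (j : nat) := th + j%:R * (pi / n).

Let phS j : ph j.+1 = ph j + pi / n.
Proof. by rewrite /ph -natr1; ring. Qed.

Let sign_between j y : 0 <= y <= pi / n -> 0 <= (-1) ^+ j * cos (a + n * (ph j + y)).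
Proof.
move=> /andP[y0 y1]; have n0 : n != 0 by rewrite gt_eqF.
have -> : a + n * (ph j + y) = (n * y - pi / 2) + j%:R * pi.
  by rewrite aE /ph; field.
rewrite cosD_npi mulrA -exprMn mulrNN mulr1 expr1n mul1r cosBpihalf.
apply: sin_ge0_pi; apply/andP; split; first by rewrite mulr_ge0// ltW.
by rewrite mulrC -ler_pdivlMr.
Qed.

(** At a zero the sine in [G] is the cosine of the zero up to sign, so one more
    factor appears. *)
Let G_ph j : G (ph j) = - ((-1) ^+ j * (s.+1%:R^-1 * cos (ph j) ^+ s.+2)).
Proof.
rewrite /G; have n0 : n != 0 by rewrite gt_eqF.
have -> : a + s.+1%:R * ph j = (- ph j - pi / 2) + j%:R * pi.
  have -> : s.+1%:R = n - 1 by rewrite /n -[in RHS]natr1 addrK.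
  by rewrite aE /ph; field.
by rewrite sinD_npi sinBpihalf cosN [cos (ph j) ^+ s.+2]exprS; ring.
Qed.

Let ph_ge j : - (pi / 2) <= ph j.
Proof.
have /andP[h _] := th_itv; apply: le_trans h _; rewrite lerDl.
by rewrite mulr_ge0// divr_ge0 ?pi_ge0// ltW.
Qed.

Let ph_le j : (j <= s.+1)%N -> ph j <= pi / 2.
Proof.
move=> js; have /andP[_ h] := th_itv.
have n0 : n != 0 by rewrite gt_eqF.
have jn : j%:R * (pi / n) <= (n - 1) * (pi / n).
  rewrite ler_wpM2r ?divr_ge0 ?pi_ge0 ?(ltW n_gt0)//.
  by rewrite lerBrDr natr1 ler_nat.
have E : (n - 1) * (pi / n) = pi - pi / n by field.
apply: le_trans (lerD h jn) _; rewrite E le_eqVlt; apply/orP; left; apply/eqP.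
by field.
Qed.

Let cos_ge0 x : - (pi / 2) <= x <= pi / 2 -> 0 <= cos x.
Proof. exact: cos_ge0_pihalf. Qed.

Let h x := `|cos (a + n * x)| * cos x ^+ s.

Let ch : continuous h.
Proof. exact: (@K_integrand_continuous R s.+1 a). Qed.

Let C j := s.+1%:R^-1 * cos (ph j) ^+ s.+2.

(** Between consecutive zeros the integrand keeps its sign, and the two end values
    of the primitive, of opposite signs, add up. *)
Let sum_upto j : (j <= s.+1)%N ->
  \int[mu]_(x in `[- (pi / 2), ph j]) h x = 2 * (\sum_(i < j) C i) + C j.
Proof.
elim: j => [_|j IH js].
  rewrite big_ord0 mulr0 add0r (@piece 1 _ _ (ph_ge 0)).
    rewrite G_ph expr1 expr0 mul1r /G cosN cos_pihalf expr0n/= !mulr0 subr0.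
    by rewrite mulN1r opprK.
  move=> x /andP[x1 x2]; split; last first.
    by apply: cos_ge0; rewrite x1 (le_trans x2 (ph_le _)).
  have -> : a + n * x = - (n * (th - x)) - pi / 2 by rewrite aE; ring.
  rewrite expr1 cosBpihalf sinN mulN1r opprK; apply: sin_ge0_pi.
  have /andP[_ t2] := th_itv; rewrite /ph mul0r addr0 in x2.
  rewrite mulr_ge0 ?subr_ge0 ?(ltW n_gt0)//= mulrC -ler_pdivlMr//.
  by rewrite lerBlDl (le_trans t2)// lerD2r.
have p0 : 0 <= pi / n by rewrite divr_ge0 ?pi_ge0// ltW.
have pS : ph j <= ph j.+1 by rewrite phS lerDl.
rewrite (@Rintegral_segment_split _ h _ (ph j) _ (ph_ge j) pS); last by move=> x _; exact: ch.
rewrite IH ?(ltnW js)// (@piece j _ _ pS).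
  rewrite !G_ph big_ord_recr /= -/(C j) -/(C j.+1) exprS.
  have E : (-1) ^+ j * (-1) ^+ j = 1 :> R by rewrite -exprMn mulrNN mulr1 expr1n.
  transitivity (2 * (\sum_(i < j) C i) + C j + (((-1) ^+ j * (-1) ^+ j) * (C j.+1 + C j))).
    by ring.
  by rewrite E; ring.
move=> x /andP[x1 x2]; split; last first.
  by apply: cos_ge0; rewrite (le_trans (ph_ge j) x1) (le_trans x2 (ph_le js)).
rewrite (_ : x = ph j + (x - ph j)); last by ring.
by apply: sign_between; rewrite subr_ge0 x1 lerBlDl -phS.
Qed.

Lemma K_integral_zeros : K_integral s.+1 a =
  2 / s.+1%:R * \sum_(j < s.+2) cos (th + j%:R * (pi / n)) ^+ s.+2.
Proof.
have pl := ph_le (leqnn s.+1).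
rewrite /K_integral (@Rintegral_segment_split _ h _ _ _ (ph_ge s.+1) pl); last first.
  by move=> x _; exact: ch.
rewrite sum_upto// (@piece s.+1 _ _ pl).
  rewrite G_ph /G cos_pihalf expr0n/= !mulr0 add0r opprK -/(C s.+1).
  have E : (-1) ^+ s.+1 * (-1) ^+ s.+1 = 1 :> R by rewrite -exprMn mulrNN mulr1 expr1n.
  rewrite mulrA E mul1r; transitivity (2 * \sum_(j < s.+2) C j).
    by rewrite [in RHS]big_ord_recr /=; ring.
  by rewrite /C -mulr_sumr mulrA.
move=> x /andP[x1 x2]; split; last first.
  by apply: cos_ge0; rewrite x2 (le_trans (ph_ge s.+1) x1).
rewrite (_ : x = ph s.+1 + (x - ph s.+1)); last by ring.
apply: sign_between; rewrite subr_ge0 x1/= lerBlDl -phS; apply: le_trans x2 _.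
have /andP[hh _] := th_itv; rewrite /ph; have n0 : n != 0 by rewrite gt_eqF.
have -> : s.+2%:R * (pi / n) = pi by rewrite -/n; field.
by rewrite -lerBlDr (_ : pi / 2 - pi = - (pi / 2))//; field.
Qed.

End Degree.

Section Maximum.
Variable s : nat.
Let n : R := s.+2%:R.

Let n_gt0 : 0 < n. Proof. by rewrite /n ltr0n. Qed.

Definition zero_sum (th : R) : R :=
  \sum_(j < s.+2) cos (th + j%:R * (pi / s.+2%:R)) ^+ s.+2.

(** The admissible positions of the smallest zero; exactly one spacing wide, so
    that every phase occurs. *)
Definition first_zero (th : R) : bool :=
  - (pi / 2) <= th <= - (pi / 2) + pi / s.+2%:R.

Lemma norm_cosD_pi x (k : int) : `|cos (x + k%:~R * pi)| = `|cos x|.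
Proof.
have H m y : `|cos (y + m%:R * pi)| = `|cos y|.
  by rewrite cosD_npi normrM normrX normrN1 expr1n mul1r.
case: k => m; first exact: H.
by rewrite NegzE mulrNz mulNr -[in RHS](subrK (m.+1%:R * pi) x) H.
Qed.

Lemma K_integral_first_zero a : exists2 th, first_zero th &
  K_integral s.+1 a = K_integral s.+1 (- (pi / 2) - n * th).
Proof.
have pi0 := pi_gt0 R; have n0 : n != 0 by rewrite gt_eqF.
pose c := - (n * (pi / 2)); pose b := - a - pi / 2.
pose k := Num.floor ((b - c) / pi).
have /andP[k1 k2] := floor_itv ((b - c) / pi).
rewrite ler_pdivlMr// lerBrDl -lerBrDr in k1.
rewrite ltr_pdivrMr// intrD mulrDl mul1r ltrBlDl addrCA -ltrBlDl in k2.
exists ((b - k%:~R * pi) / n).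
  apply/andP; split.
    rewrite ler_pdivlMr// mulNr mulrC -/c; move: k1; rewrite -/k; lra.
  rewrite ler_pdivrMr// mulrDl mulNr divfK// [_ * n]mulrC -/c.
  move: k2; rewrite -/k; lra.
apply: eq_Rintegral => t _; congr (_ * _).
have -> : - (pi / 2) - n * ((b - k%:~R * pi) / n) + s.+2%:R * t = (a + s.+2%:R * t) + k%:~R * pi.
  by rewrite /b; field.
by rewrite norm_cosD_pi.
Qed.

Lemma K_integral_zero_sum th : first_zero th ->
  K_integral s.+1 (- (pi / 2) - n * th) = 2 / s.+1%:R * zero_sum th.
Proof. by move=> h; exact: (K_integral_zeros (th := th)). Qed.

(** On the compact interval of the first zero the sum is continuous. *)
Lemma K_integral_max : exists a0, forall a, K_integral s.+1 a <= K_integral s.+1 a0 :> R.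
Proof.
have cz : continuous zero_sum.
  apply: continuous_big => [|j _ th]; first exact: add_continuous.
  apply: (@continuous_comp _ _ _ (fun th : R => cos (th + j%:R * (pi / s.+2%:R)))
    (fun u => u ^+ s.+2)); last exact: exprn_continuous.
  apply: (@continuous_comp _ _ _ (fun th : R => th + j%:R * (pi / s.+2%:R)) (@cos R)).
    by apply: cvgD; [exact: cvg_id|exact: cvg_cst].
  exact: continuous_cos.
have le : - (pi / 2) <= - (pi / 2) + pi / s.+2%:R :> R.
  by rewrite lerDl divr_ge0 ?pi_ge0.
have [c cI cmax] := EVT_max le (continuous_subspaceT cz).
rewrite in_itv in cI.
exists (- (pi / 2) - n * c) => a; have [th thI ->] := K_integral_first_zero a.
rewrite !K_integral_zero_sum// ler_wpM2l ?divr_ge0//.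
by apply: cmax; rewrite in_itv.
Qed.

Lemma K_zero_sum v : (forall th, first_zero th -> zero_sum th <= v) ->
  (exists2 th, first_zero th & zero_sum th = v) ->
  K R s.+1 = s.+1`!%:R / pi * (2 / s.+1%:R * v).
Proof.
move=> vmax [th0 th0I th0v]; rewrite /K; congr (_ * _).
apply/eqP; rewrite eq_le; apply/andP; split.
  apply: sup_le_ub; first by exists (K_integral s.+1 0); exists 0.
  move=> _ [a _ <-]; have [th thI ->] := K_integral_first_zero a.
  by rewrite K_integral_zero_sum// ler_wpM2l ?divr_ge0// vmax.
by rewrite -th0v -K_integral_zero_sum//; exact: K_integral_sup.
Qed.

End Maximum.

End KernelZeros.

(** * The constants of odd order *)

Section OddOrder.
Variable R : realType.
Implicit Types (th x : R).

Lemma sum_root_of_unity (q : R[i]) N : q ^+ N = 1 -> q != 1 -> \sum_(j < N) q ^+ j = 0.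
Proof.
move=> qN q1; have := subrX1 q N; rewrite qN subrr => /esym/eqP.
by rewrite mulf_eq0 subr_eq0 (negPf q1) => /eqP.
Qed.

Lemma cos_expi x : (cos x)%:C = (expi x%:C + (expi x%:C)^-1) / 2 :> R[i].
Proof.
rewrite -expiN -rmorphN !expi_real cosN sinN.
rewrite (_ : _ + _ = 2 * (cos x)%:C); first by rewrite mulrAC divff ?mul1r// pnatr_eq0.
by apply: complex_eqP; rewrite !(ReD, ImD, ReM, ImM) /=; ring.
Qed.

(** Used to see which products of roots of unity are trivial. *)
Lemma cos_angle_eqN1 k m : (k <= m.*2)%N -> (0 < m)%N ->
  cos (k%:R * (pi / m%:R)) = -1 :> R -> k = m.
Proof.
have H j : (j <= m)%N -> (0 < m)%N -> cos (j%:R * (pi / m%:R)) = -1 :> R -> j = m.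
  move=> jm m0; rewrite -cospi => E; have pi0 := pi_gt0 R.
  have m0' : (m%:R : R) != 0 by rewrite pnatr_eq0 -lt0n.
  have jr : (j%:R * (pi / m%:R) : R) \in `[0, pi].
    rewrite in_itv /= mulr_ge0 ?divr_ge0 ?pi_ge0//= mulrA ler_pdivrMr ?ltr0n//.
    by rewrite mulrC ler_pM2l// ler_nat.
  have piI : (pi : R) \in `[0, pi] by rewrite in_itv /= lexx pi_ge0.
  have E' := cos_inj jr piI E; apply/eqP; rewrite -(eqr_nat R); apply/eqP.
  have p0 : (pi : R) != 0 by rewrite gt_eqF.
  transitivity (j%:R * (pi / m%:R) * (m%:R / pi) : R); last first.
    by rewrite E' mulrCA divff ?mulr1.
  by rewrite -mulrA [X in _ * X]mulrA divfK// divff// mulr1.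
move=> km m0 E; have [|mk] := leqP k m; first by move=> km'; exact: H.
have E2 : cos ((m.*2 - k)%:R * (pi / m%:R)) = -1 :> R.
  have m0' : (m%:R : R) != 0 by rewrite pnatr_eq0 -lt0n.
  rewrite natrB// (_ : _ * _ = - (k%:R * (pi / m%:R)) + pi *+ 2).
    by rewrite cosD2pi cosN.
  by rewrite -mul2n natrM mulr2n; field.
have h : (m.*2 - k <= m)%N by rewrite leq_subLR -addnn leq_add2r ltnW.
have := H _ h m0 E2; rewrite -addnn; lia.
Qed.

Lemma odd_dfact_fact l : (l.+1.*2)`! = (2 ^ l.+1 * l.+1`! * odd_dfact l)%N.
Proof.
elim: l => [|l IH]; first by rewrite /odd_dfact big_ord1.
have -> : odd_dfact l.+1 = (odd_dfact l * l.+1.*2.+1)%N by rewrite /odd_dfact big_ord_recr.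
rewrite doubleS (factS l.+1.*2.+1) (factS l.+1.*2) IH (factS l.+1) (expnS 2 l.+1).
by rewrite -!muln2; ring.
Qed.

Lemma central_bin_odd_dfact l :
  ((l.+1.*2)`! * 'C(l.+1.*2, l.+1) = 2 ^ l.+1.*2 * odd_dfact l ^ 2)%N.
Proof.
have h : ('C(l.+1.*2, l.+1) * l.+1`! = 2 ^ l.+1 * odd_dfact l)%N.
  apply/eqP; rewrite -(eqn_pmul2r (fact_gt0 l.+1)); apply/eqP.
  have mm : (l.+1.*2 - l.+1 = l.+1)%N by rewrite -addnn addnK.
  have le : (l.+1 <= l.+1.*2)%N by rewrite -addnn leq_addr.
  have := bin_fact le; rewrite mm odd_dfact_fact => E.
  by rewrite -mulnA E; ring.
rewrite odd_dfact_fact.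
transitivity (2 ^ l.+1 * odd_dfact l * ('C(l.+1.*2, l.+1) * l.+1`!))%N; first by ring.
by rewrite h -addnn expnD; ring.
Qed.

(** Expanding the cosines in exponentials, each frequency sums to 0 over the
    equally spaced zeros except the frequency 0, which carries the central
    binomial coefficient. *)
Lemma zero_sum_even l th : zero_sum l.*2 th =
  l.*2.+2%:R * 'C(l.*2.+2, l.+1)%:R / 2 ^+ l.*2.+2.
Proof.
set N := l.*2.+2; pose m := l.+1.
have Nm : N = m.*2 by [].
pose v := expi (pi / N%:R : R)%:C; pose w := expi th%:C.
have v0 : v != 0 by exact: expi_neq0.
have w0 : w != 0 by exact: expi_neq0.
have vN : v ^+ N = -1.
  rewrite /v expiXn -(rmorph_nat (real_complex R)) -rmorphM mulrCA mulfV ?mulr1 ?pnatr_eq0//.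
  by rewrite expi_real cospi sinpi; apply: complex_eqP; rewrite /= ?oppr0.
have u (j : nat) : expi (th + j%:R * (pi / N%:R))%:C = w * v ^+ j.
  by rewrite rmorphD expiD /v expiXn rmorphM rmorph_nat.
pose q (k : nat) := v ^+ (N - k) * v^-1 ^+ k.
have qN (k : 'I_N.+1) : q k ^+ N = 1.
  rewrite /q exprMn -!exprM mulnC [(k * N)%N]mulnC !exprM vN exprVn vN.
  rewrite invrN1 -exprD subnK; last by rewrite -ltnS.
  by rewrite -signr_odd Nm odd_double.
have q1 (k : 'I_N.+1) : k != m :> nat -> q k != 1.
  have kN : (k <= N)%N by rewrite -ltnS.
  apply: contraNneq => qk; apply/eqP; apply: (@cos_angle_eqN1 k m) => //.
  have vk : v ^+ k.*2 = -1.
    have : v ^+ N = v ^+ k.*2.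
      transitivity (v ^+ (N - k) * v ^+ k); first by rewrite -exprD subnK.
      rewrite -addnn exprD; congr (_ * _).
      have vk1 : v^-1 ^+ k != 0 by rewrite expf_neq0// invr_eq0.
      apply: (mulIf vk1); rewrite -[RHS]exprMn mulfV// expr1n; exact: qk.
    by rewrite vN.
  have E2 : expi (k%:R * (pi / m%:R) : R)%:C = -1.
    rewrite -vk /v expiXn -(rmorph_nat (real_complex R)) -rmorphM; congr (expi _%:C).
    have NE : N%:R = 2 * m%:R :> R by rewrite Nm -mul2n natrM.
    rewrite NE -mul2n natrM; have m0 : m%:R != 0 :> R by rewrite pnatr_eq0.
    by field.
  by have := congr1 (fun z : R[i] => Re z) E2; rewrite expi_real.
apply: (@inj_comp _ _ _ _ (fun x => x) (@complexI R)) => //=.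
rewrite /zero_sum rmorph_sum /=.
transitivity ((2^-1) ^+ N * \sum_(j < N) \sum_(k < N.+1)
   (w ^+ (N - k) * w^-1 ^+ k *+ 'C(N, k)) * q k ^+ j).
  rewrite mulr_sumr; apply: eq_bigr => j _; rewrite rmorphXn /= cos_expi u exprMn mulrC.
  congr (_ * _); rewrite exprDn; apply: eq_bigr => k _.
  rewrite mulrnAl; congr (_ *+ _).
  have e1 : (v ^+ j) ^+ (N - k) = (v ^+ (N - k)) ^+ j by rewrite -!exprM mulnC.
  have e2 : (v ^+ j)^-1 ^+ k = (v^-1 ^+ k) ^+ j by rewrite -exprVn -!exprM mulnC.
  rewrite invfM (exprMn _ w) (exprMn _ w^-1) e1 e2 /q [(_ * v^-1 ^+ k) ^+ j]exprMn.
  by rewrite mulrACA.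
rewrite exchange_big /=.
rewrite (bigD1 (inord m : 'I_N.+1))//= [X in _ * (_ + X)]big1 ?addr0; last first.
  move=> k km; rewrite -mulr_sumr sum_root_of_unity ?mulr0//.
  by apply: q1; apply: contraNneq km => km; apply/eqP/val_inj; rewrite /= inordK// ltnS Nm; lia.
have mE : (inord m : 'I_N.+1) = m :> nat by rewrite inordK// ltnS Nm; lia.
rewrite -mulr_sumr mE /q (_ : (N - m)%N = m); last by rewrite Nm; lia.
rewrite -!exprMn !divff// !expr1n; under eq_bigr do rewrite expr1n.
rewrite sumr_const card_ord !rmorphM /= rmorphV /= ?rmorphXn.
  by rewrite !rmorph_nat exprVn mulrC; congr (_ / _); rewrite mulrC.
by rewrite unitfE expf_neq0// pnatr_eq0.
Qed.

Lemma K_odd l :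
  K R l.*2.+1 = 2 * (odd_dfact l)%:R ^+ 2 / (pi * l.*2.+1%:R).
Proof.
rewrite (@K_zero_sum _ l.*2 (l.*2.+2%:R * 'C(l.*2.+2, l.+1)%:R / 2 ^+ l.*2.+2)).
- have : l.*2.+2%:R * l.*2.+1`!%:R * 'C(l.*2.+2, l.+1)%:R =
      2 ^+ l.*2.+2 * (odd_dfact l)%:R ^+ 2 :> R.
    by rewrite -!natrX -!natrM; congr _%:R; rewrite -factS -doubleS central_bin_odd_dfact.
  move: (l.*2.+1`!%:R : R) ('C(_, _)%:R : R) ((odd_dfact l)%:R : R) => F C D E.
  have p0 : pi != 0 :> R by rewrite gt_eqF// pi_gt0.
  have s0 : l.*2.+1%:R != 0 :> R by rewrite pnatr_eq0.
  have t0 : 2 ^+ l.*2.+2 != 0 :> R by rewrite expf_neq0// pnatr_eq0.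
  move: (l.*2.+1%:R : R) (l.*2.+2%:R : R) (2 ^+ l.*2.+2 : R) E s0 t0 => s n t E s0 t0.
  move: (pi : R) p0 => p p0.
  transitivity (2 * (n * F * C / t) / (p * s)); first by field; rewrite ?(p0, s0, t0).
  by rewrite E; field; rewrite p0 s0 t0.
- by move=> th _; rewrite zero_sum_even.
- exists (- (pi / 2)); last exact: zero_sum_even.
  by rewrite /first_zero lexx lerDl divr_ge0 ?pi_ge0.
Qed.

End OddOrder.

(** * The constants of orders two and four *)

Section SmallEvenOrder.
Variable R : realType.
Implicit Types (th x c s : R).

Lemma sin_sqr x : sin x ^+ 2 = 1 - cos x ^+ 2.
Proof. by rewrite -(cos2Dsin2 x); ring. Qed.

Lemma cos_ge0_small (k : nat) : (1 < k)%N -> 0 <= cos (pi / k%:R) :> R.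
Proof.
move=> k1; have p0 := pi_gt0 R; apply: cos_ge0_pihalf; apply/andP; split.
  by rewrite (@le_trans _ _ 0) ?oppr_le0 ?divr_ge0 ?pi_ge0.
by rewrite ler_pM2l// lef_pV2 ?posrE ?ltr0n ?ler_nat// ltnW.
Qed.

(** The angle satisfies [2 x = pi - x]. *)
Lemma cos_pi3 : cos (pi / 3) = 2^-1 :> R.
Proof.
have c0 := @cos_ge0_small 3 isT.
have : cos (pi / 3 + pi / 3) = cos (- (pi / 3) + pi) :> R by congr cos; field.
rewrite cosDpi cosN cosD -!expr2 sin_sqr.
move: (cos (pi / 3)) c0 => c c0 E.
have /eqP : (c + 1) * (2 * c - 1) = 0 by lra.
by rewrite mulf_eq0 => /orP[/eqP|/eqP]; lra.
Qed.

(** The angle satisfies [3 x = pi - 2 x], so its cosine solves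
    [(c + 1) (4 c ^ 2 - 2 c - 1) = 0]. *)
Lemma cos_pi5 : cos (pi / 5) = (1 + Num.sqrt 5) / 4 :> R.
Proof.
have c0 := @cos_ge0_small 5 isT.
have : cos (pi / 5 + pi / 5 + pi / 5) = cos (- (pi / 5 + pi / 5) + pi) :> R by congr cos; field.
rewrite cosDpi cosN !cosD sinD.
have s2 : sin (pi / 5) * sin (pi / 5) = 1 - cos (pi / 5) ^+ 2 :> R.
  by rewrite -expr2 sin_sqr.
have r2 : Num.sqrt 5 ^+ 2 = 5 :> R by rewrite sqr_sqrtr.
have r0 : 0 <= Num.sqrt 5 :> R by exact: sqrtr_ge0.
have r1 : 2 < Num.sqrt 5 :> R by nra.
move: (cos (pi / 5)) (sin (pi / 5)) (Num.sqrt 5) c0 s2 r2 r1 => c s r c0 s2 r2 r1 E.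
have /eqP : (c + 1) * ((c - (1 + r) / 4) * (c - (1 - r) / 4)) = 0.
  have -> : (c + 1) * ((c - (1 + r) / 4) * (c - (1 - r) / 4)) =
    (c + 1) * (c ^+ 2 - c / 2 + (1 - r ^+ 2) / 16) by field.
  rewrite r2; have E' : (c * c - s * s) * c - (s * c + c * s) * s = - (c * c - s * s) by lra.
  have E2 : c ^+ 3 - 3 * c * (s * s) + c ^+ 2 - s * s = 0 by rewrite -(subr0 (s * s)); nra.
  rewrite s2 in E2; nra.
rewrite !mulf_eq0 => /orP[/eqP|/orP[/eqP|/eqP]]; lra.
Qed.

(** The three zeros are [x - pi / 3], [x] and [x + pi / 3]. *)
Lemma zero_sum1 th : let c := cos (th + pi / 3) in
  zero_sum 1 th = 9 / 4 * c - c ^+ 3.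
Proof.
move=> c; rewrite /zero_sum !big_ord_recr big_ord0 /= add0r.
pose x := th + pi / 3; pose g : R := pi / 3.
have -> : th + 0 * (pi / 3) = x - g by rewrite /x /g; ring.
have -> : th + 1 * (pi / 3) = x by rewrite /x; ring.
have -> : th + 2 * (pi / 3) = x + g by rewrite /x /g; ring.
rewrite cosB cosD /c -/x /g cos_pi3 -/g.
have s2 := sin_sqr x.
have g2 : sin g ^+ 2 = 3 / 4 by rewrite sin_sqr /g cos_pi3; field.
move: (cos x) (sin x) (sin g) s2 g2 => C S G s2 g2.
transitivity (C ^+ 3 * 5 / 4 + 3 * C * S ^+ 2 * G ^+ 2); first by field.
by rewrite s2 g2; field.
Qed.

(** The cubic [9 / 4 c - c ^ 3] has its maximum over [c >= 0] at half the square
    root of 3, where the difference has a double zero; this value of the cosine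
    belongs to the first zero [- pi / 2]. *)
Lemma K_2 : K R 2 = 3 * Num.sqrt 3 / (2 * pi).
Proof.
have r2 : Num.sqrt 3 ^+ 2 = 3 :> R by rewrite sqr_sqrtr.
have r0 : 0 <= Num.sqrt 3 :> R by exact: sqrtr_ge0.
have p0 := pi_gt0 R.
rewrite (@K_zero_sum _ 1 (3 * Num.sqrt 3 / 4)).
- have -> : 2`! = 2%N by [].
  by move: (pi : R) (lt0r_neq0 p0) => p pn0; field.
- move=> th /andP[h1 h2]; rewrite zero_sum1.
  have : 0 <= cos (th + pi / 3) by apply: cos_ge0_pihalf; apply/andP; split; lra.
  move: (cos _) (Num.sqrt 3) r2 r0 => c r r2 r0 c0.
  have : 0 <= (c - r / 2) ^+ 2 * (c + r) by rewrite mulr_ge0 ?sqr_ge0 ?addr_ge0.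
  rewrite (_ : _ * _ = c ^+ 3 - r ^+ 2 * c * 3 / 4 + r ^+ 2 * r / 4); last by field.
  by rewrite r2; lra.
- exists (- (pi / 2)); first by rewrite /first_zero lexx lerDl divr_ge0 ?pi_ge0.
  rewrite zero_sum1 [- (pi / 2) + _]addrC cosBpihalf.
  have -> : sin (pi / 3) = Num.sqrt 3 / 2 :> R.
    have s0 : 0 <= sin (pi / 3) :> R by apply: sin_ge0_pi; apply/andP; split; lra.
    apply/eqP; rewrite -(@eqrXn2 _ 2)// ?divr_ge0//; apply/eqP.
    by rewrite sin_sqr cos_pi3 exprMn r2; field.
  rewrite (_ : _ - _ = 9 / 4 * (Num.sqrt 3 / 2) - Num.sqrt 3 ^+ 2 * Num.sqrt 3 / 8); last by field.
  by rewrite r2; field.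
Qed.

(** The five zeros are symmetric about the middle one, so only even powers of its
    sine survive. *)
Lemma zero_sum3 th : let c := cos (th + 2 * (pi / 5)) in
  zero_sum 3 th = c ^+ 5 - 5 * Num.sqrt 5 / 4 * c ^+ 3 + 25 * Num.sqrt 5 / 16 * c.
Proof.
move=> c; rewrite /zero_sum !big_ord_recr big_ord0 /= add0r.
pose x := th + 2 * (pi / 5); pose g : R := pi / 5.
have -> : th + 0 * (pi / 5) = x - (g + g) by rewrite /x /g; ring.
have -> : th + 1 * (pi / 5) = x - g by rewrite /x /g; ring.
have -> : th + 2 * (pi / 5) = x by rewrite /x; ring.
have -> : th + 3 * (pi / 5) = x + g by rewrite /x /g; ring.
have -> : th + 4 * (pi / 5) = x + (g + g) by rewrite /x /g; ring.
rewrite !(cosB x) !(cosD x) /c -/x.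
have c1 : cos g = (1 + Num.sqrt 5) / 4 by exact: cos_pi5.
have r2 : Num.sqrt 5 ^+ 2 = 5 :> R by rewrite sqr_sqrtr.
have c2 : cos (g + g) = (Num.sqrt 5 - 1) / 4.
  rewrite cosD -!expr2 sin_sqr c1.
  rewrite (_ : _ - _ = (2 * Num.sqrt 5 ^+ 2 + 4 * Num.sqrt 5 - 14) / 16); last by field.
  by rewrite r2; field.
have sx := sin_sqr x; have s1 := sin_sqr g; have s2' := sin_sqr (g + g).
move: (cos x) (sin x) (sin g) (sin (g + g)) (cos g) (cos (g + g)) (Num.sqrt 5) sx s1 s2' c1 c2 r2.
move=> C S S1 S2 C1 C2 r sx s1 s2' c1 c2 r2.
transitivity (C ^+ 5 * (1 + 2 * (C1 ^+ 5 + C2 ^+ 5)) +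
  20 * C ^+ 3 * S ^+ 2 * (C1 ^+ 3 * S1 ^+ 2 + C2 ^+ 3 * S2 ^+ 2) +
  10 * C * (S ^+ 2) ^+ 2 * (C1 * (S1 ^+ 2) ^+ 2 + C2 * (S2 ^+ 2) ^+ 2)); first by ring.
have E1 : C1 ^+ 5 + C2 ^+ 5 = 5 * r / 32.
  transitivity ((2 * (r ^+ 2) ^+ 2 * r + 20 * r ^+ 2 * r + 10 * r) / 1024).
    by rewrite c1 c2; field.
  by rewrite r2; field.
have e1 : S1 ^+ 2 = (5 - r) / 8.
  rewrite s1 c1 (_ : _ - _ = (15 - 2 * r - r ^+ 2) / 16); last by field.
  by rewrite r2; field.
have e2 : S2 ^+ 2 = (5 + r) / 8.
  rewrite s2' c2 (_ : _ - _ = (15 + 2 * r - r ^+ 2) / 16); last by field.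
  by rewrite r2; field.
have E2 : C1 ^+ 3 * S1 ^+ 2 + C2 ^+ 3 * S2 ^+ 2 = 3 * r / 32.
  rewrite c1 c2 e1 e2.
  transitivity ((r ^+ 2 * r * 4 + r * 28) / 512); first by field.
  by rewrite r2; field.
have E3 : C1 * (S1 ^+ 2) ^+ 2 + C2 * (S2 ^+ 2) ^+ 2 = 5 * r / 32.
  rewrite c1 c2 e1 e2.
  transitivity ((r ^+ 2 * r * 2 + r * 30) / 256); first by field.
  by rewrite r2; field.
by rewrite E1 E2 E3 sx; field.
Qed.

(** The difference quotient at 1 is positive: with the square root of 5 bounded by
    [224 / 100], its coefficients in powers of [c - 95 / 100] are. *)
Lemma quintic_le (c r : R) : r ^+ 2 = 5 -> 2 <= r -> 95 / 100 <= c <= 1 ->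
  c ^+ 5 - 5 * r / 4 * c ^+ 3 + 25 * r / 16 * c <= 1 + 5 * r / 16.
Proof.
move=> r2 r0 /andP[c0 c1].
have r1 : r <= 224 / 100 by nra.
rewrite -subr_ge0.
have -> : 1 + 5 * r / 16 - (c ^+ 5 - 5 * r / 4 * c ^+ 3 + 25 * r / 16 * c) =
    (1 - c) * ((1 + c + c ^+ 2 + c ^+ 3 + c ^+ 4) - 5 / 16 * r * (4 * (1 + c + c ^+ 2) - 5)).
  by field.
apply: mulr_ge0; first by rewrite subr_ge0.
have q0 : 0 <= 4 * (1 + c + c ^+ 2) - 5 by have := sqr_ge0 c; move: (c ^+ 2) => d; lra.
have q1 : r * (4 * (1 + c + c ^+ 2) - 5) <= (224 / 100) * (4 * (1 + c + c ^+ 2) - 5).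
  exact: ler_wpM2r.
pose u := c - 95 / 100.
have u0 : 0 <= u by rewrite subr_ge0.
have pos (v : R) : 0 <= v ->
    0 <= v ^+ 4 + 24 / 5 * v ^+ 3 + 1293 / 200 * v ^+ 2 + 917 / 1000 * v + 5981 / (400 * 400).
  move=> v0; have := exprn_ge0 4 v0; have := exprn_ge0 3 v0; have := exprn_ge0 2 v0.
  move: (v ^+ 4) (v ^+ 3) (v ^+ 2) => v4 v3 v2; lra.
have := pos u u0.
have -> : u ^+ 4 + 24 / 5 * u ^+ 3 + 1293 / 200 * u ^+ 2 + 917 / 1000 * u +
    5981 / (400 * 400) = (1 + c + c ^+ 2 + c ^+ 3 + c ^+ 4) -
    5 / 16 * ((224 / 100) * (4 * (1 + c + c ^+ 2) - 5)) by rewrite /u; field.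
move=> /le_trans; apply; rewrite lerB// -mulrA ler_wpM2l ?divr_ge0//.
Qed.

(** The value at [pi / 10] is the square root of [(5 + sqrt 5) / 8], slightly more
    than the bound. *)
Lemma cos_ge_pi10 x : `|x| <= pi / 10 -> 95 / 100 <= cos x.
Proof.
move=> xp; have p0 := pi_gt0 R.
have cx : 0 <= cos x.
  by apply: cos_ge0_pihalf; move: xp; rewrite ler_norml => /andP[? ?]; apply/andP; split; lra.
have c2 : cos (pi / 5) <= cos (x + x).
  have -> : cos (x + x) = cos (2 * `|x|).
    have [x0|x0] := ger0P x; first by congr cos; ring.
    by rewrite -cosN; congr cos; ring.
  have x0 := normr_ge0 x.
  rewrite leNgt ltr_cos ?in_itv/=; [rewrite -leNgt; lra| |]; apply/andP; split; lra.
move: c2; rewrite cos_pi5 cosD -!expr2 sin_sqr => c2.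
have r2 : Num.sqrt 5 ^+ 2 = 5 :> R by rewrite sqr_sqrtr.
have r0 : 0 <= Num.sqrt 5 :> R by exact: sqrtr_ge0.
move: (cos x) (Num.sqrt 5) cx c2 r2 r0 => c r c0 c2 r2 r0.
have r1 : 2236 / 1000 <= r by nra.
nra.
Qed.

(** The maximum is attained when the middle zero is 0. *)
Lemma K_4 : K R 4 = 3 * (16 + 5 * Num.sqrt 5) / (4 * pi).
Proof.
have r2 : Num.sqrt 5 ^+ 2 = 5 :> R by rewrite sqr_sqrtr.
have r0 : 0 <= Num.sqrt 5 :> R by exact: sqrtr_ge0.
have r1 : 2 <= Num.sqrt 5 :> R by nra.
have p0 := pi_gt0 R.
rewrite (@K_zero_sum _ 3 (1 + 5 * Num.sqrt 5 / 16)).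
- have -> : 4`! = 24%N by [].
  by move: (pi : R) (lt0r_neq0 p0) => p pn0; field.
- move=> th /andP[h1 h2]; rewrite zero_sum3; apply: quintic_le => //.
  rewrite cos_le1 andbT; apply: cos_ge_pi10; rewrite ler_norml; apply/andP; split; lra.
- exists (- (2 * (pi / 5))); first by apply/andP; split; lra.
  by rewrite zero_sum3 addNr cos0; field.
Qed.

End SmallEvenOrder.
Theorem theorem3 (R : realType) :
  (forall s : nat, (0 < s)%N ->
    [/\ (* the supremum in the definition of [K] is a maximum *)
        exists a0 : R, forall a : R, K_integral s a <= K_integral s a0,
        forall (G : set R[i]) (f : R[i] -> R[i]),
          convex_domain G ->
          holomorphic_on (~` closure G) f ->
          bounded_Re (~` closure G) f ->
          forall z : R[i], (~` closure G) z ->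
            cmod (cderiv s f z)
              <= K R s / dist z (boundary (~` closure G)) ^+ s
                 * sup_Re (~` closure G) f,
        half_plane_estimate s (K R s)
      & forall C : R, half_plane_estimate s C -> K R s <= C]) /\
  [/\ forall l : nat,
        K R l.*2.+1 = 2 * (odd_dfact l)%:R ^+ 2 / (pi * l.*2.+1%:R),
      K R 2 = 3 * Num.sqrt 3 / (2 * pi)
    & K R 4 = 3 * (16 + 5 * Num.sqrt 5) / (4 * pi)].
Proof.
split=> [s s0|]; last by split; [exact: K_odd|exact: K_2|exact: K_4].
split.
- by case: s s0 => // s _; exact: K_integral_max.
- by move=> G f cG hf bf z zG; exact: convex_exterior_estimate.
- exact: half_plane_estimate_K.
- by move=> C; exact: half_plane_estimate_sharp.
Qed.
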